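(* Let $\gamma>0$, let $\Omega\subset\mathbb{R}^N$ be a bounded smooth domain, and let $u\in C(\overline{\Omega})\cap C^2(\Omega)$ be a solution to $$\begin{cases} -\Delta u=\dfrac{1}{u^\gamma}+f(x,u) & \text{in }\Omega,\\ u>0 & \text{in }\Omega,\\ u=0 & \text{on }\partial\Omega.\end{cases}$$ Assume that the domain $\Omega$ is convex with respect to the $\nu$-direction ($\nu\in S^{N-1}$) and symmetric with respect to $T_0^\nu$, where $$T_0^\nu=\{x\in\mathbb{R}^N: x\cdot\nu=0\}.$$ With the notation $x_\lambda^\nu=R_\lambda^\nu(x)=x+2(\lambda-x\cdot\nu)\nu$, assume that $f$ satisfies the following condition $(hp)$: $f(x,t)$ is a Carathéodory function which is uniformly locally Lipschitz continuous with respect to the second variable, namely, for any given $M>0$ there is a constant $L_f(M)$ such that $$|f(x,t_1)-f(x,t_2)|\le L_f(M)\,|t_1-t_2|,\qquad x\in\Omega,\ t_1,t_2\in[0,M].$$ Assume moreover that $f(\cdot,t)$ is non-decreasing in the $x\cdot\nu$-direction in the set $\Omega_0^\nu:=\Omega\cap\{x\cdot\nu<0\}$, for all $t\in[0,\infty)$, and that $$f(x,t)=f(x_0^\nu,t)\qquad\text{if } x\in\Omega_0^\nu\text{ and } t\in[0,\infty).$$ Then $u$ is symmetric with respect to $T_0^\nu$ and non-decreasing with respect to the $\nu$-direction in $\Omega_0^\nu$. In particular, if $\Omega$ is a ball centered at the origin of radius $R>0$, then $u$ is radially symmetric with $\frac{\partial u}{\partial r}(r)<0$ for $0<r<R$.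
   Context: The equation is understood in the weak distributional sense with compactly supported test functions: $\int_\Omega (\nabla u,\nabla\varphi)\,dx=\int_\Omega \frac{\varphi}{u^\gamma}\,dx+\int_\Omega f(x,u)\varphi\,dx$ for all $\varphi\in C^1_c(\Omega)$. Carathéodory function: $f(\cdot,t)$ is measurable for every $t$, and $f(x,\cdot)$ is continuous for a.e. $x$. $\Omega$ is convex with respect to the $\nu$-direction if every segment parallel to $\nu$ with endpoints in $\Omega$ is contained in $\Omega$. The map $R_\lambda^\nu$ is the reflection through the hyperplane $T_\lambda^\nu=\{x\in\mathbb{R}^N: x\cdot\nu=\lambda\}$; in particular $x_0^\nu=x-2(x\cdot\nu)\nu$. $\Omega$ is symmetric with respect to $T_0^\nu$ if it is invariant under $x\mapsto x_0^\nu$, and $u$ is symmetric with respect to $T_0^\nu$ if $u(x)=u(x_0^\nu)$ for all $x\in\Omega$. A function $g$ is non-decreasing in (with respect to) the $\nu$-direction (equivalently, the $x\cdot\nu$-direction) in $\Omega_0^\nu$ if $g(x)\le g(x+s\nu)$ whenever $s\ge 0$ and $x,\,x+s\nu\in\Omega_0^\nu$. In the ball case, $r=|x|$ and $u$ is regarded as a function of $r$.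
   Formalization: In the ball case, the monotonicity and symmetry assumptions on f are required for every direction ν, not just one; with one direction only the radial claim fails, e.g. f(x,t)=g(x_2) on a disc with ν=e_1. *)

(* Defs.v *)
From HB Require Import structures.
From mathcomp Require Import all_boot all_order all_algebra.
From mathcomp Require Import all_classical all_reals all_analysis.
Set Implicit Arguments.
Unset Strict Implicit.
Unset Printing Implicit Defensive.
Import Order.TTheory GRing.Theory Num.Theory.
Import numFieldNormedType.Exports.
Local Open Scope classical_set_scope.
Local Open Scope ring_scope.

(* The points of R^N are the row vectors 'rV[R]_N. The norm of the library on
   'rV[R]_N is the sup norm; it is only used through the topology and the
   bounded sets it induces. The Euclidean norm is [enorm]. *)

Definition dot (R : realType) (N : nat) (x y : 'rV[R]_N) : R :=
  \sum_(i < N) x ord0 i * y ord0 i.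

Definition enorm (R : realType) (N : nat) (x : 'rV[R]_N) : R :=
  Num.sqrt (dot x x).

Definition eball (R : realType) (N : nat) (r : R) : set 'rV[R]_N :=
  [set x | enorm x < r].

(* Lebesgue measure on R^N: the product Borel sigma-algebra, the N-fold
   product of the one-dimensional Lebesgue measure, and its completion. *)

Section rV_measurable.
Context {R : realType} (N : nat).

Let coord (i : 'I_N) (x : 'rV[R]_N) : R := x ord0 i.

Let rV_set0 : g_sigma_preimage coord set0.
Proof. exact: sigma_algebra0. Qed.

Let rV_setC A : g_sigma_preimage coord A -> g_sigma_preimage coord (~` A).
Proof. exact: sigma_algebraC. Qed.

Let rV_bigcup (F : (set 'rV[R]_N)^nat) :
  (forall i, g_sigma_preimage coord (F i)) ->
  g_sigma_preimage coord (\bigcup_i (F i)).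
Proof. exact: sigma_algebra_bigcup. Qed.

HB.instance Definition _ :=
  @isMeasurable.Build (measure_tuple_display default_measure_display)
    'rV[R]_N (g_sigma_preimage coord) rV_set0 rV_setC rV_bigcup.

Lemma measurable_coord_rV (i : 'I_N) :
  measurable_fun [set: 'rV[R]_N] (fun x : 'rV[R]_N => x ord0 i).
Proof.
move=> _ Y mY; rewrite setTI; apply: sub_sigma_algebra => /=.
rewrite -bigcup_seq/=; exists i => /=; first by rewrite mem_index_enum.
by exists Y => //; rewrite setTI.
Qed.

Lemma measurable_fun_rVP d (T : measurableType d) (f : T -> 'rV[R]_N) :
  (forall i, measurable_fun [set: T] (fun x => f x ord0 i)) ->
  measurable_fun [set: T] f.
Proof.
move=> mf.
have prefS : g_sigma_preimage (fun i => coord i \o f) `<=` measurable.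
  apply: smallest_sub; first exact: sigma_algebra_measurable.
  rewrite -bigcup_seq; apply: bigcup_sub => i _ A [B mB <-].
  exact: mf.
move=> _ A mA; apply: prefS; rewrite g_sigma_preimage_comp.
by exists A.
Qed.

End rV_measurable.

Definition rV_cons (R : realType) (N : nat) (p : R * 'rV[R]_N) : 'rV[R]_N.+1 :=
  row_mx (p.1%:M : 'rV_1) p.2.

Lemma rV_cons0 (R : realType) (N : nat) (p : R * 'rV[R]_N) :
  rV_cons p ord0 ord0 = p.1.
Proof.
have <- : lshift N (ord0 : 'I_1) = ord0 by exact/val_inj.
by apply: (etrans (row_mxEl _ _ _ _)); rewrite !mxE eqxx mulr1n.
Qed.

Lemma rV_consS (R : realType) (N : nat) (p : R * 'rV[R]_N) (i : 'I_N) :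
  rV_cons p ord0 (lift ord0 i) = p.2 ord0 i.
Proof.
have <- : rshift 1 i = lift ord0 i by exact/val_inj.
exact: row_mxEr.
Qed.

Lemma measurable_rV_cons (R : realType) (N : nat) :
  measurable_fun [set: R * 'rV[R]_N] (@rV_cons R N).
Proof.
apply: measurable_fun_rVP => i.
case: (unliftP ord0 i) => [j ->|->].
  under eq_fun do rewrite rV_consS.
  exact: (measurableT_comp (measurable_coord_rV j) measurable_snd).
under eq_fun do rewrite rV_cons0.
exact: measurable_fst.
Qed.

Section borel_lebesgue_step.
Context (R : realType) (N : nat).
Variable m : {sigma_finite_measure set 'rV[R]_N -> \bar R}.

Definition borel_lebesgue_step : set 'rV[R]_N.+1 -> \bar R :=
  pushforward (@lebesgue_measure R \x m)%E (@rV_cons R N).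

Let preimage_cons A : measurable A ->
  measurable (@rV_cons R N @^-1` A : set (measurableTypeR R * 'rV[R]_N)).
Proof.
by move=> mA; rewrite -[X in measurable X]setTI; exact: measurable_rV_cons.
Qed.

Let borel_lebesgue_step0 : borel_lebesgue_step set0 = 0%E.
Proof.
by rewrite /borel_lebesgue_step /pushforward preimage_set0 measure0.
Qed.

Let borel_lebesgue_step_ge0 A : (0 <= borel_lebesgue_step A)%E.
Proof. by rewrite /borel_lebesgue_step /pushforward. Qed.

Let borel_lebesgue_step_sigma_additive :
  semi_sigma_additive borel_lebesgue_step.
Proof.
move=> F mF tF mUF; rewrite /borel_lebesgue_step /pushforward preimage_bigcup.
apply: measure_semi_sigma_additive.
- by move=> n; exact: preimage_cons.
- apply/trivIsetP => /= i j _ _ ij; rewrite -preimage_setI.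
  by move/trivIsetP : tF => /(_ _ _ _ _ ij) ->//; rewrite preimage_set0.
- by rewrite -preimage_bigcup; exact: preimage_cons.
Qed.

HB.instance Definition _ := isMeasure.Build _ _ _ borel_lebesgue_step
  borel_lebesgue_step0 borel_lebesgue_step_ge0
  borel_lebesgue_step_sigma_additive.

Let borel_lebesgue_step_sigma_finite : sigma_finite setT borel_lebesgue_step.
Proof.
have /sigma_finiteP[E [TE ndE Eoo]] := sigma_finiteT (@lebesgue_measure R).
have /sigma_finiteP[F [TF ndF Foo]] := sigma_finiteT m.
pose tl (x : 'rV[R]_N.+1) : R * 'rV[R]_N :=
  (x ord0 ord0, \row_j x ord0 (lift ord0 j)).
have consK : cancel (@rV_cons R N) tl.
  move=> [a y]; rewrite /tl rV_cons0; congr pair.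
  by apply/rowP => j; rewrite mxE [LHS]rV_consS.
have tlK : cancel tl (@rV_cons R N).
  move=> x; apply/rowP => i; case: (unliftP ord0 i) => [j ->|->].
    by rewrite rV_consS mxE.
  by rewrite rV_cons0.
have mtl : measurable_fun setT tl.
  apply/measurable_fun_pairP; split; first exact: measurable_coord_rV.
  apply: measurable_fun_rVP => j /=.
  under eq_fun do rewrite mxE.
  exact: measurable_coord_rV.
exists (fun k => tl @^-1` (E k `*` F k)).
  apply/seteqP; split => // x _.
  have [i _ Ei] : (\bigcup_k E k) (tl x).1 by rewrite -TE.
  have [j _ Fj] : (\bigcup_k F k) (tl x).2 by rewrite -TF.
  exists (maxn i j) => //; split.
    by move: Ei; exact/subsetPset/ndE/leq_maxl.
  by move: Fj; exact/subsetPset/ndF/leq_maxr.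
move=> k; have [mE Ek] := Eoo k; have [mF Fk] := Foo k; split.
  by rewrite -[X in measurable X]setTI; apply: mtl => //; exact: measurableX.
rewrite /borel_lebesgue_step /pushforward -comp_preimage.
rewrite (_ : tl \o _ = id); last by apply/funext => p /=; rewrite consK.
by rewrite preimage_id product_measure1E// lte_mul_pinfty// ge0_fin_numE.
Qed.


HB.instance Definition _ := Measure_isSigmaFinite.Build _ _ _
  borel_lebesgue_step borel_lebesgue_step_sigma_finite.

End borel_lebesgue_step.

Fixpoint borel_lebesgue (R : realType) (N : nat) :
    {sigma_finite_measure set 'rV[R]_N -> \bar R} :=
  match N with
  | 0%N => [the {sigma_finite_measure set 'rV[R]_0 -> \bar R} of \d_(0 : 'rV[R]_0)]
  | n.+1 => [the {sigma_finite_measure set 'rV[R]_n.+1 -> \bar R} of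
              borel_lebesgue_step (borel_lebesgue R n)]
  end.

(* [lebesgue_space R N] is R^N equipped with the Lebesgue-measurable sets. *)

Definition lebesgue_space (R : realType) (N : nat) :=
  caratheodory_type (borel_lebesgue R N)^*%mu.

Definition lebesgue (R : realType) (N : nat) :
    {measure set (lebesgue_space R N) -> \bar R} :=
  [the {measure set (lebesgue_space R N) -> \bar R} of
    @completed_measure_extension _ _ _ (borel_lebesgue R N)].

Definition partial (R : realType) (N : nat) (i : 'I_N) (g : 'rV[R]_N -> R) :
    'rV[R]_N -> R :=
  'D_(delta_mx ord0 i) g.

Definition gradient (R : realType) (N : nat) (g : 'rV[R]_N -> R)
    (x : 'rV[R]_N) : 'rV[R]_N :=
  \row_(i < N) partial i g x.

(* g is of class C^k on the open set A. *)
Fixpoint is_Ck (R : realType) (N : nat) (k : nat) (A : set 'rV[R]_N)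
    (g : 'rV[R]_N -> R) : Prop :=
  (forall x, A x -> {for x, continuous g}) /\
  match k with
  | 0%N => True
  | j.+1 => forall i : 'I_N,
      (forall x, A x -> derivable g x (delta_mx ord0 i)) /\
      is_Ck j A (partial i g)
  end.

(* C^1_c(A): such functions are extended by 0 to the whole space. *)
Definition is_C1c (R : realType) (N : nat) (A : set 'rV[R]_N)
    (phi : 'rV[R]_N -> R) : Prop :=
  [/\ is_Ck 1 setT phi,
      compact (closure [set x | phi x != 0]) &
      closure [set x | phi x != 0] `<=` A].

Definition bdry (R : realType) (N : nat) (A : set 'rV[R]_N) : set 'rV[R]_N :=
  closure A `\` interior A.

(* Near each of its boundary points, A is the sublevel set {rho < 0} of a
   C^infinity function rho with nonvanishing gradient at that point. *)
Definition smooth_boundary (R : realType) (N : nat) (A : set 'rV[R]_N) :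
    Prop :=
  forall p, bdry A p ->
    exists (V : set 'rV[R]_N) (rho : 'rV[R]_N -> R),
      [/\ open V, V p, (forall k, is_Ck k V rho), gradient rho p != 0 &
          forall x, V x -> (A x <-> rho x < 0)].

Definition bounded_smooth_domain (R : realType) (N : nat)
    (Omega : set 'rV[R]_N) : Prop :=
  [/\ Omega !=set0, open Omega, connected Omega, bounded_set Omega &
      smooth_boundary Omega].

(* Reflection through the hyperplane {x . nu = lambda}. *)
Definition reflection (R : realType) (N : nat) (nu : 'rV[R]_N) (lambda : R)
    (x : 'rV[R]_N) : 'rV[R]_N :=
  x + (2 * (lambda - dot x nu)) *: nu.

Definition convex_dir (R : realType) (N : nat) (nu : 'rV[R]_N)
    (A : set 'rV[R]_N) : Prop :=
  forall (x : 'rV[R]_N) (s : R), A x -> A (x + s *: nu) ->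
    forall t : R, 0 <= t <= 1 -> A (x + (t * s) *: nu).

Definition symmetric_dir (R : realType) (N : nat) (nu : 'rV[R]_N)
    (A : set 'rV[R]_N) : Prop :=
  reflection nu 0 @` A = A.

Definition left_cap (R : realType) (N : nat) (nu : 'rV[R]_N)
    (Omega : set 'rV[R]_N) : set 'rV[R]_N :=
  Omega `&` [set x | dot x nu < 0].

Definition nondecreasing_dir (R : realType) (N : nat) (nu : 'rV[R]_N)
    (A : set 'rV[R]_N) (g : 'rV[R]_N -> R) : Prop :=
  forall (x : 'rV[R]_N) (s : R), 0 <= s -> A x -> A (x + s *: nu) ->
    g x <= g (x + s *: nu).

(* A nonlinearity f(x,t) is only relevant for x in Omega and t >= 0. *)

Definition caratheodory_fun (R : realType) (N : nat) (Omega : set 'rV[R]_N)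
    (f : 'rV[R]_N -> R -> R) : Prop :=
  (forall t : R, 0 <= t ->
     measurable_fun (Omega : set (lebesgue_space R N))
       (fun x : lebesgue_space R N => f x t)) /\
  {ae lebesgue R N, forall x : lebesgue_space R N,
     Omega x -> {within `[0, +oo[%classic, continuous (f x)}}.

Definition hp (R : realType) (N : nat) (Omega : set 'rV[R]_N)
    (f : 'rV[R]_N -> R -> R) : Prop :=
  caratheodory_fun Omega f /\
  forall M : R, 0 < M -> exists L : R,
    forall (x : 'rV[R]_N) (t1 t2 : R), Omega x ->
      0 <= t1 <= M -> 0 <= t2 <= M ->
      `|f x t1 - f x t2| <= L * `|t1 - t2|.

Definition monotone_symmetric_dir (R : realType) (N : nat) (nu : 'rV[R]_N)
    (Omega : set 'rV[R]_N) (f : 'rV[R]_N -> R -> R) : Prop :=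
  (forall t : R, 0 <= t ->
     nondecreasing_dir nu (left_cap nu Omega) (fun x => f x t)) /\
  (forall (x : 'rV[R]_N) (t : R), left_cap nu Omega x -> 0 <= t ->
     f x t = f (reflection nu 0 x) t).

(* - Delta u = u^(- gamma) + f(x,u) in Omega, in the sense of distributions.
   The integrals of (nabla u, nabla phi) and of phi / u^gamma converge as soon
   as u is C^1 and positive in Omega; that of f(x,u) phi has to be required to,
   since [Rintegral] is total. *)
Definition weak_solution (R : realType) (N : nat) (Omega : set 'rV[R]_N)
    (gamma : R) (f : 'rV[R]_N -> R -> R) (u : 'rV[R]_N -> R) : Prop :=
  forall phi : 'rV[R]_N -> R, is_C1c Omega phi ->
    (lebesgue R N).-integrable (Omega : set (lebesgue_space R N))
      (fun x : lebesgue_space R N => (f x (u x) * phi x)%:E) /\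
    \int[lebesgue R N]_(x in Omega) dot (gradient u x) (gradient phi x) =
    \int[lebesgue R N]_(x in Omega) (phi x / (u x `^ gamma)) +
    \int[lebesgue R N]_(x in Omega) (f x (u x) * phi x).

Definition solution (R : realType) (N : nat) (Omega : set 'rV[R]_N)
    (gamma : R) (f : 'rV[R]_N -> R -> R) (u : 'rV[R]_N -> R) : Prop :=
  [/\ weak_solution Omega gamma f u,
      (forall x, Omega x -> 0 < u x) &
      (forall x, bdry Omega x -> u x = 0)].

(* u is radially symmetric in the ball of radius rad, with strictly negative
   radial derivative; v is u as a function of r = |x|. *)
Definition radially_decreasing (R : realType) (N : nat) (rad : R)
    (u : 'rV[R]_N -> R) : Prop :=
  exists v : R -> R,
    (forall x, eball rad x -> u x = v (enorm x)) /\
    (forall r : R, 0 < r < rad -> derivable v r 1 /\ derive1 v r < 0).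

(* Main.v *)
Require Import Defs.
From HB Require Import structures.
From mathcomp Require Import all_boot all_order all_algebra.
From mathcomp Require Import all_classical all_reals all_analysis.
From mathcomp Require Import measurable_realfun ring lra.
Set Implicit Arguments.
Unset Strict Implicit.
Unset Printing Implicit Defensive.
Import Order.TTheory GRing.Theory Num.Theory.
Import numFieldNormedType.Exports.
Local Open Scope classical_set_scope.
Local Open Scope ring_scope.

(** The proof moves hyperplanes T_lambda = {x . nu = lambda} from the far left
    up to lambda = 0, as Gidas, Ni and Nirenberg do. Extend u by 0 to a
    continuous function U on the whole space, write x_lambda for the reflection
    of x, and compare U with its reflection on the cap Omega_lambda = Omega
    intersected with {x . nu < lambda}: the claim is U(x) <= U(x_lambda) there,
    for every lambda < 0. Monotonicity is this claim for the lambda that maps one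
    point of a line to another, symmetry is the limit lambda -> 0 in the
    directions nu and - nu.

    Only classical C^2 arguments are used for the comparison, because the
    equation gives a pointwise inequality even though f is merely measurable in
    x. Put h = - Delta U - U^(- gamma), which is continuous. Testing with a
    radial bump phi around x gives int f(y, U(y)) phi = int h phi
    ([weak_source]), and a bump around x_lambda is the reflection of the bump
    around x. At the points y of the cap with y_lambda not on T_0, f(y, U(y)) is
    at most f(y_lambda, U(y_lambda)) + L |U(y) - U(y_lambda)|, by the
    monotonicity and symmetry of f and its Lipschitz bound. Integrating against phi, and using
    that Lebesgue measure is invariant under reflections, transfers this
    inequality to h, and shrinking the bump makes it pointwise ([source_le]);
    continuity recovers the excluded points ([source_reflection]). The invariance in turn follows from translation
    invariance by Fubini, in the way one proves uniqueness of Haar measure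
    ([measure_involution]).

    So w = U - U(x_lambda) satisfies, where w > 0,
      - Delta w <= U^(- gamma) - U(x_lambda)^(- gamma) + L w.
    Where U is small the singular term wins over L w ([powRV_steep]), so the
    right-hand side is negative and w has no positive maximum there. This
    replaces the usual maximum principle near the boundary, where the gradient of
    u may blow up and the Hopf lemma is not available. On the remaining set
    {U >= delta}, which is compact in Omega, everything is smooth.

    Suppose the claim holds for some lambda < 0. If w vanished at a point of the
    cap, the strong maximum principle would propagate the zero along - nu up to
    the exit point q of Omega; but U(q) = 0 while q_lambda lies inside Omega, by
    convexity and symmetry, so U(q_lambda) > 0. Hence w < 0 in the cap
    ([cap_lt]), and the Hopf lemma gives d U / d nu > 0 at the points of
    T_lambda in Omega ([hopf_hyperplane]). By compactness the comparison
    persists on {U >= delta} for planes slightly further right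
    ([cap_le_near_compact]), and the singular term takes care of the rest
    ([cap_le_extend]). So the planes never stop before 0 ([cap_le_all]).
    Both the strong maximum principle and the Hopf lemma come from one
    exponential barrier ([positivity_barrier]).

    In a ball every direction is admissible. Two points of a sphere are mirror
    images of one another, so u is radial, and the Hopf lemma on T_(-r) for
    nu = - e_0, at the point r e_0, says that the radial derivative is
    negative. *)

Local Notation "''e_' i" := (delta_mx ord0 i) (at level 8, i at level 2).

(** * Euclidean geometry and hyperplane reflections *)

Lemma continuous_sumr (R : realType) (T : topologicalType) (x : T)
    (N : nat) (f : 'I_N -> T -> R) :
  (forall i, {for x, continuous (f i)}) ->
  {for x, continuous (fun z => \sum_(i < N) f i z)}.
Proof.
move=> fa; apply: (@cvg_big _ _ _ _ _ _ _ (nbhs x)) => [|i _]; last exact: fa.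
exact: add_continuous.
Qed.

Section euclid.
Variables (R : realType) (N : nat).
Implicit Types (x y z nu : 'rV[R]_N) (a b r : R).

Lemma dotC x y : dot x y = dot y x.
Proof. by apply: eq_bigr => i _; rewrite mulrC. Qed.

Lemma dotDl x y z : dot (x + y) z = dot x z + dot y z.
Proof. by rewrite -big_split; apply: eq_bigr => i _; rewrite mxE mulrDl. Qed.

Lemma dotZl a x y : dot (a *: x) y = a * dot x y.
Proof. by rewrite mulr_sumr; apply: eq_bigr => i _; rewrite mxE mulrA. Qed.

Lemma dotNl x y : dot (- x) y = - dot x y.
Proof. by rewrite -scaleN1r dotZl mulN1r. Qed.

Lemma dotDr x y z : dot z (x + y) = dot z x + dot z y.
Proof. by rewrite dotC dotDl !(dotC z). Qed.

Lemma dotZr a x y : dot x (a *: y) = a * dot x y.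
Proof. by rewrite dotC dotZl dotC. Qed.

Lemma dotNr x y : dot x (- y) = - dot x y.
Proof. by rewrite dotC dotNl dotC. Qed.

Definition dotE := (dotDl, dotDr, dotNl, dotNr, dotZl, dotZr).

Lemma dot_ge0 x : 0 <= dot x x.
Proof. by apply: sumr_ge0 => i _; rewrite -expr2 sqr_ge0. Qed.

Lemma dot_eq0 x : (dot x x == 0) = (x == 0).
Proof.
apply/idP/eqP => [|->]; last by rewrite /dot big1 // => i _; rewrite mxE mul0r.
rewrite psumr_eq0; last by move=> i _; rewrite -expr2 sqr_ge0.
move=> /allP h; apply/rowP => i; rewrite mxE.
by have := h i (mem_index_enum i); rewrite /= -expr2 sqrf_eq0 => /eqP.
Qed.

Lemma enorm_ge0 x : 0 <= enorm x. Proof. exact: sqrtr_ge0. Qed.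

Lemma sqr_enorm x : enorm x ^+ 2 = dot x x.
Proof. by rewrite sqr_sqrtr // dot_ge0. Qed.

Lemma enorm1_dot nu : enorm nu = 1 -> dot nu nu = 1.
Proof. by rewrite -sqr_enorm => ->; rewrite expr1n. Qed.

Lemma enorm_lt r x : 0 <= r -> (enorm x < r) = (dot x x < r ^+ 2).
Proof. by move=> r0; rewrite -sqr_enorm ltr_sqr // nnegrE ?enorm_ge0. Qed.

Lemma enorm_eq r x : 0 <= r -> (enorm x == r) = (dot x x == r ^+ 2).
Proof. by move=> r0; rewrite -sqr_enorm eqrXn2 ?enorm_ge0. Qed.

Lemma reflectionD nu a x y :
  reflection nu a (x + y) = reflection nu a x + reflection nu 0 y.
Proof. by rewrite /reflection dotE addrACA -scalerDl; congr (_ + _ *: _); ring. Qed.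

Lemma reflection0E nu a x : reflection nu a x = reflection nu 0 x + (2 * a) *: nu.
Proof. by rewrite /reflection -addrA -scalerDl; congr (_ + _ *: _); ring. Qed.

Lemma dot_reflection nu a x : dot nu nu = 1 ->
  dot (reflection nu a x) nu = 2 * a - dot x nu.
Proof. by move=> n1; rewrite /reflection !dotE n1; ring. Qed.

Lemma reflectionK nu a : dot nu nu = 1 ->
  involutive (reflection nu a).
Proof.
move=> n1 x; rewrite {1}/reflection dot_reflection // /reflection -addrA -scalerDl.
by rewrite [X in X *: _](_ : _ = 0) ?scale0r ?addr0 //; ring.
Qed.

Lemma dot_reflection0 nu x y : dot nu nu = 1 ->
  dot (reflection nu 0 x) (reflection nu 0 y) = dot x y.
Proof. by move=> n1; rewrite /reflection !dotE n1 (dotC nu y); ring. Qed.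

Lemma reflectionB nu a x y :
  reflection nu a x - reflection nu a y = reflection nu 0 (x - y).
Proof.
have {1}-> : x = y + (x - y) by rewrite addrC subrK.
by rewrite reflectionD addrC addKr.
Qed.

Lemma coord_dot x (i : 'I_N) : x ord0 i ^+ 2 <= dot x x.
Proof.
rewrite /dot (bigD1 i) //= expr2 lerDl.
by apply: sumr_ge0 => j _; rewrite -expr2 sqr_ge0.
Qed.

Lemma coord_le_norm x (i : 'I_N) : `|x ord0 i| <= `|x|.
Proof.
rewrite [leRHS]/Num.norm /= mx_normrE; apply/bigmax_geP; right => /=.
by exists (ord0, i).
Qed.

Lemma dot_le_norm x : dot x x <= N%:R * `|x| ^+ 2.
Proof.
have h i : x ord0 i * x ord0 i <= `|x| ^+ 2.
  rewrite -expr2 -real_normK ?num_real // lerXn2r ?nnegrE //.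
  exact: coord_le_norm.
apply: (le_trans (ler_sum _ (fun i _ => h i))).
by rewrite sumr_const card_ord mulr_natl.
Qed.

Lemma continuous_coord (i : 'I_N) : continuous (fun x : 'rV[R]_N => x ord0 i).
Proof. exact: coord_continuous. Qed.

Lemma continuous_dotl y : continuous (fun x => dot x y).
Proof.
move=> x; apply: continuous_sumr => i; 
by apply: continuousM; [exact: continuous_coord|exact: cst_continuous].
Qed.

Lemma continuous_sqdist y : continuous (fun x => dot (x - y) (x - y)).
Proof.
move=> x; apply: continuous_sumr => i.
suff h : {for x, continuous (fun z : 'rV[R]_N => (z - y) ord0 i)} by apply: continuousM.
apply: (@continuous_comp _ _ _ (fun z => z - y) (fun z => z ord0 i)).
  apply: (@continuousB _ _ _ id (cst y) x); [exact: cvg_id|exact: cst_continuous].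
exact: continuous_coord.
Qed.

Lemma continuous_reflection nu a : continuous (reflection nu a).
Proof.
move=> x; pose g (z : 'rV[R]_N) := (2 * (a - dot z nu)) *: nu.
suff gx : {for x, continuous g} by exact: (@continuousD _ _ _ id g x _ gx).
apply: continuousZr_tmp; apply: continuousM; first exact: cst_continuous.
by apply: continuousB; [exact: cst_continuous|exact: continuous_dotl].
Qed.

Lemma open_eball r : open (@eball R N r).
Proof.
have [r0|r0] := ltP r 0.
  rewrite (_ : eball r = set0); first exact: open0.
  by rewrite -subset0 => x /= h; have := enorm_ge0 x; rewrite leNgt (lt_trans h r0).
rewrite (_ : eball r = (fun x => dot (x - 0) (x - 0)) @^-1` [set t | t < r ^+ 2]).
  by apply: open_comp; [move=> x _; exact: continuous_sqdist|exact: open_lt].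
by apply/seteqP; split => x /=; rewrite /eball /= enorm_lt // subr0.
Qed.

End euclid.

(** * Translation and reflection invariance of Lebesgue measure *)

Lemma measurable_ball_rV (R : realType) (N : nat) (x : 'rV[R]_N) (r : R) :
  measurable (ball x r : set 'rV[R]_N).
Proof.
have [r0|r0] := leP r 0.
  rewrite (_ : ball x r = set0); first exact: measurable0.
  by rewrite -subset0 => y [/lt_geF]; rewrite r0.
rewrite (_ : ball x r = \bigcap_(i in [set: 'I_N])
   ((fun y : 'rV[R]_N => y ord0 i) @^-1` ball (x ord0 i) r)).
  apply: fin_bigcap_measurable => // i _.
  rewrite -[X in measurable X]setTI.
  apply: (measurable_coord_rV i) => //.
  by rewrite ball_itv; exact: measurable_itv.
apply/seteqP; split => y /=.
  by move=> [_ h] i _; exact: h.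
by move=> h; split => // i j; rewrite (ord1 i); exact: h.
Qed.

Lemma open_measurable_rV (R : realType) (N : nat) (A : set 'rV[R]_N) :
  open A -> measurable A.
Proof.
move=> oA.
pose c (q : 'rV[rat]_N) : 'rV[R]_N := map_mx ratr q.
pose B (p : 'rV[rat]_N * nat) : set 'rV[R]_N :=
  if `[< ball (c p.1) (p.2.+1%:R^-1) `<=` A >]
  then ball (c p.1) (p.2.+1%:R^-1) else set0.
have -> : A = \bigcup_n (oapp B set0 (unpickle n)).
  apply/seteqP; split => [x Ax|x [n _]]; last first.
    case: (unpickle n) => //= p.
    by rewrite /B; case: ifPn => [/asboolP h xp|//]; exact: h.
  have /nbhs_ballP[e /= e0 eA] := open_nbhs_nbhs (conj oA Ax).
  have [n hn] : exists n : nat, n.+1%:R^-1 < e / 2.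
    have := near_infty_natSinv_lt (PosNum (divr_gt0 e0 (ltr0Sn R 1))).
    by move=> [n _ hn]; exists n; apply: (hn n) => /=.
  have n0 : 0 < n.+1%:R^-1 :> R by rewrite invr_gt0.
  have /choice[q hq] : forall i, exists q : rat,
      `|ratr q - x ord0 i| < n.+1%:R^-1.
    move=> i; have /rat_in_itvoo[q] : x ord0 i - n.+1%:R^-1 < x ord0 i + n.+1%:R^-1.
      by rewrite ltrBlDr -addrA ltrDl addr_gt0.
    by rewrite in_itv /= => /andP[h1 h2]; exists q; rewrite ltr_norml ltrBrDl h1 ltrBlDl.
  have xb : ball (c (\row_i q i)) n.+1%:R^-1 x.
    split => // i j; rewrite (ord1 i) !mxE; exact: hq.
  exists (pickle (\row_i q i, n)) => //; rewrite pickleK /= /B /=.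
  suff cA : ball (c (\row_i q i)) n.+1%:R^-1 `<=` A by rewrite asboolT.
  move=> y yb; apply: eA.
  have := ball_triangle (ball_sym xb) yb; apply: le_ball.
  by rewrite [leRHS](splitr e) lerD // ltW.
apply: bigcupT_measurable => n; case: (unpickle n) => [p|] /=; last exact: measurable0.
rewrite /B; case: ifPn => _; [exact: measurable_ball_rV|exact: measurable0].
Qed.

Lemma continuous_measurable_rV (R : realType) (N : nat) (f : 'rV[R]_N -> R) :
  continuous f -> measurable_fun [set: 'rV[R]_N] f.
Proof.
move=> cf; apply: (measurability _ (@RGenOpens.measurableE R)) => _ [_ [a [b ->]] <-].
rewrite setTI; apply: open_measurable_rV; apply: open_comp; [by move=> x _; exact: cf|exact: interval_open].
Qed.

Lemma lebesgue_translation (R : realType) (a : R) (A : set (measurableTypeR R)) :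
  measurable A ->
  lebesgue_measure ((fun x => x + a) @^-1` A) = lebesgue_measure A.
Proof.
have ms : measurable_fun [set: measurableTypeR R]
    ((fun x => x + a) : measurableTypeR R -> measurableTypeR R).
  exact: measurable_funD.
pose m' : {measure set (measurableTypeR R) -> \bar R} :=
  (measure_function_pushforward__canonical__measure_function_Measure (@lebesgue_measure R) ms).
move=> mA; rewrite -[LHS]/(m' A); symmetry; move: A mA.
have := (@lebesgue_measure_unique R m'); apply.
move=> _ [[x y] _ <-] /=.
rewrite /pushforward /=.
rewrite (_ : _ @^-1` _ = `]x - a, y - a]%classic); last first.
  by apply/seteqP; split => z /=; rewrite !in_itv /= ltrBlDr lerBrDr.
rewrite !lebesgue_measure_itv /= !lte_fin ltrD2r; case: ifP => // _.
by rewrite -!EFinB; congr EFin; ring.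
Qed.

(** By Fubini over the first coordinate: translating a set translates its
    sections and the base point of each section. *)
Lemma borel_lebesgue_translation (R : realType) (N : nat) (a : 'rV[R]_N)
    (A : set 'rV[R]_N) : measurable A ->
  borel_lebesgue R N ((fun x => x + a) @^-1` A) = borel_lebesgue R N A.
Proof.
elim: N a A => [|N IH] a A mA.
  rewrite /=; congr (\d_ _ _); apply/seteqP; split => x /=; last first.
    by rewrite (_ : x + a = x) //; apply/rowP => -[].
  by rewrite (_ : x + a = x) //; apply/rowP => -[].
rewrite /= /borel_lebesgue_step /pushforward.
set m := borel_lebesgue R N.
pose a0 := a ord0 ord0; pose a' : 'rV[R]_N := \row_j a ord0 (lift ord0 j).
have mB : measurable (@rV_cons R N @^-1` A : set (measurableTypeR R * 'rV[R]_N)).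
  by rewrite -[X in measurable X]setTI; exact: measurable_rV_cons.
set B := _ @^-1` A in mB *.
have consD p : rV_cons p + a = rV_cons (p.1 + a0, p.2 + a').
  apply/rowP => i; rewrite [LHS]mxE; case: (unliftP ord0 i) => [j ->|->].
    by rewrite !rV_consS /= !mxE.
  by rewrite !rV_cons0.
rewrite /product_measure1 /=.
have -> : (fun x : measurableTypeR R => m (xsection (@rV_cons R N @^-1`
    ((fun x0 => x0 + a) @^-1` A)) x)) =
    ((fun x : measurableTypeR R => m (xsection B x)) \o (fun x => x + a0)).
  apply/funext => x /=; rewrite -[RHS](IH a'); last exact: measurable_xsection.
  congr (m _); apply/seteqP; split => y.
    by rewrite /xsection /= !inE /= !consD.
  by rewrite /xsection /= !inE /= !consD.
have ms : measurable_fun [set: measurableTypeR R]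
    ((fun x => x + a0) : measurableTypeR R -> measurableTypeR R).
  exact: measurable_funD.
rewrite -(@ge0_integral_pushforward _ _ _ _ _ _ ms _ setT
   (fun x => m (xsection B x))) //; last first.
  exact: measurable_fun_xsection.
apply: eq_measure_integral => C mC _.
by rewrite /= /pushforward lebesgue_translation.
Qed.

(** Balls of the sup norm are products of intervals, so their measure can be
    followed through the recursive construction. *)
Lemma borel_lebesgue_ball (R : realType) (N : nat) (r : R) : 0 < r ->
  (0 < borel_lebesgue R N (ball (0%R : 'rV[R]_N) r) < +oo)%E.
Proof.
move=> r0; elim: N => [|N IH].
  by rewrite /= diracE mem_set ?lte01 ?ltry //; exact: ballxx.
rewrite /= /borel_lebesgue_step /pushforward.
rewrite (_ : @rV_cons R N @^-1` _ =
    (ball (0 : R) r : set (measurableTypeR R)) `*` ball (0 : 'rV[R]_N) r); last first.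
  apply/seteqP; split => -[a y] /=.
    move=> [_ h]; split => /=.
      by have := h ord0 ord0; rewrite rV_cons0 mxE.
    split=> // i j; have := h i (lift ord0 j); rewrite (ord1 i) rV_consS mxE.
    by rewrite mxE.
  move=> [ha [_ h]]; split => // i j; rewrite (ord1 i) mxE.
  case: (unliftP ord0 j) => [k ->|->]; last by rewrite rV_cons0.
  by rewrite rV_consS; have := h ord0 k; rewrite mxE.
have mb : measurable (ball (0 : R) r : set (measurableTypeR R)).
  by rewrite ball_itv; exact: measurable_itv.
have lb : lebesgue_measure (ball (0 : R) r : set (measurableTypeR R)) = (r *+ 2)%:E.
  by apply: lebesgue_measure_ball; exact: ltW.
set P := (X in (0 < X < _)%E).
have -> : P = ((r *+ 2)%:E * borel_lebesgue R N (ball (0%R : 'rV[R]_N) r))%E.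
  rewrite /P product_measure1E //; last exact: measurable_ball_rV.
  by congr (_ * _)%E; exact: lb.
case/andP: IH => h1 h2.
have r2 : 0 < r *+ 2 by rewrite pmulrn_rgt0.
by rewrite mule_gt0 // lte_mul_pinfty // lee_fin ltW.
Qed.

Lemma borel_lebesgue_eball (R : realType) (N : nat) (r : R) : 0 < r ->
  (0 < borel_lebesgue R N (@eball R N r) < +oo)%E.
Proof.
move=> r0; apply/andP; split.
  have s0 : 0 < r / N.+1%:R by rewrite divr_gt0.
  have /andP[+ _] := borel_lebesgue_ball N s0.
  move/lt_le_trans; apply; apply: le_measure; rewrite ?inE.
  - exact: measurable_ball_rV.
  - by apply: open_measurable_rV; exact: open_eball.
  move=> x; rewrite -ball_normE /= sub0r normrN /eball /= => xs.
  rewrite enorm_lt ?(ltW r0) //; apply: (le_lt_trans (dot_le_norm x)).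
  apply: (@le_lt_trans _ _ (N%:R * (r / N.+1%:R) ^+ 2)).
    apply: ler_wpM2l => //; rewrite ler_sqr ?nnegrE ?(ltW s0) //; exact: ltW.
  rewrite expr_div_n mulrCA -[ltRHS]mulr1 ltr_pM2l ?exprn_gt0 //.
  rewrite ltr_pdivrMr ?exprn_gt0 // mul1r -natrX ltr_nat.
  by rewrite expnS expn1; apply: (@leq_trans N.+1) => //; rewrite leq_pmulr.
have /andP[_] := borel_lebesgue_ball N r0.
apply: le_lt_trans; apply: le_measure; rewrite ?inE.
- by apply: open_measurable_rV; exact: open_eball.
- exact: measurable_ball_rV.
move=> x; rewrite /eball /= => xr; split => // i j; rewrite (ord1 i) mxE /ball /= sub0r normrN.
rewrite -ltr_sqr ?nnegrE ?(ltW r0) // real_normK ?num_real //.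
by apply: (le_lt_trans (coord_dot x j)); rewrite -enorm_lt ?(ltW r0).
Qed.

(** Cavalieri's principle, used twice: [S1] and [S2] have vertical slices of the
    same measure, hence the same product measure, which horizontal slices evaluate
    as mu A * mu B and mu A' * mu B. The factor mu B then cancels. *)
Lemma cavalieri_cancel (d : measure_display) (V : measurableType d) (R : realType)
    (mu : {sigma_finite_measure set V -> \bar R}) (A A' B : set V) (S1 S2 : set (V * V)) :
  measurable A -> measurable A' -> measurable B -> (0 < mu B < +oo)%E ->
  measurable S1 -> measurable S2 ->
  (forall x, mu (xsection S1 x) = mu (xsection S2 x)) ->
  (forall y, B y -> mu (ysection S1 y) = mu A) ->
  (forall y, ~ B y -> ysection S1 y = set0) ->
  (forall y, A' y -> mu (ysection S2 y) = mu B) ->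
  (forall y, ~ A' y -> ysection S2 y = set0) ->
  mu A' = mu A.
Proof.
move=> mA mA' mB /andP[B0 Boo] mS1 mS2 e12 S1B S1nB S2A S2nA.
have slices (S : set (V * V)) : measurable S ->
    (\int[mu]_x mu (xsection S x) = \int[mu]_y mu (ysection S y))%E.
  move=> mS; have := indic_fubini_tonelli mu mu mS.
  by rewrite indic_fubini_tonelli_FE // indic_fubini_tonelli_GE.
have const_slices (S : set (V * V)) (C : set V) (k : \bar R) : measurable C -> (0 <= k)%E ->
    (forall y, C y -> mu (ysection S y) = k) -> (forall y, ~ C y -> ysection S y = set0) ->
    (\int[mu]_y mu (ysection S y) = k * mu C)%E.
  move=> mC k0 SC SnC; rewrite -[RHS](@integral_cst _ _ _ mu C mC k) [RHS]integral_mkcond.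
  apply: eq_integral => y _; rewrite patchE; case: ifPn => [|/negP yC].
    by rewrite inE => /SC.
  by rewrite SnC ?measure0 // => Cy; apply: yC; rewrite inE.
have h : (mu A' * mu B = mu A * mu B)%E.
  rewrite -(const_slices S1 B (mu A)) // -slices // muleC -(const_slices S2 A' (mu B)) //.
  by rewrite -slices //; apply: eq_integral => x _; rewrite e12.
have Bf : mu B \is a fin_num by rewrite ge0_fin_numE // ltW.
apply/eqP; rewrite eq_le -(lee_pmul2r Bf B0) h lexx /=.
by rewrite -(lee_pmul2r Bf B0) h.
Qed.

Lemma measurable_pairD (R : realType) (N : nat) (f g : 'rV[R]_N * 'rV[R]_N -> 'rV[R]_N) (a : R) :
  measurable_fun setT f -> measurable_fun setT g ->
  measurable_fun setT (fun p => f p + a *: g p).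
Proof.
move=> mf mg; apply: measurable_fun_rVP => i.
under eq_fun do rewrite mxE [X in _ + X]mxE.
apply: measurable_funD; first exact: measurableT_comp (measurable_coord_rV i) mf.
apply: measurable_funM => //.
exact: measurableT_comp (measurable_coord_rV i) mg.
Qed.

Section involution_invariance.
Context {R : realType} {N : nat}.
Variable mu : {sigma_finite_measure set 'rV[R]_N -> \bar R}.
Hypothesis muD : forall (a : 'rV[R]_N) (A : set 'rV[R]_N), measurable A ->
  mu ((fun x => x + a) @^-1` A) = mu A.
Variables (T : 'rV[R]_N -> 'rV[R]_N) (B : set 'rV[R]_N).
Hypothesis mT : measurable_fun [set: 'rV[R]_N] T.
Hypothesis TD : forall x y, T (x + y) = T x + T y.
Hypothesis TK : involutive T.
Hypothesis mB : measurable B.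
Hypothesis TB : T @^-1` B = B.
Hypothesis Bfin : (0 < mu B < +oo)%E.
Hypothesis BN : forall x, B x -> B (- x).

(** The uniqueness argument for Haar measure: the sets
    {(x, y) | x + T y in A, y in B} and {(x, y) | T y in A, x - T y in B} have
    vertical slices that are translates of each other, by T x. An invariant set
    [B] of finite positive measure is what makes the comparison conclusive. *)
Lemma measure_involution A : measurable A -> mu (T @^-1` A) = mu A.
Proof.
move=> mA.
have mTsnd : measurable_fun [set: 'rV[R]_N * 'rV[R]_N] (fun p => T p.2).
  exact: measurableT_comp mT measurable_snd.
pose S1 : set ('rV[R]_N * 'rV[R]_N) := [set p | A (p.1 + 1 *: T p.2) /\ B p.2].
pose S2 : set ('rV[R]_N * 'rV[R]_N) := [set p | A (T p.2) /\ B (p.1 + (-1) *: T p.2)].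
have mS1 : measurable S1.
  apply: (@measurableI _ _ ((fun p => p.1 + 1 *: T p.2) @^-1` A) (snd @^-1` B)).
    rewrite -[X in measurable X]setTI; apply: measurable_pairD => //.
  by rewrite -[X in measurable X]setTI; apply: measurable_snd.
have mS2 : measurable S2.
  apply: (@measurableI _ _ ((fun p => T p.2) @^-1` A)
     ((fun p => p.1 + (-1) *: T p.2) @^-1` B)).
    by rewrite -[X in measurable X]setTI; apply: mTsnd.
  by rewrite -[X in measurable X]setTI; apply: measurable_pairD.
have TN x : T (- x) = - T x.
  have T0 : T 0 = 0 by apply: (addrI (T 0)); rewrite -TD !addr0.
  by apply: (addrI (T x)); rewrite -TD !subrr.
have BTx x : B (T x) = B x by rewrite -[in RHS]TB.
have BNx x : B (- x) <-> B x by split=> [/BN|/BN //]; rewrite opprK.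
have mTA : measurable (T @^-1` A) by rewrite -[X in measurable X]setTI; exact: mT.
apply: (cavalieri_cancel mA mTA mB Bfin mS1 mS2) => [x|y By|y nBy|y TAy|y nTAy].
- rewrite -(muD (- T x) (measurable_xsection x mS1)).
  congr (mu _); apply/seteqP; split => y; rewrite /xsection /= !inE /S1 /S2 /=;
    rewrite TD TN TK !scale1r !scaleN1r addrCA subrr addr0 -(BTx (y - _)) TD TN TK;
    by move=> [? ?]; split=> //; apply/BNx; rewrite opprB.
- rewrite -[RHS](muD (T y) mA); congr (mu _).
  by apply/seteqP; split => x; rewrite /ysection /= inE /S1 /= scale1r // => -[].
- by rewrite -subset0 => x; rewrite /ysection /= inE => -[_ /nBy].
- rewrite -[RHS](muD (- T y) mB); congr (mu _).
  by apply/seteqP; split => x; rewrite /ysection /= inE /S2 /= scaleN1r // => -[].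
- by rewrite -subset0 => x; rewrite /ysection /= inE => -[/nTAy].
Qed.
End involution_invariance.

Lemma measurable_reflection (R : realType) (N : nat) (nu : 'rV[R]_N) (a : R) :
  measurable_fun [set: 'rV[R]_N] (reflection nu a).
Proof.
apply: measurable_fun_rVP => i; apply: continuous_measurable_rV => x.
apply: (@continuous_comp _ _ _ (reflection nu a) (fun z => z ord0 i)).
  exact: continuous_reflection.
exact: continuous_coord.
Qed.

(** The unit Euclidean ball is the invariant set that makes the preceding
    argument work for the linear reflection; the affine one differs from it by a
    translation. *)
Lemma borel_lebesgue_reflection (R : realType) (N : nat) (nu : 'rV[R]_N) (a : R)
    (A : set 'rV[R]_N) : dot nu nu = 1 -> measurable A ->
  borel_lebesgue R N (reflection nu a @^-1` A) = borel_lebesgue R N A.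
Proof.
move=> n1 mA.
have mA' : measurable ((fun x : 'rV[R]_N => x + (2 * a) *: nu) @^-1` A).
  rewrite -[X in measurable X]setTI.
  have mD : measurable_fun [set: 'rV[R]_N] (fun x : 'rV[R]_N => x + (2 * a) *: nu).
    apply: measurable_fun_rVP => i; under eq_fun do rewrite mxE.
    by apply: measurable_funD => //; exact: measurable_coord_rV.
  exact: mD.
rewrite -[RHS](borel_lebesgue_translation ((2 * a) *: nu) mA).
rewrite -(@measure_involution _ _ _ (@borel_lebesgue_translation R N) (reflection nu 0) (@eball R N 1)
   (measurable_reflection nu 0) _ (reflectionK 0 n1) _ _ _ _ _ mA').
- by congr (borel_lebesgue R N _); apply/funext => x /=; rewrite reflection0E.
- by move=> x y; rewrite reflectionD.
- by apply: open_measurable_rV; exact: open_eball.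
- by apply/seteqP; split => x; rewrite /eball /= /enorm dot_reflection0.
- exact: borel_lebesgue_eball.
- by move=> x; rewrite /eball /= /enorm dotNl dotNr opprK.
Qed.

(** * Integration against the completed Lebesgue measure *)

(** Restricting to a line turns a directional derivative into an ordinary one,
    so that one-dimensional results apply. *)
Lemma is_derive_line (R : realType) (N : nat) (F : 'rV[R]_N -> R)
    (x v : 'rV[R]_N) (t : R) : derivable F (x + t *: v) v ->
  is_derive t 1 (fun s => F (x + s *: v)) ('D_v F (x + t *: v)).
Proof.
move=> dF.
have e : (fun h : R => h^-1 *: ((fun s => F (x + s *: v)) (h *: 1 + t) -
      F (x + t *: v))) =
    (fun h => h^-1 *: (F (h *: v + (x + t *: v)) - F (x + t *: v))).
  apply/funext => h; congr (_ *: (F _ - _)).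
  by rewrite [h *: 1]mulr1 scalerDl addrCA.
by split; rewrite /derivable /derive /= e.
Qed.

Section transport.
Context {R : realType} {N : nat}.
Notation mu := (borel_lebesgue R N).
Notation leb := (lebesgue R N).

Lemma lebesgueE (A : set 'rV[R]_N) : measurable A -> leb A = mu A.
Proof. exact: measurable_mu_extE. Qed.

Lemma lebesgue_measurable (A : set 'rV[R]_N) : measurable A ->
  measurable (A : set (lebesgue_space R N)).
Proof. exact: caratheodory_measurable_mu_ext. Qed.

Lemma lebesgue_measurable_fun (F : 'rV[R]_N -> R) :
  measurable_fun [set: 'rV[R]_N] F ->
  measurable_fun [set: lebesgue_space R N] (F : lebesgue_space R N -> R).
Proof. by move=> mF _ B mB; apply: lebesgue_measurable; exact: mF. Qed.

Variables (T T' : 'rV[R]_N -> 'rV[R]_N).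
Hypotheses (TK : cancel T T') (T'K : cancel T' T).
Hypotheses (mT : measurable_fun [set: 'rV[R]_N] T)
  (mT' : measurable_fun [set: 'rV[R]_N] T').
Hypothesis muT : forall A, measurable A -> mu (T @^-1` A) = mu A.

Let mpre A : measurable A -> measurable (T @^-1` A).
Proof. by move=> mA; rewrite -[X in measurable X]setTI; exact: mT. Qed.
Let mpre' A : measurable A -> measurable (T' @^-1` A).
Proof. by move=> mA; rewrite -[X in measurable X]setTI; exact: mT'. Qed.

Let muT' A : measurable A -> mu (T' @^-1` A) = mu A.
Proof.
move=> mA; rewrite -muT; last exact: mpre'.
by congr (mu _); apply/seteqP; split => x /=; rewrite TK.
Qed.

Let mu_ext_le (S : 'rV[R]_N -> 'rV[R]_N) X :
  (forall A, measurable A -> measurable (S @^-1` A)) ->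
  (forall A, measurable A -> mu (S @^-1` A) = mu A) ->
  (mu_ext mu (S @^-1` X) <= mu_ext mu X)%E.
Proof.
move=> mS muS; apply: le_ereal_inf_tmp => _ [A [mA XA] <-].
apply: ereal_inf_lbound; exists (fun k => S @^-1` A k).
  split; first by move=> k; exact: mS.
  by move=> x /XA [k _ Ak]; exists k.
by apply: eq_eseriesr => k _; rewrite muS.
Qed.

(** A bijection that preserves the Borel measure in both directions carries
    covers to covers, hence preserves the outer measure and with it the
    Caratheodory-measurable sets. This is what lets reflections act on functions
    that are only measurable for the completed sigma-algebra. *)
Lemma mu_ext_transport X : mu_ext mu (T @^-1` X) = mu_ext mu X.
Proof.
apply/eqP; rewrite eq_le mu_ext_le //=.
have {1}-> : X = T' @^-1` (T @^-1` X) by apply/seteqP; split => x /=; rewrite T'K.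
exact: mu_ext_le.
Qed.

Lemma measurable_transport :
  measurable_fun [set: lebesgue_space R N] (T : lebesgue_space R N -> lebesgue_space R N).
Proof.
move=> _ A mA; have {}mA : caratheodory_measurable (mu_ext mu) A := mA.
rewrite setTI; suff : caratheodory_measurable (mu_ext mu) (T @^-1` A) by [].
move=> X.
have -> : X = T @^-1` (T' @^-1` X) by apply/seteqP; split => x /=; rewrite TK.
by rewrite preimage_setC -!preimage_setI !mu_ext_transport; exact: mA.
Qed.

Lemma lebesgue_transport A : leb (T @^-1` A) = leb A.
Proof. exact: mu_ext_transport. Qed.

Lemma integrable_transport (F : lebesgue_space R N -> R) :
  leb.-integrable setT (EFin \o F) -> leb.-integrable setT (EFin \o (F \o T)).
Proof.
move=> /integrableP[mF Foo]; apply/integrableP; split.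
  exact: measurableT_comp mF measurable_transport.
have mabs : measurable_fun [set: lebesgue_space R N] (fun x => `|(EFin \o F) x|)%E.
  exact: measurableT_comp.
have := @ge0_integral_pushforward _ _ _ _ _ _ measurable_transport leb setT
  (fun x => `|(EFin \o F) x|)%E measurableT mabs (fun _ _ => abse_ge0 _).
rewrite preimage_setT /comp => <-.
move: Foo; congr (_ < _)%E.
apply: eq_measure_integral => [|mS A _]; first exact: measurable_transport.
by rewrite /= /pushforward lebesgue_transport.
Qed.

Lemma Rintegral_transport (F : lebesgue_space R N -> R) :
  leb.-integrable setT (EFin \o F) ->
  \int[leb]_x (F (T x)) = \int[leb]_x F x.
Proof.
move=> iF; rewrite /Rintegral; congr fine.
have mF : measurable_fun setT (EFin \o F) by case/integrableP : iF.
have := @integral_pushforward _ _ _ _ _ _ measurable_transport leb setT _ mF _ measurableT.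
rewrite preimage_setT => /(_ (integrable_transport iF)) <-.
apply: eq_measure_integral => [|mS A _]; first exact: measurable_transport.
by rewrite /= /pushforward lebesgue_transport.
Qed.

End transport.

Section compact_support.
Context {R : realType} {N : nat}.
Notation leb := (lebesgue R N).
Implicit Types (F : 'rV[R]_N -> R) (K : set 'rV[R]_N).

Lemma compact_bounded_fun F K : continuous F -> compact K ->
  (forall x, ~ K x -> F x = 0) -> exists2 M, 0 <= M & forall x, `|F x| <= M.
Proof.
move=> cF cK F0; have [[k Kk]|K0] := pselect (K !=set0); last first.
  by exists 0 => // x; rewrite F0 ?normr0 // => Kx; apply: K0; exists x.
have cnF : {within K, continuous (fun x => `|F x|)}.
  have cn : continuous (fun x => `|F x|) by move=> x; exact: cvg_norm (cF x).
  exact: continuous_subspaceT cn.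
have [c _ cmax] := compact_EVT_max (ex_intro _ k Kk) cK cnF.
exists `|F c| => // x; have [Kx|nKx] := pselect (K x); last by rewrite F0 ?normr0.
by apply: cmax; rewrite inE.
Qed.

Lemma lebesgue_ball_fin (r : R) : (leb (ball (0 : 'rV[R]_N)%R r) < +oo)%E.
Proof.
have r0 : 0 < `|r| + 1 by rewrite ltr_wpDl.
rewrite (@le_lt_trans _ _ (leb (ball (0 : 'rV[R]_N) (`|r| + 1)))) //.
  apply: le_measure; rewrite ?inE; [| |apply: le_ball].
  - by apply: lebesgue_measurable; exact: measurable_ball_rV.
  - by apply: lebesgue_measurable; exact: measurable_ball_rV.
  - by rewrite (le_trans (ler_norm _)) // lerDl.
rewrite lebesgueE; last exact: measurable_ball_rV.
by case/andP : (borel_lebesgue_ball N r0).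
Qed.

Lemma bounded_support_integrable F (M r : R) :
  measurable_fun [set: 'rV[R]_N] F -> (forall x, `|F x| <= M) ->
  (forall x, r <= `|x| -> F x = 0) -> leb.-integrable setT (EFin \o F).
Proof.
move=> mF FM F0.
have mB : measurable (ball (0 : 'rV[R]_N) r : set (lebesgue_space R N)).
  by apply: lebesgue_measurable; exact: measurable_ball_rV.
have iB : leb.-integrable (ball (0 : 'rV[R]_N) r) (EFin \o F).
  apply: measurable_bounded_integrable => //; first exact: lebesgue_ball_fin.
    by apply: measurable_funTS; exact: lebesgue_measurable_fun.
  exists M; split; first exact: num_real.
  by move=> m Mm x _ /=; apply: (le_trans (FM x)); exact: ltW.
move/(integrable_mkcond _ mB) : iB; congr (leb.-integrable _ _).
apply/funext => x; rewrite /patch; case: ifPn => // xr /=.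
rewrite F0 // leNgt; apply: contra xr => xr.
by rewrite inE -ball_normE /= sub0r normrN.
Qed.

Lemma compact_norm_bounded K : compact K ->
  exists r, forall x, r <= `|x| -> ~ K x.
Proof.
move=> /compact_bounded [M [_ KM]]; exists (M + 2) => x xM Kx.
have := KM (M + 1); rewrite ltrDl ltr01 => /(_ erefl x Kx) /(le_trans xM).
by rewrite lerD2l (ler_nat _ 2 1).
Qed.

Lemma continuous_compact_integrable F K : continuous F -> compact K ->
  (forall x, ~ K x -> F x = 0) -> leb.-integrable setT (EFin \o F).
Proof.
move=> cF cK F0; have [M _ FM] := compact_bounded_fun cF cK F0.
have [r Kr] := compact_norm_bounded cK.
apply: (@bounded_support_integrable F M r) => //.
  exact: continuous_measurable_rV.
by move=> x /Kr; exact: F0.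
Qed.

Lemma measurable_addr_rV (a : 'rV[R]_N) :
  measurable_fun [set: 'rV[R]_N] (fun x => x + a).
Proof.
apply: measurable_fun_rVP => i; under eq_fun do rewrite mxE.
by apply: measurable_funD => //; exact: measurable_coord_rV.
Qed.

Lemma Rintegral_translation (F : lebesgue_space R N -> R) (a : 'rV[R]_N) :
  leb.-integrable setT (EFin \o F) ->
  leb.-integrable setT (EFin \o (fun x : lebesgue_space R N => F ((x : 'rV[R]_N) + a))) /\
  \int[leb]_x F ((x : 'rV[R]_N) + a) = \int[leb]_x F x.
Proof.
move=> iF.
have K1 : cancel (fun x => x + a) (fun x => x - a) by move=> x; rewrite addrK.
have K2 : cancel (fun x => x - a) (fun x => x + a) by move=> x; rewrite subrK.
split.
  apply: (integrable_transport K1 K2 _ _ _ iF); try exact: measurable_addr_rV.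
  by move=> A; exact: borel_lebesgue_translation.
apply: (Rintegral_transport K1 K2 _ _ _ iF); try exact: measurable_addr_rV.
by move=> A; exact: borel_lebesgue_translation.
Qed.

Lemma Rintegral_reflection (F : lebesgue_space R N -> R) (nu : 'rV[R]_N) (a : R) :
  dot nu nu = 1 -> leb.-integrable setT (EFin \o F) ->
  leb.-integrable setT (EFin \o (fun x : lebesgue_space R N => F (reflection nu a x))) /\
  \int[leb]_x F (reflection nu a x) = \int[leb]_x F x.
Proof.
move=> n1 iF; have K1 := reflectionK a n1.
split.
  apply: (integrable_transport K1 K1 _ _ _ iF); try exact: measurable_reflection.
  by move=> A; exact: borel_lebesgue_reflection.
apply: (Rintegral_transport K1 K1 _ _ _ iF); try exact: measurable_reflection.
by move=> A; exact: borel_lebesgue_reflection.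
Qed.

End compact_support.

Section integral_derivative.
Context {R : realType} {N : nat}.
Notation leb := (lebesgue R N).
Variables (F : 'rV[R]_N -> R) (K : set 'rV[R]_N) (v : 'rV[R]_N).
Hypotheses (cF : continuous F) (cK : compact K) (F0 : forall x, ~ K x -> F x = 0).
Hypotheses (dF : forall x, derivable F x v) (cG : continuous ('D_v F)).

Lemma derive_support x : ~ K x -> 'D_v F x = 0.
Proof.
move=> nKx; rewrite -(derive_cst (0 : R) x v); apply: near_eq_derive.
have oK : open (~` K).
  by apply: closed_openC; apply: compact_closed => //; exact: norm_hausdorff.
have : nbhs x (~` K) by exact: open_nbhs_nbhs.
by apply: filterS => y; exact: F0.
Qed.

(** The integral of a difference quotient vanishes by translation invariance,
    and the mean value theorem provides the bound needed to pass to the limit. *)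
Lemma Rintegral_derive : \int[leb]_x 'D_v F x = 0.
Proof.
have [M M0 GM] := compact_bounded_fun cG cK derive_support.
have [r Kr] := compact_norm_bounded cK.
pose Fn n (x : 'rV[R]_N) : R := n.+1%:R * (F (x + n.+1%:R^-1 *: v) - F x).
have FnM n x : `|Fn n x| <= M.
  have h0 : 0 < n.+1%:R^-1 :> R by rewrite invr_gt0.
  have dl (t : R) : is_derive t 1 (fun s => F (x + s *: v)) ('D_v F (x + t *: v)).
    exact: is_derive_line.
  have [t _ e] : exists2 t, t \in `]0, n.+1%:R^-1[%R &
     F (x + n.+1%:R^-1 *: v) - F (x + 0 *: v) = 'D_v F (x + t *: v) * (n.+1%:R^-1 - 0).
    apply: (@MVT R (fun s => F (x + s *: v)) (fun s => 'D_v F (x + s *: v))) => //.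
    apply: derivable_within_continuous => t _.
    by have [] := dl t.
  rewrite /Fn; move: e; rewrite scale0r addr0 subr0 => ->.
  by rewrite mulrC -mulrA mulVf ?mulr1 ?GM // pnatr_eq0.
have Fn0 n x : r + `|v| <= `|x| -> Fn n x = 0.
  move=> rx; rewrite /Fn (F0 (Kr x _)) ?(F0 (Kr _ _)) ?subrr ?mulr0 //.
    apply: (@le_trans _ _ (`|x| - `|n.+1%:R^-1 *: v|)); last first.
      exact: lerB_normD.
    rewrite normrZ lerBrDr (le_trans _ rx) // lerD2l.
    rewrite -[leRHS]mul1r ler_wpM2r // normfV normr_nat invf_le1 ?ltr0n //.
    by rewrite ler1n.
  by apply: (le_trans _ rx); rewrite lerDl.
have mFn n : measurable_fun [set: 'rV[R]_N] (Fn n).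
  apply: measurable_funM => //; apply: measurable_funB; last exact: continuous_measurable_rV.
  apply: (measurableT_comp (continuous_measurable_rV cF)).
  exact: measurable_addr_rV.
have iF := continuous_compact_integrable cF cK F0.
have intFn n : (\int[leb]_x (Fn n x)%:E = 0)%E.
  have iFn : leb.-integrable setT (EFin \o Fn n).
    exact: bounded_support_integrable (mFn n) (FnM n) (Fn0 n).
  have [iT eT] := Rintegral_translation (n.+1%:R^-1 *: v) iF.
  rewrite -(@fineK _ (\int[leb]_x (Fn n x)%:E)%E); last exact: integrable_fin_num.
  congr EFin; transitivity (\int[leb]_x (Fn n x)) => //.
  have iB := integrableB measurableT iT iF.
  rewrite /Fn RintegralZl //.
  by rewrite RintegralB // eT subrr mulr0.
pose B : set 'rV[R]_N := ball (0 : 'rV[R]_N) (r + `|v|).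
have mB : measurable B by exact: measurable_ball_rV.
have ig : leb.-integrable setT (EFin \o (fun x => M * \1_B x)).
  apply: (@bounded_support_integrable _ _ (fun x : 'rV[R]_N => M * \1_B x) M (r + `|v|)).
  - by apply: measurable_funM => //; exact: measurable_indic.
  - move=> x; rewrite normrM (ger0_norm M0) indicE -[leRHS]mulr1 ler_wpM2l //.
    by case: (x \in B); rewrite ?normr1 ?normr0.
  move=> x rx; rewrite indicE memNset ?mulr0 //.
  by rewrite /B -ball_normE /= sub0r normrN; apply/negP; rewrite -leNgt.
have Fn_cvg x : Fn n x @[n --> \oo] --> 'D_v F x.
  have h0 : (n.+1%:R^-1 : R) @[n --> \oo] --> (0 : R)^'.
    move=> A [e /= e0 eA]; have [m _ hm] := near_infty_natSinv_lt (PosNum e0).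
    exists m => // n mn /=; apply: eA; last by rewrite gt_eqF // invr_gt0.
    by rewrite /= sub0r normrN gtr0_norm ?invr_gt0 //; exact: hm.
  have := cvg_comp _ _ h0 (@dF x); apply: cvg_trans.
  apply: near_eq_cvg; apply: nearW => n.
  by rewrite /Fn /= invrK [_ *: v + x]addrC.
have ef : {ae leb, forall x, [set: lebesgue_space R N] x ->
    (Fn n x)%:E @[n --> \oo] --> ('D_v F x)%:E}.
  by apply: aeW => x _; apply: cvg_EFin; [exact: nearW|exact: Fn_cvg].
have eM : {ae leb, forall x n, [set: lebesgue_space R N] x ->
    (`|(Fn n x)%:E| <= (EFin \o (fun x => M * \1_B x)%R) x)%E}.
  apply: aeW => x n _ /=; rewrite lee_fin indicE.
  have [xB|/negP xB] := boolP (x \in B); first by rewrite mulr1 FnM.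
  rewrite Fn0 ?normr0 ?mulr0 // leNgt; apply/negP => xr; apply: xB.
  by rewrite inE /B -ball_normE /= sub0r normrN.
have [_ _] := dominated_convergence measurableT
  (fun n => (measurable_EFinP _ _).2 (lebesgue_measurable_fun (mFn n)))
  ((measurable_EFinP _ _).2 (lebesgue_measurable_fun (continuous_measurable_rV cG)))
  ef ig eM.
under eq_fun do rewrite intFn.
move=> h; have e := cvg_unique (@ereal_hausdorff R) h (cvg_cst 0%E).
transitivity (fine (0%E : \bar R)) => //; congr fine; exact: e.
Qed.
End integral_derivative.

(** * Directional derivatives and the Laplacian *)

Section linear_approximation.
Context {R : realType} {N : nat}.
Implicit Types (F g : 'rV[R]_N -> R) (A : set 'rV[R]_N) (x y v w : 'rV[R]_N).


Lemma MVT_line F x v (a : R) : 0 < a ->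
  (forall t, 0 <= t <= a -> derivable F (x + t *: v) v) ->
  exists2 c, 0 < c < a & F (x + a *: v) - F x = 'D_v F (x + c *: v) * a.
Proof.
move=> a0 dF.
have dl (t : R) : 0 <= t <= a ->
    is_derive t 1 (fun s => F (x + s *: v)) ('D_v F (x + t *: v)).
  by move=> ta; apply: is_derive_line; exact: dF.
have [||c ca e] := @MVT R (fun s => F (x + s *: v)) (fun s => 'D_v F (x + s *: v)) 0 a a0.
- by move=> t; rewrite in_itv /= => /andP[t0 ta]; apply: dl; rewrite !ltW.
- apply: derivable_within_continuous => t; rewrite in_itv /= => ta.
  by have [] := dl t ta.
by exists c; [rewrite in_itv in ca|move: e; rewrite scale0r addr0 subr0].
Qed.

Lemma MVT_lineW F x v (a : R) :
  (forall t, `|t| <= `|a| -> derivable F (x + t *: v) v) ->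
  exists2 c, `|c| <= `|a| & F (x + a *: v) - F x = 'D_v F (x + c *: v) * a.
Proof.
move=> dF; case: (ltgtP a 0) => [a0|a0|->].
- have [||c /andP[c0 ca] e] := @MVT_line F (x + a *: v) v (- a).
  + by rewrite oppr_gt0.
  + move=> t /andP[t0 ta]; rewrite -addrA -scalerDl; apply: dF.
    rewrite !ler0_norm ?(ltW a0) //; lra.
  exists (a + c); first by rewrite !ler0_norm ?(ltW a0) //; lra.
  move: e; rewrite scaleNr addrK -!addrA -!scalerDl => e.
  by rewrite -[LHS]opprK opprB e mulrN opprK.
- have [|c /andP[c0 ca] e] := @MVT_line F x v a a0.
    by move=> t /andP[t0 ta]; apply: dF; rewrite !ger0_norm // ltW.
  by exists c => //; rewrite !ger0_norm // ltW.
by exists 0; rewrite // scale0r addr0 subrr mulr0.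
Qed.

Definition trunc_rV n w : 'rV[R]_N := \row_k (if (k < n)%N then w ord0 k else 0).

Lemma trunc_rVS n w (i : 'I_N) : i = n :> nat ->
  trunc_rV n.+1 w = trunc_rV n w + w ord0 i *: 'e_i.
Proof.
move=> ni; apply/rowP => k; rewrite !mxE eqxx /= ltnS leq_eqVlt -ni.
have [ki|ki] := eqVneq (k : nat) i.
  have -> : k = i by exact: val_inj.
  by rewrite !eqxx ltnn mulr1 add0r.
rewrite (_ : (k == i) = false) ?mulr0 ?addr0 //.
by apply/negbTE; apply: contraNneq ki => ->.
Qed.

(** Move from x to x + w one coordinate at a time and apply the mean value
    theorem on each step. The steps stay in the same ball because the norm is the
    sup norm. *)
Lemma C1_linear_approx A g x (e d : R) : 0 <= e ->
  (forall i y, A y -> derivable g y 'e_i) ->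
  ball x d `<=` A ->
  (forall i y, ball x d y -> `|partial i g y - partial i g x| <= e) ->
  forall w, ball x d (x + w) ->
  `|g (x + w) - g x - \sum_i w ord0 i * partial i g x| <= e * \sum_i `|w ord0 i|.
Proof.
move=> e0 dg xA cg w xw.
have d0 : 0 < d by case: xw.
have key n : (n <= N)%N ->
  `|g (x + trunc_rV n w) - g x - \sum_(i < N | (i < n)%N) w ord0 i * partial i g x| <=
  e * \sum_(i < N | (i < n)%N) `|w ord0 i|.
  elim: n => [_|n IH nN].
    rewrite !big_pred0 // (_ : trunc_rV 0 w = 0); last by apply/rowP => k; rewrite !mxE.
    by rewrite addr0 subrr subr0 normr0 mulr0.
  have {IH} := IH (ltnW nN).
  pose i := Ordinal nN; rewrite (@trunc_rVS n w i) //.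
  have split_sum (G : 'I_N -> R) :
      \sum_(k < N | (k < n.+1)%N) G k = G i + \sum_(k < N | (k < n)%N) G k.
    rewrite (bigD1 i) /= ?ltnSn //; congr (_ + _); apply: eq_bigl => k.
    rewrite ltnS leq_eqVlt andbC; have [ki|ki] := eqVneq (k : nat) n.
      have -> : k = i by exact: val_inj.
      by rewrite eqxx /= ltnn.
    have -> // : k != i.
    by apply: contraNneq ki => ->; rewrite /= eqxx.
  rewrite !split_sum.
  have inb (c : R) : `|c| <= `|w ord0 i| -> ball x d (x + trunc_rV n w + c *: 'e_i).
    move=> cw; split => // a k; case: xw => _ /(_ a k); rewrite (ord1 a) !mxE eqxx /=.
    rewrite /ball /= !opprD !addrA subrr !add0r normrN => wd.
    have [ki|ki] := eqVneq k i.
      rewrite ki in wd *; rewrite ltnn oppr0 add0r mulr1 normrN.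
      exact: le_lt_trans wd.
    by rewrite mulr0n mulr0 oppr0 addr0 normrN; case: ifP => // _; rewrite normr0.
  have [c cw ec] := @MVT_lineW g (x + trunc_rV n w) 'e_i (w ord0 i)
     (fun t ht => dg i _ (xA _ (inb t ht))).
  rewrite addrA => IH; rewrite mulrDr.
  rewrite (_ : _ - _ = (g (x + trunc_rV n w + w ord0 i *: 'e_i) - g (x + trunc_rV n w) -
     w ord0 i * partial i g x) + (g (x + trunc_rV n w) - g x -
     \sum_(i < N | (i < n)%N) w ord0 i * partial i g x)); last by ring.
  apply: (le_trans (ler_normD _ _)); rewrite lerD //.
  rewrite ec mulrC -mulrBr normrM mulrC ler_wpM2r //.
  by apply: cg; exact: inb.
have := key N (leqnn N).
rewrite (_ : trunc_rV N w = w); last by apply/rowP => k; rewrite mxE ltn_ord.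
rewrite (eq_bigl xpredT); last by move=> k; exact: ltn_ord.
by rewrite [in X in _ <= _ * X](eq_bigl xpredT) // => k; exact: ltn_ord.
Qed.

End linear_approximation.

Definition lap (R : realType) (N : nat) (g : 'rV[R]_N -> R) (x : 'rV[R]_N) : R :=
  \sum_i partial i (partial i g) x.

(** The second derivatives that the Laplacian needs, without any continuity: it
    suffices for the maximum principle and is stable under sums. *)
Definition twice_derivable (R : realType) (N : nat) (A : set 'rV[R]_N)
    (g : 'rV[R]_N -> R) : Prop :=
  forall x, A x -> forall i, derivable g x 'e_i /\ derivable (partial i g) x 'e_i.

Section first_order.
Context {R : realType} {N : nat}.
Implicit Types (F g : 'rV[R]_N -> R) (A : set 'rV[R]_N) (x y v w nu : 'rV[R]_N).

(** Only partial derivatives are given, but their continuity yields all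
    directional derivatives; this is what makes reflections in arbitrary
    directions accessible. *)
Lemma C1_is_derive A g x v : open A -> is_Ck 1 A g -> A x ->
  is_derive x v g (\sum_i v ord0 i * partial i g x).
Proof.
move=> oA [_ Cg] Ax; set L := \sum_i _.
suff h : h^-1 *: ((g \o shift x) (h *: v) - g x) @[h --> 0^'] --> L.
  by split; [apply/cvg_ex; exists L|exact: cvg_lim].
apply/cvgrPdist_le => e e0.
pose S := \sum_i `|v ord0 i|.
have S0 : 0 <= S by apply: sumr_ge0.
have e'0 : 0 < e / (S + 1) by rewrite divr_gt0 // ltr_wpDl.
have Cgi i : {for x, continuous (partial i g)} by have [_ [+ _]] := Cg i; exact.
have /nbhs_ballP[d /= d0 hd] : \forall y \near x, A y /\
    forall i, `|partial i g y - partial i g x| <= e / (S + 1).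
  near=> y; split; first by near: y; exact: open_nbhs_nbhs.
  near: y; apply: filter_forall => i.
  by have /cvgrPdistC_le := Cgi i; apply.
near=> h.
have h0 : h != 0 by near: h; exact: nbhs_dnbhs_neq.
have hb : ball x d (x + h *: v).
  rewrite -ball_normE /= opprD addrA subrr add0r normrN normrZ.
  apply: (@le_lt_trans _ _ (`|h| * (`|v| + 1))); first by rewrite ler_wpM2l // lerDl.
  rewrite -ltr_pdivlMr ?ltr_wpDl //.
  near: h; apply: dnbhs0_lt; by rewrite divr_gt0 // ltr_wpDl.
have := @C1_linear_approx _ _ A g x (e / (S + 1)) d (ltW e'0)
  (fun i y Ay => (Cg i).1 y Ay) (fun y xy => (hd y xy).1)
  (fun i y xy => (hd y xy).2 i) (h *: v) hb.
have -> : \sum_i (h *: v) ord0 i * partial i g x = h * L.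
  by rewrite mulr_sumr; apply: eq_bigr => i _; rewrite mxE mulrA.
have -> : \sum_i `|(h *: v) ord0 i| = `|h| * S.
  by rewrite mulr_sumr; apply: eq_bigr => i _; rewrite mxE normrM.
move=> H; rewrite distrC /= [_ *: v + x]addrC.
have -> : h^-1 *: (g (x + h *: v) - g x) - L = h^-1 * (g (x + h *: v) - g x - h * L).
  by rewrite [in RHS]mulrBr mulKf.
rewrite normrM normfV ler_pdivrMl ?normr_gt0 //.
apply: (le_trans H); rewrite mulrCA ler_wpM2l //.
rewrite mulrAC ler_pdivrMr ?ltr_wpDl // ler_wpM2l ?(ltW e0) //.
by rewrite lerDl.
Unshelve. all: by end_near. Qed.

Lemma is_derive_partial_ext A g g' x v : open A -> (forall x, A x -> g x = g' x) -> A x ->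
  'D_v g x = 'D_v g' x /\ (derivable g x v -> derivable g' x v).
Proof.
move=> oA gg' Ax.
have h : \forall y \near x, g y = g' y.
  have : nbhs x A by exact: open_nbhs_nbhs.
  by apply: filterS => y Ay; exact: gg'.
by split; [exact: near_eq_derive|exact: near_eq_derivable].
Qed.

Lemma is_Ck_ext k A g g' : open A -> (forall x, A x -> g x = g' x) -> is_Ck k A g -> is_Ck k A g'.
Proof.
move=> oA.
have cont_ext h h' : (forall x, A x -> h x = h' x) ->
    (forall x, A x -> {for x, continuous h}) -> forall x, A x -> {for x, continuous h'}.
  move=> hh' ch x Ax.
  have hx : h x = h' x by exact: hh'.
  suff : h' @ nbhs x --> h x by rewrite hx.
  apply: cvg_trans (ch x Ax); apply: near_eq_cvg.
  have : nbhs x A by exact: open_nbhs_nbhs.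
  by apply: filterS => y Ay; exact: hh'.
elim: k g g' => [|k IH] g g' gg'.
  by move=> [cg _]; split => //; exact: cont_ext cg.
move=> [cg pg]; split; first exact: cont_ext cg.
move=> i; have [dg Cg] := pg i; split.
  by move=> x Ax; exact: (is_derive_partial_ext 'e_i oA gg' Ax).2 (dg x Ax).
apply: IH Cg => x Ax.
exact: (is_derive_partial_ext 'e_i oA gg' Ax).1.
Qed.

(** If the second derivative were positive at the maximum, the first one would be
    positive just to the right of it and the function would increase. *)
Lemma lap_max_partial A g x i : open A -> A x ->
  (forall y, A y -> derivable g y 'e_i) -> derivable (partial i g) x 'e_i ->
  (forall y, A y -> g y <= g x) -> partial i (partial i g) x <= 0.
Proof.
move=> oA Ax dg d2g gx.
have /nbhs_ballP[d /= d0 dA] := open_nbhs_nbhs (conj oA Ax).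
have inA (t : R) : `|t| < d -> A (x + t *: 'e_i).
  move=> td; apply: dA; split => // a k; rewrite (ord1 a) !mxE eqxx /= /ball /=.
  rewrite opprD addrA subrr add0r normrN normrM.
  case: (k == i); rewrite ?normr1 ?mulr1 // normr0 mulr0.
  exact: d0.
have dl (t : R) : `|t| < d ->
    is_derive t 1 (fun s => g (x + s *: 'e_i)) (partial i g (x + t *: 'e_i)).
  by move=> td; apply: is_derive_line; apply: dg; exact: inA.
have D0 : partial i g x = 0.
  have h : is_derive (0 : R) 1 (fun s => g (x + s *: 'e_i)) 0.
    apply: (@derive1_at_max R _ (- d) d).
    - by rewrite -subr_ge0 opprK addr_ge0 // ltW.
    - move=> t; rewrite in_itv /= -ltr_norml => td.
      by have [] := dl t td.
    - by rewrite in_itv /= oppr_lt0 d0.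
    - move=> t; rewrite in_itv /= -ltr_norml => td.
      by rewrite scale0r addr0; apply: gx; exact: inA.
  have := dl 0; rewrite normr0 scale0r addr0 => /(_ d0) h'.
  by rewrite -(@derive_val _ _ _ _ _ _ _ h') (@derive_val _ _ _ _ _ _ _ h).
rewrite leNgt; apply/negP => c0.
have := @cvgr_gt _ _ _ _ _ _ d2g _ c0.
move=> [e /= e0 he].
pose h := Num.min d e / 2.
have m0 : 0 < Num.min d e by rewrite lt_min d0 e0.
have h0 : 0 < h by rewrite divr_gt0.
have hm : h < Num.min d e by rewrite /h ltr_pdivrMr // ltr_pMr // ltr1n.
move: hm; rewrite lt_min => /andP[hd he'].
have [|c /andP[c0' ch] ec] := @MVT_line _ _ g x 'e_i h h0.
  by move=> t /andP[t0 th]; apply: dg; apply: inA; rewrite ger0_norm // (le_lt_trans th).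
have := gx (x + h *: 'e_i); rewrite -subr_le0 ec => /(_ (inA _ _)).
rewrite gtr0_norm // => /(_ hd); apply/negP; rewrite -ltNge mulr_gt0 //.
have ce : c < e := lt_trans ch he'.
have := he c; rewrite /= sub0r normrN gtr0_norm // => /(_ ce); rewrite gt_eqF // => /(_ isT).
rewrite D0 subr0 pmulr_rgt0 ?invr_gt0 //.
by rewrite /= addrC.
Qed.

End first_order.

Section laplacian.
Context {R : realType} {N : nat}.
Implicit Types (F g : 'rV[R]_N -> R) (A : set 'rV[R]_N) (x y v w nu : 'rV[R]_N).

Lemma C2_twice_derivable A g : is_Ck 2 A g -> twice_derivable A g.
Proof.
move=> [_ Cg] x Ax i; have [dg [_ C2g]] := Cg i.
by split; [exact: dg|have [d2g _] := C2g i; exact: d2g].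
Qed.

Lemma C2_C1 A g : is_Ck 2 A g -> is_Ck 1 A g.
Proof.
by move=> [cg Cg]; split => // i; have [dg [c1g _]] := Cg i.
Qed.

Lemma twice_derivable_lin A g1 g2 (c : R) : open A ->
  twice_derivable A g1 -> twice_derivable A g2 ->
  twice_derivable A (fun z => g1 z + c * g2 z) /\
  forall x, A x -> lap (fun z => g1 z + c * g2 z) x = lap g1 x + c * lap g2 x.
Proof.
move=> oA t1 t2.
have D1 v h1 h2 x : derivable h1 x v -> derivable h2 x v ->
    is_derive x v (fun z => h1 z + c * h2 z) ('D_v h1 x + c * 'D_v h2 x).
  move=> d1 d2; have /derivableP i1 := d1; have /derivableP i2 := d2.
  exact: (@is_deriveD _ _ _ h1 (c \*: h2) x v _ _ i1 (is_deriveZ c i2)).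
have P1 x i : A x -> partial i (fun z => g1 z + c * g2 z) x =
     partial i g1 x + c * partial i g2 x.
  move=> Ax; have [d1 _] := t1 x Ax i; have [d2 _] := t2 x Ax i.
  by have [_ e] := D1 _ _ _ _ d1 d2; exact: e.
have D2 x i : A x -> is_derive x 'e_i (partial i (fun z => g1 z + c * g2 z))
    (partial i (partial i g1) x + c * partial i (partial i g2) x).
  move=> Ax; have [_ d1] := t1 x Ax i; have [_ d2] := t2 x Ax i.
  have [dd <-] := D1 _ _ _ _ d1 d2.
  have [e1 e2] := is_derive_partial_ext 'e_i oA (fun y Ay => esym (P1 y i Ay)) Ax.
  by split; [exact: e2|rewrite e1].
split.
  move=> x Ax i; split; last by have [] := D2 x i Ax.
  have [d1 _] := t1 x Ax i; have [d2 _] := t2 x Ax i.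
  by have [] := D1 _ _ _ _ d1 d2.
move=> x Ax; rewrite /lap mulr_sumr -big_split; apply: eq_bigr => i _ /=.
by have [_ e] := D2 x i Ax; exact: e.
Qed.

Lemma lap_max A g x : open A -> A x -> twice_derivable A g ->
  (forall y, A y -> g y <= g x) -> lap g x <= 0.
Proof.
move=> oA Ax tg gx; apply: sumr_le0 => i _.
apply: (lap_max_partial oA Ax _ _ gx); first by move=> y Ay; have [] := tg y Ay i.
by have [] := tg x Ax i.
Qed.

Lemma reflection0Z nu (c : R) v : reflection nu 0 (c *: v) = c *: reflection nu 0 v.
Proof. by rewrite /reflection dotZl scalerDr scalerA; congr (_ + _ *: _); ring. Qed.

Lemma is_derive_reflection F nu a x v :
  derivable F (reflection nu a x) (reflection nu 0 v) ->
  is_derive x v (F \o reflection nu a) ('D_(reflection nu 0 v) F (reflection nu a x)).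
Proof.
move=> dF.
have e : (fun h : R => h^-1 *: (((F \o reflection nu a) \o shift x) (h *: v) -
      (F \o reflection nu a) x)) =
    (fun h => h^-1 *: ((F \o shift (reflection nu a x)) (h *: reflection nu 0 v) -
      F (reflection nu a x))).
  apply/funext => h /=; congr (_ *: (F _ - _)).
  by rewrite addrC reflectionD reflection0Z addrC.
by split; rewrite /derivable /derive e.
Qed.

Lemma open_reflection nu a A : open A -> open (reflection nu a @^-1` A).
Proof. by move=> oA; apply: open_comp => // x _; exact: continuous_reflection. Qed.

(** The images of the standard basis under the linear reflection are the rows of
    an orthogonal matrix. *)
Lemma reflection_orthogonal nu j k : dot nu nu = 1 ->
  \sum_i (reflection nu 0 'e_i) ord0 j * (reflection nu 0 'e_i) ord0 k = (j == k)%:R.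
Proof.
move=> n1.
have r0E (i l : 'I_N) : (reflection nu 0 'e_i) ord0 l =
    (l == i)%:R - 2 * nu ord0 i * nu ord0 l.
  rewrite /reflection !mxE eqxx /= [dot _ _](_ : _ = nu ord0 i).
    by rewrite sub0r mulrN mulNr.
  rewrite /dot (bigD1 i) //= mxE !eqxx mul1r big1 ?addr0 // => m mi.
  by rewrite mxE (negbTE mi) andbF mul0r.
have sE (G : 'I_N -> R) (l : 'I_N) : \sum_i (l == i)%:R * G i = G l.
  rewrite (bigD1 l) //= eqxx mul1r big1 ?addr0 // => m ml.
  by rewrite eq_sym (negbTE ml) mul0r.
under eq_bigr => i _ do rewrite !r0E.
transitivity (\sum_i ((j == i)%:R * (k == i)%:R - (j == i)%:R * (2 * nu ord0 i * nu ord0 k)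
   - (k == i)%:R * (2 * nu ord0 i * nu ord0 j)
   + (nu ord0 i * nu ord0 i) * (4 * nu ord0 j * nu ord0 k))).
  by apply: eq_bigr => i _; ring.
rewrite !big_split /= !sumrN !sE -mulr_suml -/(dot nu nu) n1 [k == j]eq_sym; ring.
Qed.

(** The Laplacian is the trace of the Hessian, and conjugation by the orthogonal
    linear part of the reflection preserves the trace. *)
Lemma lap_reflection A g nu a : open A -> is_Ck 2 A g -> dot nu nu = 1 ->
  twice_derivable (reflection nu a @^-1` A) (g \o reflection nu a) /\
  forall x, A (reflection nu a x) ->
    lap (g \o reflection nu a) x = lap g (reflection nu a x).
Proof.
move=> oA Cg n1; set T := reflection nu a.
have oB : open (T @^-1` A) by exact: open_reflection.
pose M (i : 'I_N) := reflection nu 0 'e_i.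
have C1g := C2_C1 Cg.
have C1p j : is_Ck 1 A (partial j g) by have [_ h] := Cg; have [_] := h j.
have D1 F x i : is_Ck 1 A F -> A (T x) ->
    is_derive x 'e_i (F \o T) (\sum_j M i ord0 j * partial j F (T x)).
  move=> CF Ax; have := C1_is_derive (M i) oA CF Ax.
  by move=> [dF <-]; exact: is_derive_reflection.
have P1 i x : A (T x) -> partial i (g \o T) x =
     \sum_j M i ord0 j * (partial j g \o T) x.
  by move=> Ax; have [_ e] := D1 g x i C1g Ax; exact: e.
have D2 i x : A (T x) -> is_derive x 'e_i (partial i (g \o T))
    (\sum_j M i ord0 j * \sum_k M i ord0 k * partial k (partial j g) (T x)).
  move=> Ax.
  have [dd <-] : is_derive x 'e_i (\sum_(j < N) (M i ord0 j \*: (partial j g \o T)))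
      (\sum_j M i ord0 j * \sum_k M i ord0 k * partial k (partial j g) (T x)).
    by apply: is_derive_sum => j; apply: is_deriveZ; exact: D1.
  have eP y : (T @^-1` A) y -> (\sum_(j < N) (M i ord0 j \*: (partial j g \o T))) y =
      partial i (g \o T) y.
    by move=> Ay; rewrite P1 // fct_sumE.
  have [e1 e2] := is_derive_partial_ext 'e_i oB eP Ax.
  by split; [exact: e2|rewrite e1].
split.
  move=> x Ax i; split; last by have [] := D2 i x Ax.
  by have [] := D1 g x i C1g Ax.
move=> x Ax; rewrite /lap.
transitivity (\sum_(i < N) \sum_(j < N) \sum_(k < N)
    M i ord0 j * (M i ord0 k * partial k (partial j g) (T x))).
  apply: eq_bigr => i _; have [_ e] := D2 i x Ax; rewrite [LHS]e.
  by apply: eq_bigr => j _; rewrite mulr_sumr.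
rewrite exchange_big /=; apply: eq_bigr => j _.
rewrite exchange_big /= (bigD1 j) //= [X in _ + X]big1 ?addr0.
  under eq_bigr => i _ do rewrite mulrA.
  by rewrite -mulr_suml reflection_orthogonal // eqxx mul1r.
move=> k kj; under eq_bigr => i _ do rewrite mulrA.
by rewrite -mulr_suml reflection_orthogonal // eq_sym (negbTE kj) mul0r.
Qed.

End laplacian.

(** * A barrier for the strong maximum principle and the Hopf lemma *)

Section barrier.
Context {R : realType} {N : nat}.
Implicit Types (F g : 'rV[R]_N -> R) (A : set 'rV[R]_N) (x y v w nu : 'rV[R]_N).

(** The converse of [is_derive_line], to compute directional derivatives of
    functions whose restriction to lines is explicit. *)
Lemma is_derive_from_line F x v (l : R) :
  is_derive (0 : R) 1 (fun s => F (x + s *: v)) l -> is_derive x v F l.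
Proof.
have e : (fun h : R => h^-1 *: ((fun s => F (x + s *: v)) (h *: 1 + 0) -
      F (x + 0 *: v))) =
    (fun h => h^-1 *: (F (h *: v + x) - F x)).
  apply/funext => h; congr (_ *: (F _ - F _)); last by rewrite scale0r addr0.
  by rewrite [h *: 1]mulr1 addr0 addrC.
by move=> [d <-]; move: d; rewrite /derivable /derive /= e => d; split.
Qed.

Lemma is_derive_sqdist x y v :
  is_derive x v (fun z => dot (z - y) (z - y)) (2 * dot (x - y) v).
Proof.
apply: is_derive_from_line.
have -> : (fun s : R => dot (x + s *: v - y) (x + s *: v - y)) =
    (fun s => dot (x - y) (x - y) + (2 * dot (x - y) v) * s + dot v v * (s * s)).
  apply/funext => s; rewrite addrAC !dotE (dotC v y) (dotC v x); ring.
apply: is_derive_eq; rewrite /GRing.scale /=; ring.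
Qed.

Lemma is_derive_coordB x y v i : is_derive x v (fun z => (z - y) ord0 i) (v ord0 i).
Proof.
apply: is_derive_from_line.
have -> : (fun s : R => (x + s *: v - y) ord0 i) =
    (fun s => (x - y) ord0 i + v ord0 i * s).
  by apply/funext => s; rewrite !mxE; ring.
apply: is_derive_eq; rewrite /GRing.scale /=; ring.
Qed.

Definition gauss (al : R) y x : R := expR (- al * dot (x - y) (x - y)).

Lemma is_derive_gauss al x y v :
  is_derive x v (gauss al y) (- 2 * al * dot (x - y) v * gauss al y x).
Proof.
apply: is_derive_from_line; rewrite /gauss.
have -> : (fun s : R => expR (- al * dot (x + s *: v - y) (x + s *: v - y))) =
    expR \o (fun s : R => - al * dot (x - y) (x - y) +
       (- al * 2 * dot (x - y) v) * s + (- al * dot v v) * (s * s)).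
  apply/funext => s /=; congr expR; rewrite addrAC !dotE (dotC v y) (dotC v x); ring.
have h : is_derive (0 : R) 1 (fun s : R => - al * dot (x - y) (x - y) +
       (- al * 2 * dot (x - y) v) * s + (- al * dot v v) * (s * s))
     (- al * 2 * dot (x - y) v).
  apply: is_derive_eq; rewrite /GRing.scale /=; ring.
have := is_derive1_comp (is_derive_expR _) h.
by rewrite !mulr0 !addr0 => {}h; apply: (is_derive_eq h); ring.
Qed.

Lemma dot_delta (z : 'rV[R]_N) i : dot z 'e_i = z ord0 i.
Proof.
rewrite /dot (bigD1 i) //= mxE !eqxx mulr1 big1 ?addr0 // => m mi.
by rewrite mxE (negbTE mi) andbF mulr0.
Qed.

Lemma lap_gauss al y x :
  lap (gauss al y) x = (4 * al ^+ 2 * dot (x - y) (x - y) - 2 * al * N%:R) * gauss al y x.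
Proof.
have P1 i : partial i (gauss al y) = (fun z => - 2 * al * (z - y) ord0 i * gauss al y z).
  apply/funext => z; have [_ e] := is_derive_gauss al z y 'e_i.
  by rewrite [LHS]e dot_delta.
have P2 i : partial i (partial i (gauss al y)) x =
    (4 * al ^+ 2 * (x - y) ord0 i ^+ 2 - 2 * al) * gauss al y x.
  rewrite P1.
  have h : is_derive x 'e_i (fun z => - 2 * al * (z - y) ord0 i * gauss al y z)
    ((4 * al ^+ 2 * (x - y) ord0 i ^+ 2 - 2 * al) * gauss al y x).
    have h1 := is_derive_coordB x y 'e_i i.
    have h2 := is_derive_gauss al x y 'e_i.
    have h3 := @is_deriveM _ _ ((- 2 * al) \*: (fun z => (z - y) ord0 i)) _ x 'e_i _ _
       (is_deriveZ _ h1) h2.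
    apply: (is_derive_eq h3); rewrite /GRing.scale /= dot_delta !mxE !eqxx /=.
    rewrite -[_ *: _]/(-2 * al * (x ord0 i - y ord0 i)); ring.
  by have [_ e] := h; exact: e.
rewrite /lap (eq_bigr _ (fun i _ => P2 i)) -mulr_suml; congr (_ * _).
rewrite big_split /= -mulr_sumr sumrN sumr_const card_ord.
rewrite (_ : \sum_i (x - y) ord0 i ^+ 2 = dot (x - y) (x - y)); last exact: eq_bigr.
by rewrite mulr_natr.
Qed.

Lemma gauss_twice_derivable A al y : twice_derivable A (gauss al y).
Proof.
move=> x _ i; split; first by have [] := is_derive_gauss al x y 'e_i.
have -> : partial i (gauss al y) = (fun z => - 2 * al * dot (z - y) 'e_i * gauss al y z).
  by apply/funext => z; have [_ e] := is_derive_gauss al z y 'e_i; exact: e.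
apply: derivableM; last by have [] := is_derive_gauss al x y 'e_i.
have -> : (fun z => - 2 * al * dot (z - y) 'e_i) =
    (- 2 * al) \*: (fun z => (z - y) ord0 i).
  by apply/funext => z; rewrite dot_delta.
by apply: derivableZ; have [] := is_derive_coordB x y 'e_i i.
Qed.

Lemma closed_sqball y (r : R) : closed [set x : 'rV[R]_N | dot (x - y) (x - y) <= r].
Proof.
apply: (@preimage_closed _ _ (fun x => dot (x - y) (x - y)) [set t | t <= r]).
  by move=> x _; exact: continuous_sqdist.
exact: closed_le.
Qed.

Lemma open_sqball y (r : R) : open [set x : 'rV[R]_N | dot (x - y) (x - y) < r].
Proof.
apply: (@open_comp _ _ (fun x => dot (x - y) (x - y)) [set t | t < r]).
  by move=> x _; exact: continuous_sqdist.
exact: open_lt.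
Qed.

Lemma sqball_sub_ball y (d : R) : 0 < d ->
  [set x : 'rV[R]_N | dot (x - y) (x - y) < d ^+ 2] `<=` ball y d.
Proof.
move=> d0 x /= xd; split => // i j; rewrite (ord1 i) /ball /= distrC.
rewrite -ltr_sqr ?nnegrE ?(ltW d0) // real_normK ?num_real //.
apply: le_lt_trans xd; have := coord_dot (x - y) j.
by rewrite !mxE.
Qed.

Lemma compact_sqball y (r : R) : compact [set x : 'rV[R]_N | dot (x - y) (x - y) <= r].
Proof.
apply: bounded_closed_compact; last exact: closed_sqball.
exists (`|y| + (`|r| + 1)); split; first exact: num_real.
move=> M yM x /= xr.
have d0 : 0 < `|r| + 1 by rewrite ltr_wpDl.
have : ball y (`|r| + 1) x.
  apply: sqball_sub_ball => //=.
  apply: (@le_lt_trans _ _ `|r|); first by rewrite (le_trans xr) // ler_norm.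
  have := normr_ge0 r; nra.
rewrite -ball_normE /= => yx.
rewrite -(subrK y x) addrC (le_trans (ler_normD _ _)) // (le_trans _ (ltW yM)) //.
by rewrite lerD2l distrC ltW.
Qed.

Lemma expR_chord (e t : R) : 0 <= e -> e * t <= e * expR t - e.
Proof.
move=> e0; rewrite -[X in _ <= _ - X]mulr1 -mulrBr ler_wpM2l //.
by rewrite lerBrDl expR_ge1Dx.
Qed.

(** Compare v with a multiple of exp (- al |x - y|^2) - exp (- al rho^2). For
    large [al] the exponential satisfies the strict reverse inequality away from
    y, so the difference has no positive maximum there; near y it is controlled
    by v y > 0, and on the sphere the barrier vanishes. The lower bound is linear
    in the distance to the sphere: inside the ball it is the strong maximum
    principle, at a boundary zero it is the Hopf lemma. *)
Lemma positivity_barrier (v : 'rV[R]_N -> R) y (rho C : R) : 0 < rho -> 0 <= C ->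
  (forall x, dot (x - y) (x - y) <= rho ^+ 2 -> {for x, continuous v} /\ 0 <= v x) ->
  twice_derivable [set x | dot (x - y) (x - y) < rho ^+ 2] v ->
  (forall x, dot (x - y) (x - y) < rho ^+ 2 -> lap v x <= C * v x) ->
  0 < v y ->
  exists2 k, 0 < k & forall x, dot (x - y) (x - y) <= rho ^+ 2 ->
    k * (rho ^+ 2 - dot (x - y) (x - y)) <= v x.
Proof.
move=> rho0 C0 cv tv lv vy.
have rho2 : 0 < rho ^+ 2 by rewrite exprn_gt0.
have cvy : {for y, continuous v}.
  by apply: (cv y _).1; rewrite subrr /dot big1 ?ltW // => i _; rewrite mxE mul0r.
pose m := v y / 2.
have m0 : 0 < m by rewrite divr_gt0.
have [d /= d0 hd] : exists2 d, 0 < d & ball y d `<=` [set x | m < v x].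
  apply/nbhs_ballP; apply: (@cvgr_gt _ _ (nbhs y) _ v (v y) cvy).
  by rewrite /m ltr_pdivrMr // ltr_pMr // ltr1n.
pose r2 := d ^+ 2.
have r20 : 0 < r2 by rewrite exprn_gt0.
(* [r2] bounds |x - y|^2 from below on the annulus; the choice gives
   4 al^2 r2 - 2 al N > C there. *)
pose al := (N%:R + C + 1) / r2 + 1.
have N0 : 0 <= N%:R :> R by exact: ler0n.
have al1 : 1 <= al by rewrite lerDr divr_ge0 ?(ltW r20) // addr_ge0 // addr_ge0.
have al2 : N%:R + C + 1 <= al * r2.
  by rewrite mulrDl divfK ?gt_eqF // lerDl mul1r ltW.
pose e := expR (- al * rho ^+ 2).
pose b x := m * (gauss al y x - e).
pose Om := [set x | dot (x - y) (x - y) < rho ^+ 2].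
pose K := [set x : 'rV[R]_N | dot (x - y) (x - y) <= rho ^+ 2].
have sq0 x : 0 <= dot (x - y) (x - y) by exact: dot_ge0.
have cb : continuous b.
  move=> x.
  have cg : {for x, continuous (gauss al y)}.
    have c1 := @cst_continuous 'rV[R]_N R (- al) x.
    have c2 := continuousM c1 (continuous_sqdist (y := y) (x:=x)).
    exact: (continuous_comp c2 (@continuous_expR R _)).
  have c1 := @cst_continuous 'rV[R]_N R m x.
  have c2 := @cst_continuous 'rV[R]_N R e x.
  exact: continuousM c1 (continuousB cg c2).
have cz : {within K, continuous (fun x => b x - v x)}.
  apply: continuous_in_subspaceT => x; rewrite inE => Kx.
  by apply: continuousB; [exact: cb|exact: (cv x Kx).1].
have bv x : K x -> b x <= v x.
  have Ky : K y by rewrite /K /= subrr /dot big1 ?ltW // => i _; rewrite mxE mul0r.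
  have [c] := compact_EVT_max (ex_intro _ y Ky) (compact_sqball (r:=rho ^+ 2)) cz.
  rewrite inE => Kc cmax Kx.
  suff : b c - v c <= 0 by move=> bc; rewrite -subr_le0; apply: le_trans bc; apply: cmax; rewrite inE.
  rewrite leNgt; apply/negP => zc.
  have gc1 : gauss al y c <= 1.
    by rewrite /gauss -expR0 ler_expR mulNr oppr_le0 mulr_ge0 // (le_trans ler01).
  have e0 : 0 < e by exact: expR_gt0.
  have g0 : 0 < gauss al y c by exact: expR_gt0.
  have [cr2|cr2] := ltP (dot (c - y) (c - y)) r2.
    have := hd c (sqball_sub_ball d0 cr2); rewrite /b in zc => /= mv.
    nra.
  move: (Kc); rewrite /K /= le_eqVlt => /orP[/eqP cr|cr].
    have := (cv c Kc).2; move: zc; rewrite /b /gauss cr -/e subrr mulr0 sub0r.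
    by rewrite oppr_gt0 ltNge => /negbTE ->.
  have oOm : open Om by exact: open_sqball.
  have [tg lg] := twice_derivable_lin (- m^-1) oOm
     (@gauss_twice_derivable Om al y) tv.
  have gz z : gauss al y z + - m^-1 * v z = m^-1 * (b z - v z) + e.
    by rewrite /b mulrBr mulKf ?gt_eqF //; ring.
  have := lap_max oOm cr tg; rewrite lg // lap_gauss => H.
  have {}H : (4 * al ^+ 2 * dot (c - y) (c - y) - 2 * al * N%:R) * gauss al y c
      + - m^-1 * lap v c <= 0.
    apply: H => z Oz; rewrite !gz lerD2r ler_pM2l ?invr_gt0 //; apply: cmax.
    by rewrite inE /K /=; exact: ltW.
  have lvc := lv c cr.
  rewrite mulNr subr_le0 ler_pdivlMl // in H.
  have h1 : C < 4 * al ^+ 2 * dot (c - y) (c - y) - 2 * al * N%:R.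
    have : 4 * al ^+ 2 * r2 - 2 * al * N%:R <= 4 * al ^+ 2 * dot (c - y) (c - y) - 2 * al * N%:R.
      by rewrite lerD2r ler_wpM2l // mulr_ge0 // sqr_ge0.
    apply: lt_le_trans.
    rewrite (_ : _ - _ = 2 * al * (2 * (al * r2) - N%:R)); last by ring.
    nra.
  have h2 : v c <= m * gauss al y c.
    by rewrite subr_gt0 /b in zc; apply: (le_trans (ltW zc)); rewrite ler_pM2l // gerBl ltW.
  have h3 : C * v c <= C * (m * gauss al y c) by rewrite ler_wpM2l.
  have : C * (m * gauss al y c) < (4 * al ^+ 2 * dot (c - y) (c - y) - 2 * al * N%:R) * (m * gauss al y c).
    by rewrite ltr_pM2r // mulr_gt0.
  apply/negP; rewrite -leNgt mulrCA; apply: (le_trans H); exact: (le_trans lvc).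
exists (m * e * al); first by rewrite !mulr_gt0 // ?expR_gt0 // (lt_le_trans ltr01).
move=> x Kx; apply: le_trans (bv x Kx); rewrite /b -2![m * _ * _]mulrA ler_pM2l // -mulrA.
have -> : gauss al y x = e * expR (al * (rho ^+ 2 - dot (x - y) (x - y))).
  by rewrite /gauss /e -expRD; congr expR; ring.
by apply: expR_chord; exact: expR_ge0.
Qed.

End barrier.

(** * Testing the weak equation with radial bumps *)

Section bump.
Context {R : realType} {N : nat}.
Implicit Types (F g : 'rV[R]_N -> R) (A K : set 'rV[R]_N) (x y v w nu : 'rV[R]_N).

(** The square makes the positive part continuously differentiable. *)
Definition pos_sqr (t : R) : R := Num.max 0 t ^+ 2.

(** In every sign case the difference quotient at step h differs from the
    derivative by at most |h|. *)
Lemma is_derive_pos_sqr (t : R) : is_derive t 1 pos_sqr (2 * Num.max 0 t).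
Proof.
suff h : h^-1 *: ((pos_sqr \o shift t) (h *: (1 : R)) - pos_sqr t) @[h --> (0 : R)^']
    --> 2 * Num.max 0 t.
  by split; [apply/cvg_ex; exists (2 * Num.max 0 t)|exact: cvg_lim].
apply/cvgrPdist_le => e e0; near=> h.
have h0 : h != 0 by near: h; exact: nbhs_dnbhs_neq.
have he : `|h| <= e by near: h; exact: dnbhs0_le.
rewrite /= [h *: 1]mulr1 distrC.
have -> : h^-1 *: (pos_sqr (h + t) - pos_sqr t) - 2 * Num.max 0 t =
    h^-1 * (pos_sqr (h + t) - pos_sqr t - 2 * Num.max 0 t * h).
  by rewrite [in RHS]mulrBr [_ * h]mulrC mulKf.
rewrite normrM normfV ler_pdivrMl ?normr_gt0 // (@le_trans _ _ (`|h| * `|h|)) //; last first.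
  by rewrite ler_wpM2l.
rewrite -expr2 real_normK ?num_real //.
rewrite /pos_sqr ler_norml.
case: (leP 0 t) => t0; case: (leP 0 (h + t)) => ht; nra.
Unshelve. all: by end_near. Qed.

Definition bump x (r : R) y : R := pos_sqr (r - dot (y - x) (y - x)).

Lemma bump_ge0 x r y : 0 <= bump x r y. Proof. exact: sqr_ge0. Qed.

Lemma bump_out x r y : r <= dot (y - x) (y - x) -> bump x r y = 0.
Proof. by move=> h; rewrite /bump /pos_sqr max_l ?expr0n // subr_le0. Qed.

Lemma bump_lower x (r k : R) y : 0 <= k -> dot (y - x) (y - x) <= r - k -> k ^+ 2 <= bump x r y.
Proof.
move=> k0 h; rewrite /bump /pos_sqr ler_sqr ?nnegrE //; first by rewrite le_max; lra.
by rewrite le_max lexx.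
Qed.

Lemma is_derive_bump x r y v : is_derive y v (bump x r)
  (- 4 * Num.max 0 (r - dot (y - x) (y - x)) * dot (y - x) v).
Proof.
apply: is_derive_from_line; rewrite /bump.
have dq : derivable (fun z => dot (z - x) (z - x)) (y + 0 *: v) v.
  by have [] := is_derive_sqdist (y + 0 *: v) x v.
have h := is_derive_line dq.
have h2 : is_derive (0 : R) 1 (fun s : R => r - dot (y + s *: v - x) (y + s *: v - x))
    (- (2 * dot (y - x) v)).
  have [_ e] := is_derive_sqdist (y + 0 *: v) x v.
  rewrite e scale0r addr0 in h.
  by have := is_deriveB (is_derive_cst r (0 : R) 1) h; rewrite sub0r.
have := is_derive1_comp (is_derive_pos_sqr _) h2.
rewrite scale0r addr0 => {}h; apply: (is_derive_eq h); ring.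
Qed.

Lemma partial_bumpE x r i : partial i (bump x r) =
  (fun y => - 4 * Num.max 0 (r - dot (y - x) (y - x)) * (y - x) ord0 i).
Proof.
apply/funext => y; have [_ e] := is_derive_bump x r y 'e_i.
by rewrite [LHS]e dot_delta.
Qed.

Lemma continuous_rdist x r : continuous (fun y => r - dot (y - x) (y - x)).
Proof.
move=> y; have c1 := @cst_continuous 'rV[R]_N R r y.
exact: continuousB c1 (continuous_sqdist (y := x) (x := y)).
Qed.

Lemma continuous_posdist x r : continuous (fun y => Num.max 0 (r - dot (y - x) (y - x))).
Proof.
move=> y; have c1 := @cst_continuous 'rV[R]_N R 0 y.
exact: continuous_max c1 (continuous_rdist (x := x) (r := r) (x0 := y)).
Qed.

Lemma continuous_bump x r : continuous (bump x r).
Proof.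
move=> y; have c := continuous_posdist (x := x) (r := r) (x0 := y).
have := continuousM c c.
by congr continuous_at; apply/funext => z; rewrite /bump /pos_sqr expr2.
Qed.

Lemma continuous_partial_bump x r i : continuous (partial i (bump x r)).
Proof.
rewrite partial_bumpE => y.
have c1 := @cst_continuous 'rV[R]_N R (- 4) y.
have c2 := continuous_posdist (x := x) (r := r) (x0 := y).
have c3 : {for y, continuous (fun z : 'rV[R]_N => (z - x) ord0 i)}.
  apply: (@continuous_comp _ _ _ (fun z : 'rV[R]_N => z - x) (fun z => z ord0 i)).
    apply: (@continuousB _ _ _ id (cst x) y); [exact: cvg_id|exact: cst_continuous].
  exact: continuous_coord.
exact: continuousM (continuousM c1 c2) c3.
Qed.

Lemma partial_bump_out x r y i : r <= dot (y - x) (y - x) -> partial i (bump x r) y = 0.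
Proof. by move=> h; rewrite partial_bumpE max_l ?subr_le0 // mulr0 mul0r. Qed.

Lemma bump_C1c x r A :
  [set y | dot (y - x) (y - x) <= r] `<=` A -> is_C1c A (bump x r).
Proof.
move=> BA.
have clB : closure [set y | bump x r y != 0] `<=` [set y | dot (y - x) (y - x) <= r].
  rewrite closureE => y; apply; split; first exact: closed_sqball.
  move=> z /=; apply: contraNT; rewrite -ltNge => h.
  by apply/eqP/bump_out/ltW.
split.
- split; first by move=> y _; exact: continuous_bump.
  move=> i; split; first by move=> y _; have [] := is_derive_bump x r y 'e_i.
  by split => // y _; exact: continuous_partial_bump.
- by apply: subclosed_compact clB; [exact: closed_closure|exact: compact_sqball].
- exact: subset_trans clB BA.
Qed.

(** The reflection of a radial bump is the bump around the reflected centre, so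
    a single family of test functions serves on both sides of the hyperplane. *)
Lemma bump_reflection nu a x r y : dot nu nu = 1 ->
  bump x r (reflection nu a y) = bump (reflection nu a x) r y.
Proof.
move=> n1; rewrite /bump -{1 2}(reflectionK a n1 x) reflectionB dot_reflection0 //.
Qed.

(** A product with a compactly supported factor is continuous as soon as it is
    continuous on a neighbourhood of the support, whatever default values the other
    factor takes elsewhere. *)
Lemma continuous_glue A K F : closed K -> K `<=` A ->
  (forall x, ~ K x -> F x = 0) -> (forall x, A x -> {for x, continuous F}) -> continuous F.
Proof.
move=> cK KA F0 cF x; have [Ax|nAx] := pselect (A x); first exact: cF.
have nKx : ~ K x by move=> /KA.
have h : {near x, F =1 cst 0}.
  have : nbhs x (~` K) by apply: open_nbhs_nbhs; split => //; exact: closed_openC.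
  by apply: filterS => y; exact: F0.
suff : F @ nbhs x --> (0 : R) by rewrite -(F0 x nKx).
apply: (@cvg_trans _ ((cst 0 : _ -> R) @ nbhs x)); last exact: cvg_cst.
by apply: near_eq_cvg; apply: filterS h => y ->.
Qed.

End bump.

Lemma continuous_powRV (R : realType) (gamma t : R) : 0 < t ->
  {for t, continuous (fun s : R => (s `^ gamma)^-1)}.
Proof.
move=> t0; apply: continuousV; first by rewrite gt_eqF // powR_gt0.
apply: differentiable_continuous; apply/derivable1_diffP.
by have [] := is_derive1_powR gamma t0.
Qed.

Section weak.
Context {R : realType} {N : nat}.
Notation leb := (lebesgue R N).
Variables (Omega : set 'rV[R]_N) (gamma : R) (f : 'rV[R]_N -> R -> R) (U : 'rV[R]_N -> R).
Hypotheses (oO : open Omega) (U2 : is_Ck 2 Omega U) (Upos : forall x, Omega x -> 0 < U x).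
Hypothesis (wU : weak_solution Omega gamma f U).

(** The value that the equation assigns to f (y, U y) when U is smooth. *)
Definition source (y : 'rV[R]_N) : R := - lap U y - (U y `^ gamma)^-1.

Lemma continuous_U y : Omega y -> {for y, continuous U}.
Proof. by move=> Oy; have [cU _] := U2; exact: cU. Qed.

Lemma continuous_partial_U i y : Omega y -> {for y, continuous (partial i U)}.
Proof. by move=> Oy; have [_ /(_ i) [_ [c _]]] := U2; exact: c. Qed.

Lemma continuous_partial2_U i y : Omega y -> {for y, continuous (partial i (partial i U))}.
Proof.
by move=> Oy; have [_ /(_ i) [_ [_ /(_ i) [_ [c _]]]]] := U2; exact: c.
Qed.

Lemma continuous_lap_U y : Omega y -> {for y, continuous (lap U)}.
Proof. by move=> Oy; apply: continuous_sumr => i; exact: continuous_partial2_U. Qed.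

Lemma continuous_powU y : Omega y -> {for y, continuous (fun y => (U y `^ gamma)^-1)}.
Proof.
move=> Oy; exact: (continuous_comp (continuous_U Oy) (continuous_powRV (Upos Oy))).
Qed.

Lemma continuous_source y : Omega y -> {for y, continuous source}.
Proof.
move=> Oy; exact: (continuousB (continuousN (continuous_lap_U Oy)) (continuous_powU Oy)).
Qed.

Lemma Rintegral_sumr n (G : 'I_n -> 'rV[R]_N -> R) :
  (forall i, leb.-integrable setT (EFin \o G i)) ->
  leb.-integrable setT (EFin \o (fun y => \sum_i G i y)) /\
  \int[leb]_y (\sum_i G i y) = \sum_i \int[leb]_y G i y.
Proof.
elim: n G => [|n IH] G iG.
  have -> : (fun y => \sum_i G i y) = cst 0 by apply/funext => y; rewrite big_ord0.
  split; first exact: integrable0.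
  by rewrite big_ord0 /Rintegral integral0.
have [i1 e1] := IH (fun i => G (lift ord0 i)) (fun i => iG _).
have -> : (fun y => \sum_i G i y) =
    (fun y => G ord0 y + \sum_i G (lift ord0 i) y).
  by apply/funext => y; rewrite big_ord_recl.
split; first exact: (integrableD measurableT (iG ord0) i1).
by rewrite RintegralD // big_ord_recl e1.
Qed.

Variables (x : 'rV[R]_N) (r : R).
Let K := [set y | dot (y - x) (y - x) <= r].
Hypothesis (KO : K `<=` Omega).
Notation phi := (bump x r).

Let cK : compact K. Proof. exact: compact_sqball. Qed.
Let phi0 y : ~ K y -> phi y = 0.
Proof. by move=> h; apply/bump_out/ltW; rewrite ltNge; apply/negP. Qed.
Let dphi0 y i : ~ K y -> partial i phi y = 0.
Proof. by move=> h; apply/partial_bump_out/ltW; rewrite ltNge; apply/negP. Qed.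

Lemma integrable_glue F : (forall y, ~ K y -> F y = 0) ->
  (forall y, Omega y -> {for y, continuous F}) ->
  continuous F /\ leb.-integrable setT (EFin \o F).
Proof.
move=> F0 cF.
have cFT : continuous F.
  exact: continuous_glue (closed_sqball (y := x) (r := r)) KO F0 cF.
by split => //; exact: continuous_compact_integrable cFT cK F0.
Qed.

(** The integrand of the difference of the two sides is the derivative of the
    compactly supported function phi * partial i U. *)
Lemma integral_by_parts i :
  \int[leb]_y (partial i U y * partial i phi y) =
  - \int[leb]_y (phi y * partial i (partial i U) y).
Proof.
pose F y := phi y * partial i U y.
have cphi y : {for y, continuous phi} by exact: continuous_bump.
have cdphi y : {for y, continuous (partial i phi)} by exact: continuous_partial_bump.
have F0 y : ~ K y -> F y = 0 by move=> h; rewrite /F phi0 // mul0r.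
have [cF _] := integrable_glue F0 (fun y Oy => continuousM (cphi y) (@continuous_partial_U i y Oy)).
have [_ iA] : continuous (fun y => partial i U y * partial i phi y) /\
   leb.-integrable setT (EFin \o (fun y => partial i U y * partial i phi y)).
  apply: integrable_glue => [y h|y Oy]; first by rewrite dphi0 // mulr0.
  exact: continuousM (@continuous_partial_U i y Oy) (cdphi y).
have [_ iB] : continuous (fun y => phi y * partial i (partial i U) y) /\
   leb.-integrable setT (EFin \o (fun y => phi y * partial i (partial i U) y)).
  apply: integrable_glue => [y h|y Oy]; first by rewrite phi0 // mul0r.
  exact: continuousM (cphi y) (@continuous_partial2_U i y Oy).
have dU y : Omega y -> derivable (partial i U) y 'e_i.
  by move=> Oy; have [] := C2_twice_derivable U2 Oy i.
have oK : open (~` K) by apply: closed_openC; exact: closed_sqball.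
have dF y : is_derive y 'e_i F
    (partial i U y * partial i phi y + phi y * partial i (partial i U) y).
  have [Oy|nOy] := pselect (Omega y).
    have [dp ep] := is_derive_bump x r y 'e_i.
    have h := is_deriveM (derivableP dp) (derivableP (dU y Oy)).
    by apply: (is_derive_eq h); rewrite addrC.
  have nKy : ~ K y by move=> /KO.
  rewrite dphi0 // phi0 // mulr0 mul0r addr0.
  have [e1 e2] := is_derive_partial_ext 'e_i oK
    (fun z (nKz : (~` K) z) => esym (F0 z nKz) : cst 0 z = F z) nKy.
  split; first by apply: e2; exact: derivable_cst.
  by rewrite -e1 derive_cst.
have DE : 'D_('e_i) F = (fun y => partial i U y * partial i phi y +
    phi y * partial i (partial i U) y).
  by apply/funext => y; have [_ e] := dF y.
have := @Rintegral_derive _ _ F K 'e_i cF cK F0 (fun y => let: DeriveDef d _ := dF y in d).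
rewrite DE RintegralD // => h; apply/eqP; rewrite -addr_eq0; apply/eqP/h.
have cDA y : Omega y -> {for y, continuous (fun y => partial i U y * partial i phi y +
    phi y * partial i (partial i U) y)}.
  move=> Oy; apply: continuousD.
    exact: continuousM (@continuous_partial_U i y Oy) (cdphi y).
  exact: continuousM (cphi y) (@continuous_partial2_U i y Oy).
apply: (integrable_glue _ cDA).1 => y nKy.
by rewrite dphi0 // phi0 // mulr0 mul0r addr0.
Qed.

Lemma integrable_source : leb.-integrable setT (EFin \o (fun y => source y * phi y)).
Proof.
apply: (integrable_glue _ _).2 => [y h|y Oy]; first by rewrite phi0 // mulr0.
exact: continuousM (continuous_source Oy) (continuous_bump (x0 := y)).
Qed.

Lemma restrict_phi (F : 'rV[R]_N -> R) : (forall y, ~ K y -> F y = 0) -> F \_ Omega = F.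
Proof.
move=> F0; apply/funext => y; rewrite patchE; case: ifPn => // yO.
by rewrite F0 // => /KO Oy; move: yO; rewrite mem_set.
Qed.

Lemma RintegralO (F : 'rV[R]_N -> R) : (forall y, ~ K y -> F y = 0) ->
  \int[leb]_(y in Omega) F y = \int[leb]_y F y.
Proof. by move=> F0; rewrite Rintegral_mkcond restrict_phi. Qed.

(** The two functions f (y, U y) and [source] agree against bumps; they need not
    agree at any given point. *)
Lemma weak_source :
  leb.-integrable setT (EFin \o (fun y => f y (U y) * phi y)) /\
  \int[leb]_y (f y (U y) * phi y) = \int[leb]_y (source y * phi y).
Proof.
have mO : measurable (Omega : set (lebesgue_space R N)).
  by apply: lebesgue_measurable; exact: open_measurable_rV.
have [if_ e] := wU (bump_C1c KO).
have f0 y : ~ K y -> f y (U y) * phi y = 0 by move=> h; rewrite phi0 // mulr0.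
have if' : leb.-integrable setT (EFin \o (fun y => f y (U y) * phi y)).
  move/(integrable_mkcond _ mO) : if_; congr (leb.-integrable _ _).
  by rewrite -[in RHS](restrict_phi f0) restrict_EFin.
split => //.
have g0 y : ~ K y -> dot (gradient U y) (gradient phi y) = 0.
  by move=> h; rewrite /dot big1 // => i _; rewrite !mxE dphi0 // mulr0.
have p0 y : ~ K y -> phi y / (U y `^ gamma) = 0 by move=> h; rewrite phi0 // mul0r.
move: e; rewrite (RintegralO g0) (RintegralO p0) (RintegralO f0).
pose A i y := partial i U y * partial i phi y.
pose B i y := phi y * partial i (partial i U) y.
have iA i : leb.-integrable setT (EFin \o A i).
  apply: (integrable_glue _ _).2 => [y h|y Oy]; first by rewrite /A dphi0 // mulr0.
  exact: continuousM (@continuous_partial_U i y Oy) (continuous_partial_bump (x0 := y)).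
have iB i : leb.-integrable setT (EFin \o B i).
  apply: (integrable_glue _ _).2 => [y h|y Oy]; first by rewrite /B phi0 // mul0r.
  exact: continuousM (continuous_bump (x0 := y)) (@continuous_partial2_U i y Oy).
have iP : leb.-integrable setT (EFin \o (fun y => phi y / (U y `^ gamma))).
  apply: (integrable_glue _ _).2 => [y h|y Oy]; first by rewrite phi0 // mul0r.
  exact: continuousM (continuous_bump (x0 := y)) (continuous_powU Oy).
have -> : (fun y => dot (gradient U y) (gradient phi y)) = (fun y => \sum_i A i y).
  by apply/funext => y; apply: eq_bigr => i _; rewrite !mxE.
have [iSA eA] := Rintegral_sumr iA.
have [iSB eB] := Rintegral_sumr iB.
rewrite eA (eq_bigr _ (fun i _ => integral_by_parts i)) sumrN -/(B _) -eB => e.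
have -> : (fun y => source y * phi y) =
    (fun y => - (\sum_i B i y) - phi y / (U y `^ gamma)).
  apply/funext => y; rewrite /source mulrBl mulNr [_^-1 * _]mulrC; congr (- _ - _).
  by rewrite /lap mulr_suml; apply: eq_bigr => i _; rewrite /B mulrC.
have iN : leb.-integrable setT (EFin \o (fun y => - (\sum_i B i y))).
  exact: (integrableN iSB).
rewrite RintegralB //.
have -> : \int[leb]_y (- (\sum_i B i y)) = - \int[leb]_y (\sum_i B i y).
  have := RintegralZl (-1) measurableT iSB.
  by rewrite mulN1r => <-; apply: eq_Rintegral => y _; rewrite mulN1r.
by rewrite e addrC addKr.
Qed.

End weak.

(** * From the weak equation to a pointwise reflection inequality *)

Lemma Rintegral_scaled_indic (d : measure_display) (T : measurableType d) (R : realType)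
    (mu : {measure set T -> \bar R}) (k : R) (S : set T) : measurable S -> 0 <= k ->
  (mu S < +oo)%E -> \int[mu]_x (k * \1_S x) = k * fine (mu S).
Proof.
move=> mS k0 Soo; rewrite /Rintegral; under eq_integral do rewrite EFinM.
rewrite ge0_integralZl // ?integral_indic ?setIT //.
- by rewrite fineM // ge0_fin_numE.
- exact/measurable_EFinP/measurable_indic.
Qed.

Lemma lebesgue_sqball (R : realType) (N : nat) (x : 'rV[R]_N) (r : R) : 0 < r ->
  let S := [set y : 'rV[R]_N | dot (y - x) (y - x) < r] in
  measurable S /\ (0 < lebesgue R N S < +oo)%E.
Proof.
move=> r0 S.
have mS : measurable S by apply: open_measurable_rV; exact: open_sqball.
split=> //.
have s0 : 0 < Num.sqrt r by rewrite sqrtr_gt0.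
rewrite lebesgueE //.
have -> : S = (fun y => y + - x) @^-1` @eball R N (Num.sqrt r).
  apply/seteqP; split => y; rewrite /S /eball /= enorm_lt ?(ltW s0) //;
  by rewrite sqr_sqrtr // ltW.
rewrite borel_lebesgue_translation; first exact: borel_lebesgue_eball.
by apply: open_measurable_rV; exact: open_eball.
Qed.

Section pointwise.
Context {R : realType} {N : nat}.
Notation leb := (lebesgue R N).
Variables (Omega : set 'rV[R]_N) (gamma : R) (f : 'rV[R]_N -> R -> R) (U : 'rV[R]_N -> R).
Hypotheses (oO : open Omega) (U2 : is_Ck 2 Omega U) (Upos : forall x, Omega x -> 0 < U x).
Hypotheses (wU : weak_solution Omega gamma f U) (cU : continuous U).
Variables (nu : 'rV[R]_N) (lambda L : R) (W : set 'rV[R]_N).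
Let T := reflection nu lambda.
Hypotheses (n1 : dot nu nu = 1) (oW : open W) (WO : W `<=` Omega)
  (WT : forall y, W y -> Omega (T y)).
Hypothesis fle : forall y, W y ->
  f y (U y) <= f (T y) (U (T y)) + L * `|U y - U (T y)|.

(** If the inequality failed at x it would fail uniformly near x. Integrating
    the hypothesis on f against a bump supported there, and replacing f by
    [source] on both sides by [weak_source], would bound a positive integral by
    0. On the reflected side this uses that the measure and the bump are carried
    along by the reflection. *)
Lemma source_le x : W x ->
  source gamma U x <= source gamma U (T x) + L * `|U x - U (T x)|.
Proof.
move=> Wx; rewrite leNgt; apply/negP => Gx.
pose h := source gamma U.
pose w y := L * `|U y - U (T y)|.
pose G y := h y - (h (T y) + w y).
have cw : continuous w.
  move=> y; have c1 := @cst_continuous 'rV[R]_N R L y.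
  have c2 := continuous_comp (@continuous_reflection R N nu lambda y) (@cU (T y)).
  exact: (continuousM c1 (cvg_norm (continuousB (@cU y) c2))).
have cG : {for x, continuous G}.
  have c1 := @continuous_source _ _ _ gamma _ U2 Upos _ (WO Wx).
  have c2 := continuous_comp (@continuous_reflection R N nu lambda x)
    (@continuous_source _ _ _ gamma _ U2 Upos _ (WT Wx)).
  have c3 : {for x, continuous w} by exact: cw.
  have := continuousB c1 (continuousD c2 c3). exact.
pose c := G x / 2.
have G0 : 0 < G x by rewrite subr_gt0.
have c0 : 0 < c by rewrite divr_gt0.
have cG2 : c < G x by rewrite /c ltr_pdivrMr // ltr_pMr // ltr1n.
have /nbhs_ballP[d /= d0 hd] : \forall y \near x, W y /\ c < G y.
  near=> y; split; first by near: y; exact: open_nbhs_nbhs.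
  by near: y; apply: (@cvgr_gt _ _ (nbhs x) _ G (G x) cG).
(* Bumps are indexed by the square of their radius. *)
pose r := d ^+ 2 / 2.
have r0 : 0 < r by rewrite divr_gt0 // exprn_gt0.
have rd : r < d ^+ 2 by rewrite /r ltr_pdivrMr // ltr_pMr ?ltr1n // exprn_gt0.
pose K := [set y | dot (y - x) (y - x) <= r].
have Kd y : K y -> W y /\ c < G y.
  by move=> Ky; apply: hd; apply: sqball_sub_ball => //=; exact: le_lt_trans Ky rd.
have KO : K `<=` Omega by move=> y /Kd[/WO].
pose K' := [set y | dot (y - T x) (y - T x) <= r].
have K'O : K' `<=` Omega.
  move=> y K'y; rewrite -(reflectionK lambda n1 y); apply: WT.
  apply: (Kd _ _).1; rewrite /K /= -{1 2}(reflectionK lambda n1 x) reflectionB.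
  by rewrite dot_reflection0.
pose phi := bump x r; pose phi' := bump (T x) r.
have phiT y : phi' (T y) = phi y.
  by rewrite /phi' bump_reflection // /T reflectionK.
have phi0 y : ~ K y -> phi y = 0.
  by move=> nK; apply/bump_out/ltW; rewrite ltNge; apply/negP.
have [i1 e1] := weak_source oO U2 Upos wU KO.
have [i2 e2] := weak_source oO U2 Upos wU K'O.
have j1 := integrable_source gamma U2 Upos KO.
have j2 := integrable_source gamma U2 Upos K'O.
have [iT1 eT1] := Rintegral_reflection lambda n1 i2.
have [iT2 eT2] := Rintegral_reflection lambda n1 j2.
have iw : leb.-integrable setT (EFin \o (fun y => w y * phi y)).
  apply: (integrable_glue KO _ _).2 => [y h1|y Oy]; first by rewrite phi0 // mulr0.
  exact: continuousM (cw y) (continuous_bump (x0 := y)).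
have E1 : (fun y => f (T y) (U (T y)) * phi' (T y)) =
    (fun y => f (T y) (U (T y)) * phi y) by apply/funext => y; rewrite phiT.
have E2 : (fun y => h (T y) * phi' (T y)) =
    (fun y => h (T y) * phi y) by apply/funext => y; rewrite phiT.
rewrite -/T -/phi' E1 in iT1 eT1; rewrite -/T -/phi' -/h E2 in iT2 eT2.
have i3 : leb.-integrable setT
    (EFin \o (fun y => f (T y) (U (T y)) * phi y + w y * phi y)).
  exact: (integrableD measurableT iT1 iw).
have H1 : \int[leb]_y (f y (U y) * phi y) <=
    \int[leb]_y (f (T y) (U (T y)) * phi y + w y * phi y).
  apply: le_Rintegral => // y _.
  have [Ky|nKy] := pselect (K y); last by rewrite phi0 // !mulr0 addr0.
  rewrite -mulrDl ler_wpM2r ?bump_ge0 //; apply: fle; exact: (Kd y Ky).1.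
rewrite RintegralD // eT1 e2 -eT2 e1 -/h -/phi in H1.
have i4 : leb.-integrable setT (EFin \o (fun y => h (T y) * phi y + w y * phi y)).
  exact: (integrableD measurableT iT2 iw).
have i5 : leb.-integrable setT
    (EFin \o (fun y => h y * phi y - (h (T y) * phi y + w y * phi y))).
  exact: (integrableB measurableT j1 i4).
have H2 : \int[leb]_y (h y * phi y - (h (T y) * phi y + w y * phi y)) <= 0.
  by rewrite RintegralB // RintegralD // subr_le0.
have r20 : 0 < r / 2 by rewrite divr_gt0.
pose S := [set y | dot (y - x) (y - x) < r / 2].
have mS := (lebesgue_sqball x r20).1.
pose k := c * (r / 2) ^+ 2.
have k0 : 0 < k by rewrite mulr_gt0 // exprn_gt0.
have SK y : S y -> K y.
  by rewrite /S /K /= => /ltW h1; apply: (le_trans h1); rewrite [leRHS](splitr r) lerDl ltW.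
have [M KM] := compact_norm_bounded (compact_sqball (y := x) (r := r)).
have iS : leb.-integrable setT (EFin \o (fun y => k * \1_S y)).
  apply: (@bounded_support_integrable _ _ (fun y => k * \1_S y) k M).
  - by apply: measurable_funM => //; exact: measurable_indic.
  - move=> y; rewrite normrM gtr0_norm // indicE ler_piMr ?(ltW k0) //.
    by case: (y \in S); rewrite ?normr1 ?normr0.
  - by move=> y /KM nK; rewrite indicE memNset ?mulr0 // => /SK.
have H3 : \int[leb]_y (k * \1_S y) <=
    \int[leb]_y (h y * phi y - (h (T y) * phi y + w y * phi y)).
  apply: le_Rintegral => // y _; rewrite -mulrDl -mulrBl -/(G y) indicE.
  have [Ky|nKy] := pselect (K y); last first.
    by rewrite phi0 // memNset ?mulr0 // => /SK.
  have [Sy|nSy] := pselect (S y); last first.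
    rewrite memNset // mulr0 mulr_ge0 ?bump_ge0 //.
    by apply: ltW; exact: lt_trans c0 (Kd y Ky).2.
  rewrite mem_set // mulr1 /k ler_pM ?sqr_ge0 ?(ltW c0) ?(ltW (Kd y Ky).2) //.
  apply: bump_lower; first exact: ltW.
  by apply: (le_trans (ltW Sy)); rewrite lerBrDr -splitr.
have : 0 < \int[leb]_y (k * \1_S y).
  have [_ /andP[S0 Soo]] := lebesgue_sqball x r20.
  rewrite (Rintegral_scaled_indic (lebesgue_measurable mS) (ltW k0) Soo).
  by apply: mulr_gt0 => //; apply: fine_gt0; rewrite S0 Soo.
by rewrite ltNge (le_trans H3).
Unshelve. all: by end_near. Qed.
End pointwise.

(** * Negative powers and domains symmetric in one direction *)

Section inverse_power.
Context {R : realType}.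
Implicit Types (a b m L gamma : R).

Lemma MVT_powRV gamma a b : 0 < a -> a < b ->
  exists2 c, a < c < b &
    (a `^ gamma)^-1 - (b `^ gamma)^-1 = gamma * (c `^ (gamma + 1))^-1 * (b - a).
Proof.
move=> a0 ab.
have d (t : R) : 0 < t -> is_derive t 1 (fun s : R => s `^ (- gamma)) (- gamma * t `^ (- gamma - 1)).
  by move=> t0; exact: (is_derive1_powR (- gamma) t0).
have [||c] := @MVT R (fun s : R => s `^ (- gamma)) (fun t => - gamma * t `^ (- gamma - 1)) a b ab.
- by move=> t; rewrite in_itv /= => /andP[at_ _]; apply: d; exact: lt_trans at_.
- apply: derivable_within_continuous => t; rewrite in_itv /= => /andP[at_ _].
  by have [] := d t (lt_le_trans a0 at_).
rewrite in_itv /= => cab e; exists c => //.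
rewrite -!powRN opprD.
by rewrite -[LHS]opprB e; ring.
Qed.

Lemma powRV_lipschitz gamma m a b : 0 < gamma -> 0 < m -> m <= a -> a <= b ->
  (a `^ gamma)^-1 - (b `^ gamma)^-1 <= gamma * (m `^ (gamma + 1))^-1 * (b - a).
Proof.
move=> g0 m0 ma; rewrite le_eqVlt => /predU1P[->|ab]; first by rewrite !subrr mulr0.
have a0 : 0 < a := lt_le_trans m0 ma.
have [c /andP[ac cb] ->] := MVT_powRV gamma a0 ab.
have mc : m <= c := le_trans ma (ltW ac).
rewrite ler_wpM2r ?subr_ge0 ?(ltW ab) // ler_wpM2l ?(ltW g0) //.
rewrite lef_pV2 ?posrE ?powR_gt0 ?(lt_le_trans m0 mc) //.
by rewrite ge0_ler_powR ?nnegrE ?addr_ge0 ?(ltW g0) ?(ltW m0) ?(le_trans (ltW m0) mc).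
Qed.

(** The slope - gamma t^(- gamma - 1) tends to - oo at 0, so below some [de] it
    beats the slope L. *)
Lemma powRV_steep gamma L : 0 < gamma -> 0 <= L ->
  exists2 de, 0 < de & forall a b, 0 < a -> a < b -> b < de ->
    (b `^ gamma)^-1 - (a `^ gamma)^-1 + L * (b - a) < 0.
Proof.
move=> g0 L0.
have q0 : 0 < gamma + 1 by rewrite addr_gt0.
have t0 : 0 < gamma / (L + 1) by rewrite divr_gt0 // ltr_wpDl.
pose de := (gamma / (L + 1)) `^ (gamma + 1)^-1.
exists de => [|a b a0 ab bde]; first exact: powR_gt0.
have [c /andP[ac cb] e] := MVT_powRV gamma a0 ab.
have c0 : 0 < c := lt_trans a0 ac.
have cq : c `^ (gamma + 1) < gamma / (L + 1).
  have -> : gamma / (L + 1) = de `^ (gamma + 1).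
    by rewrite /de -powRrM mulVf ?gt_eqF // powRr1 // ltW.
  by rewrite gt0_ltr_powR ?nnegrE ?(ltW c0) ?powR_ge0 // (lt_trans cb).
rewrite -[X in X + _]opprB e addrC -mulrBl pmulr_llt0 ?subr_gt0 // subr_lt0.
rewrite ltr_pdivlMr ?powR_gt0 //.
rewrite ltr_pdivlMr ?ltr_wpDl // mulrC in cq.
apply: le_lt_trans cq; rewrite ler_wpM2r ?powR_ge0 // lerDl //.
Qed.

End inverse_power.

Section geometry.
Context {R : realType} {N : nat}.
Variables (Omega : set 'rV[R]_N) (nu : 'rV[R]_N).
Hypotheses (n1 : dot nu nu = 1) (cvO : convex_dir nu Omega) (syO : symmetric_dir nu Omega).
Implicit Types (x y z : 'rV[R]_N) (s t lambda : R).

Lemma reflection0_in x : Omega x -> Omega (reflection nu 0 x).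
Proof. by move=> Ox; rewrite -syO; exists x. Qed.

(** The segment from x to its mirror image in {x . nu = 0} stays inside. *)
Lemma segment_in x s : Omega x -> 0 <= s <= - 2 * dot x nu -> Omega (x + s *: nu).
Proof.
move=> Ox /andP[s0 s1].
have [e|ne] := eqVneq (dot x nu) 0.
  have -> : s = 0 by apply/eqP; rewrite eq_le s0 andbT (le_trans s1) // e mulr0.
  by rewrite scale0r addr0.
have Ox' : Omega (x + (- 2 * dot x nu) *: nu).
  by have := reflection0_in Ox; rewrite /reflection sub0r mulrN -mulNr.
have d0 : 0 < - 2 * dot x nu.
  have : dot x nu < 0 by rewrite lt_neqAle ne /=; lra.
  lra.
have := @cvO x _ Ox Ox' (s / (- 2 * dot x nu)).
rewrite divfK ?gt_eqF //; apply.
by rewrite divr_ge0 ?(ltW d0) //= ler_pdivrMr // mul1r.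
Qed.

Lemma reflection_in x lambda : lambda <= 0 -> Omega x -> dot x nu <= lambda ->
  Omega (reflection nu lambda x).
Proof. by move=> l0 Ox xl; apply: segment_in => //; apply/andP; split; lra. Qed.

(** If the reflected point is still to the left of {x . nu = 0}, this is the
    monotonicity of f along nu. If it is to the right, replace it by its mirror
    image, which is x moved by - 2 lambda > 0 along nu. The hypotheses say nothing
    about f on {x . nu = 0} itself, which is why this case is excluded. *)
Lemma monotone_reflection (f : 'rV[R]_N -> R -> R) x lambda t :
  monotone_symmetric_dir nu Omega f -> lambda < 0 -> Omega x -> dot x nu < lambda ->
  dot (reflection nu lambda x) nu != 0 -> 0 <= t ->
  f x t <= f (reflection nu lambda x) t.
Proof.
move=> [fm fs] l0 Ox xl Tx0 t0.
have OT : Omega (reflection nu lambda x) by apply: reflection_in => //; exact: ltW.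
have capx : left_cap nu Omega x by split=> //=; exact: lt_trans l0.
move: Tx0; rewrite neq_lt => /orP[Tx|Tx].
  apply: (fm t t0 x) => //; first by lra.
pose y := x + (- 2 * lambda) *: nu.
have yE : reflection nu 0 y = reflection nu lambda x.
  by rewrite /y /reflection !dotE n1 -addrA -scalerDl; congr (_ + _ *: _); ring.
have capy : left_cap nu Omega y.
  split; last by rewrite /= /y !dotE n1; rewrite dot_reflection // in Tx; lra.
  by apply: segment_in => //; apply/andP; split; lra.
rewrite -yE -fs //; apply: (fm t t0 x) => //; lra.
Qed.

End geometry.

(** * The moving plane *)

Section sets.
Context {R : realType} {N : nat}.
Implicit Types (x y z nu : 'rV[R]_N).

Lemma open_dot_lt nu (a : R) : open [set z : 'rV[R]_N | dot z nu < a].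
Proof.
apply: (@open_comp _ _ (fun z => dot z nu) [set t | t < a]); last exact: open_lt.
by move=> z _; exact: continuous_dotl.
Qed.

Lemma closed_dot_le nu (a : R) : closed [set z : 'rV[R]_N | dot z nu <= a].
Proof.
apply: (@preimage_closed _ _ (fun z => dot z nu) [set t | t <= a]); last exact: closed_le.
by move=> z _; exact: continuous_dotl.
Qed.

Lemma open_dot_neq nu (a : R) : open [set z : 'rV[R]_N | dot z nu != a].
Proof.
apply: (@open_comp _ _ (fun z => dot z nu) [set t | t != a]); last exact: open_neq.
by move=> z _; exact: continuous_dotl.
Qed.

Lemma cauchy_schwarz_unit w nu : dot nu nu = 1 -> dot w nu ^+ 2 <= dot w w.
Proof.
move=> n1; have := dot_ge0 (w - dot w nu *: nu).
by rewrite !dotE n1 (dotC nu w) => h; nra.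
Qed.

Lemma continuous_line (x v : 'rV[R]_N) (t : R) :
  {for t, continuous (fun s : R => x + s *: v)}.
Proof.
have c1 := @cst_continuous R 'rV[R]_N x t.
have c2 : {for t, continuous (fun s : R => s *: v)}.
  by apply: (@continuousZr_tmp _ _ _ (id : R -> R)); exact: cvg_id.
exact: continuousD c1 c2.
Qed.

End sets.

Section moving_plane.
Context {R : realType} {N : nat}.
Variables (Omega : set 'rV[R]_N) (gamma : R) (f : 'rV[R]_N -> R -> R) (U : 'rV[R]_N -> R).
Hypotheses (gamma0 : 0 < gamma) (oO : open Omega) (bO : bounded_set Omega).
Hypotheses (cU : continuous U) (U2 : is_Ck 2 Omega U)
  (Upos : forall x, Omega x -> 0 < U x) (U0 : forall x, ~ Omega x -> U x = 0).
Hypothesis (wU : weak_solution Omega gamma f U).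
Variables (M L : R).
Hypotheses (UM : forall x, U x <= M) (L0 : 0 <= L).
Hypothesis fL : forall x t1 t2, Omega x -> 0 <= t1 <= M -> 0 <= t2 <= M ->
  `|f x t1 - f x t2| <= L * `|t1 - t2|.
Variable (nu : 'rV[R]_N).
Hypotheses (n1 : dot nu nu = 1) (cvO : convex_dir nu Omega) (syO : symmetric_dir nu Omega)
  (mf : monotone_symmetric_dir nu Omega f).
Implicit Types (x y z : 'rV[R]_N) (s t lambda : R).
Notation T := (reflection nu).

Let U_ge0 x : 0 <= U x.
Proof. by have [/Upos/ltW//|/U0->] := pselect (Omega x). Qed.

Let T_in x lambda : lambda <= 0 -> Omega x -> dot x nu <= lambda -> Omega (T lambda x).
Proof. exact: reflection_in. Qed.

Let cUT lambda x : {for x, continuous (U \o T lambda)}.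
Proof. exact: (continuous_comp (@continuous_reflection R N nu lambda x) (@cU _)). Qed.

Lemma source_reflection_generic lambda x : lambda < 0 -> Omega x -> dot x nu < lambda ->
  dot (T lambda x) nu != 0 ->
  source gamma U x <= source gamma U (T lambda x) + L * `|U x - U (T lambda x)|.
Proof.
move=> l0 Ox xl Tx0.
pose W := Omega `&` [set z | dot z nu < lambda] `&` [set z | dot z nu != 2 * lambda].
have Tdot z : dot (T lambda z) nu = 2 * lambda - dot z nu by exact: dot_reflection.
apply: (@source_le R N Omega gamma f U oO U2 Upos wU cU nu lambda L W n1).
- apply: openI; last exact: open_dot_neq.
  by apply: openI => //; exact: open_dot_lt.
- by move=> y [[]].
- by move=> y [[Oy yl] _]; apply: T_in => //; exact: ltW.
- move=> y [[Oy /= yl] yn].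
  have OT : Omega (T lambda y) by apply: T_in => //; exact: ltW.
  apply: (@le_trans _ _ (f (T lambda y) (U y))).
    apply: (monotone_reflection n1 cvO syO mf) => //.
    by rewrite Tdot; apply: contra yn => /eqP h; apply/eqP; lra.
  rewrite -lerBlDl; apply: (le_trans (ler_norm _)); apply: fL => //.
    by rewrite U_ge0 UM.
  by rewrite U_ge0 UM.
split; first by split.
by move: Tx0; rewrite /= Tdot; apply: contra => /eqP h; apply/eqP; lra.
Qed.

(** Reflected points on {x . nu = 0} are reached by continuity, since both sides
    are continuous and nearby points on the line x + t nu are generic. *)
Lemma source_reflection lambda x : lambda < 0 -> Omega x -> dot x nu < lambda ->
  source gamma U x <= source gamma U (T lambda x) + L * `|U x - U (T lambda x)|.
Proof.
move=> l0 Ox xl.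
have [Tx0|/source_reflection_generic] := eqVneq (dot (T lambda x) nu) 0; last exact.
pose D y := source gamma U (T lambda y) + L * `|U y - U (T lambda y)| - source gamma U y.
rewrite -subr_ge0 -/(D x) leNgt; apply/negP => Dx.
have OT : Omega (T lambda x) by apply: T_in => //; exact: ltW.
have cD : {for x, continuous D}.
  have c1 := @continuous_source _ _ _ gamma _ U2 Upos _ Ox.
  have c2 := continuous_comp (@continuous_reflection R N nu lambda x)
    (@continuous_source _ _ _ gamma _ U2 Upos _ OT).
  have c3 := @cst_continuous 'rV[R]_N R L x.
  have c4 : {for x, continuous (fun y => `|U y - U (T lambda y)|)}.
    exact: (cvg_norm (continuousB (@cU x) (@cUT lambda x))).
  exact: (continuousB (continuousD c2 (continuousM c3 c4)) c1).
have nD : \forall y \near x, D y < 0 /\ Omega y /\ dot y nu < lambda.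
  near=> y; split; first by near: y; apply: (@cvgr_lt _ _ (nbhs x) _ D (D x) cD).
  split; near: y; apply: open_nbhs_nbhs; split => //.
  exact: open_dot_lt.
have cl := @continuous_line R N x nu 0.
have : \forall t \near (0 : R), D (x + t *: nu) < 0 /\ Omega (x + t *: nu) /\
    dot (x + t *: nu) nu < lambda.
  apply: (cl [set y | D y < 0 /\ Omega y /\ dot y nu < lambda]).
  by rewrite /= scale0r addr0; exact: nD.
move=> /nbhs_ballP[e /= e0 he].
have := he (e / 2); rewrite /ball /= sub0r normrN gtr0_norm ?divr_gt0 // => /(_ _)[].
  by rewrite ltr_pdivrMr // ltr_pMr // ltr1n.
move=> D0 [Oy yl]; move: D0; apply/negP; rewrite -leNgt subr_ge0.
apply: source_reflection_generic => //.
rewrite dot_reflection // in Tx0; rewrite dot_reflection // !dotE n1 mulr1.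
by rewrite opprD addrA Tx0 sub0r oppr_eq0 gt_eqF // divr_gt0.
Unshelve. all: by end_near. Qed.

Lemma lap_reflection_le lambda x : lambda < 0 -> Omega x -> dot x nu < lambda ->
  lap U (T lambda x) - lap U x <=
  (U x `^ gamma)^-1 - (U (T lambda x) `^ gamma)^-1 + L * `|U x - U (T lambda x)|.
Proof.
move=> l0 Ox xl; have := source_reflection l0 Ox xl; rewrite /source.
move: (lap U x) (lap U (T lambda x)) (U x `^ gamma)^-1 (U (T lambda x) `^ gamma)^-1.
by move: (L * _) => a b c p q; lra.
Qed.

Definition gap lambda z := U (T lambda z) - U z.

Lemma continuous_gap lambda : continuous (gap lambda).
Proof. by move=> z; exact: (continuousB (@cUT lambda z) (@cU z)). Qed.

Lemma gap_twice_derivable lambda : let A := Omega `&` T lambda @^-1` Omega in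
  [/\ open A, twice_derivable A (gap lambda) &
   forall z, A z -> lap (gap lambda) z = lap U (T lambda z) - lap U z].
Proof.
move=> A.
have oT : open (T lambda @^-1` Omega) by exact: open_reflection.
have oA : open A by exact: openI.
have [t1 l1] := lap_reflection lambda oO U2 n1.
have t2 := C2_twice_derivable U2.
have sub B g : twice_derivable B g -> A `<=` B -> twice_derivable A g.
  by move=> tg AB z /AB; exact: tg.
have [tl ll] := twice_derivable_lin (-1) oA (sub _ _ t1 (@subIsetr _ _ _))
  (sub _ _ t2 (@subIsetl _ _ _)).
have e : (fun z => (U \o T lambda) z + -1 * U z) = gap lambda.
  by apply/funext => z; rewrite mulN1r.
rewrite e in tl ll; split => // z Az; rewrite ll // l1; last by case: Az.
by rewrite mulN1r.
Qed.

Definition cap_le lambda := forall x, Omega x -> dot x nu < lambda ->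
  U x <= U (T lambda x).

(** On a closed ball inside Omega the solution is bounded below, so that the
    singular term is Lipschitz there and the gap satisfies a linear differential
    inequality. *)
Lemma gap_barrier lambda y (rho : R) : lambda < 0 -> cap_le lambda -> 0 < rho ->
  (forall z, dot (z - y) (z - y) <= rho ^+ 2 -> Omega z /\ dot z nu <= lambda) ->
  (forall z, dot (z - y) (z - y) < rho ^+ 2 -> dot z nu < lambda) ->
  0 < gap lambda y ->
  exists2 k, 0 < k & forall z, dot (z - y) (z - y) <= rho ^+ 2 ->
    k * (rho ^+ 2 - dot (z - y) (z - y)) <= gap lambda z.
Proof.
move=> l0 bl rho0 KO Kl vy.
pose K := [set z | dot (z - y) (z - y) <= rho ^+ 2].
have Ky : K y by rewrite /K /= subrr /dot big1 ?sqr_ge0 // => i _; rewrite mxE mul0r.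
have [c cK cmin] := compact_EVT_min (ex_intro _ y Ky) (compact_sqball (r := rho ^+ 2))
  (continuous_subspaceT cU).
have m0 : 0 < U c by apply: Upos; rewrite inE in cK; exact: (KO c cK).1.
have C0 : 0 <= gamma * (U c `^ (gamma + 1))^-1 + L.
  by rewrite addr_ge0 // mulr_ge0 ?(ltW gamma0) // invr_ge0 powR_ge0.
have [oA tA lA] := gap_twice_derivable lambda.
have BA z : dot (z - y) (z - y) < rho ^+ 2 ->
    (Omega `&` T lambda @^-1` Omega) z.
  move=> h; have [Oz zl] := KO z (ltW h); split => //.
  by apply: T_in => //; exact: ltW.
apply: (positivity_barrier rho0 C0) => //.
- move=> z Kz; split; first exact: continuous_gap.
  have [Oz] := KO z Kz; rewrite le_eqVlt subr_ge0 => /predU1P[zl|zl]; last exact: bl.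
  by rewrite /reflection zl subrr mulr0 scale0r addr0.
- by move=> z Bz; apply: tA; exact: BA.
move=> z Bz; rewrite lA; last exact: BA.
have [Oz _] := KO z (ltW Bz); have zl := Kl z Bz.
apply: (le_trans (lap_reflection_le l0 Oz zl)).
have vz := bl z Oz zl.
rewrite mulrDl lerD //.
  by apply: powRV_lipschitz => //; apply: cmin; rewrite inE; exact: ltW.
by rewrite distrC ger0_norm ?subr_ge0.
Qed.

Lemma dot_half y z (rho : R) : 0 < rho -> dot (z - y) (z - y) <= rho ^+ 2 ->
  dot z nu <= dot y nu + rho.
Proof.
move=> rho0 h; have h2 := le_trans (cauchy_schwarz_unit (z - y) n1) h.
move: h2; rewrite -[X in X ^+ 2 <= _](_ : dot z nu - dot y nu = _); last by rewrite !dotE.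
nra.
Qed.

Lemma dot_half_lt y z (rho : R) : 0 < rho -> dot (z - y) (z - y) < rho ^+ 2 ->
  dot z nu < dot y nu + rho.
Proof.
move=> rho0 h; have h2 := le_lt_trans (cauchy_schwarz_unit (z - y) n1) h.
move: h2; rewrite -[X in X ^+ 2 < _](_ : dot z nu - dot y nu = _); last by rewrite !dotE.
nra.
Qed.

Lemma sqball_in A x : open A -> A x -> exists2 rho : R, 0 < rho &
  forall z, dot (z - x) (z - x) < rho ^+ 2 -> A z.
Proof.
move=> oA Ax; have /nbhs_ballP[d /= d0 dA] := open_nbhs_nbhs (conj oA Ax).
by exists d => // z h; apply: dA; exact: sqball_sub_ball h.
Qed.

Lemma gap_hyperplane lambda x (t : R) : dot x nu = lambda ->
  gap lambda (x - t *: nu) = U (x + t *: nu) - U (x - t *: nu).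
Proof.
move=> xl; rewrite /gap /reflection !dotE n1 xl -addrA -scaleNr -scalerDl.
by congr (U (_ + _ *: _) - _); ring.
Qed.

(** Follow the line through x in the direction - nu until it leaves Omega, at a
    point where the gap is positive because its mirror image lies in Omega. At
    the last zero of the gap on this segment, the barrier on a ball centred
    slightly further along the segment forces positivity. *)
Lemma cap_lt lambda x : lambda < 0 -> cap_le lambda -> Omega x -> dot x nu < lambda ->
  0 < gap lambda x.
Proof.
move=> l0 bl Ox xl.
rewrite lt_neqAle subr_ge0 bl // andbT eq_sym; apply/eqP => vx0.
(* [E] collects the times at which the half-line from x has left Omega. *)
pose E := [set t : R | 0 <= t /\ ~ Omega (x - t *: nu)].
have cline t : {for t, continuous (fun s : R => x - s *: nu)}.
  have := @continuous_line R N x (- nu) t.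
  by congr continuous_at; apply/funext => s; rewrite scalerN.
have [B [B0 OB]] : exists B : R, 0 < B /\ forall z, Omega z -> - B < dot z nu.
  have [B [_ hB]] := bO.
  have B1 : B < `|B| + 1 by rewrite (le_lt_trans (ler_norm _)) // ltrDl.
  exists (N%:R * (`|B| + 1) ^+ 2 + 1).
  have h0 : 0 <= N%:R * (`|B| + 1) ^+ 2 by rewrite mulr_ge0 // sqr_ge0.
  split=> [|z Oz]; first by rewrite ltr_wpDl.
  have h1 := cauchy_schwarz_unit z n1.
  have h2 := dot_le_norm z.
  have h3 : `|z| ^+ 2 <= (`|B| + 1) ^+ 2.
    by rewrite lerXn2r ?nnegrE ?addr_ge0 //; exact: hB.
  have h4 : N%:R * `|z| ^+ 2 <= N%:R * (`|B| + 1) ^+ 2 by rewrite ler_wpM2l.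
  have h5 := le_trans h1 (le_trans h2 h4).
  nra.
have E0 : has_inf E.
  split; last by exists 0 => t [].
  exists (`|dot x nu| + B); split; first by rewrite addr_ge0 // ltW.
  move=> /OB; rewrite !dotE n1 mulr1.
  by have := ler_norm (dot x nu); lra.
pose t1 := inf E.
have t10 : 0 <= t1 by apply: lb_le_inf; [case: E0|move=> t []].
have nOq : ~ Omega (x - t1 *: nu).
  move=> Oq.
  have : \forall t \near t1, Omega (x - t *: nu).
    by apply: (cline t1 Omega); apply: open_nbhs_nbhs.
  move=> /nbhs_ballP[e /= e0 he].
  have [t [t0 nOt] tlt] := inf_adherent e0 E0.
  apply: (nOt); apply: he; rewrite /ball /= distrC ger0_norm ?subr_ge0.
    by rewrite ltrBlDl.
  by apply: ge_inf; [case: E0|split].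
have Oin t : 0 <= t -> t < t1 -> Omega (x - t *: nu).
  move=> t0 tt1; apply: contrapT => nO; move: tt1; apply/negP; rewrite -leNgt.
  by apply: ge_inf; [case: E0|split].
have t1pos : 0 < t1.
  rewrite lt_neqAle t10 andbT; apply/eqP => t1e; apply: nOq.
  by rewrite -t1e scale0r subr0.
have dline t : dot (x - t *: nu) nu = dot x nu - t by rewrite !dotE n1 mulr1.
(* The mirror image of the exit point is reached from a nearby interior point by
   a segment that the convexity keeps inside. *)
have vq : 0 < gap lambda (x - t1 *: nu).
  rewrite /gap (U0 nOq) subr0; apply: Upos.
  pose e := Num.min t1 (- lambda).
  have e0 : 0 < e by rewrite lt_min t1pos oppr_gt0.
  have [e1 e2] : e <= t1 /\ e <= - lambda by split; rewrite ge_min lexx ?orbT.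
  have Oz := Oin (t1 - e) _ _.
  have -> : T lambda (x - t1 *: nu) =
      (x - (t1 - e) *: nu) + (2 * (lambda - (dot x nu - t1)) - e) *: nu.
    rewrite /reflection dline -!addrA -!scaleNr -!scalerDl; congr (_ + _ *: _); ring.
  apply: segment_in => //; first by apply: Oz; lra.
  by rewrite dline; apply/andP; split; lra.
(* [t2] is the last zero of the gap before the exit. *)
pose Z := [set t : R | 0 <= t <= t1 /\ gap lambda (x - t *: nu) = 0].
have Z0 : Z 0 by split; rewrite ?lexx ?ltW // scale0r subr0.
have hZ : has_sup Z by split; [exists 0|exists t1 => t [/andP[]]].
pose t2 := sup Z.
have t20 : 0 <= t2 by apply: ub_le_sup => //; case: hZ.
have t21 : t2 <= t1 by apply: ge_sup; [exists 0|move=> t [/andP[]]].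
have cdl t : {for t, continuous (fun s => gap lambda (x - s *: nu))}.
  exact: (continuous_comp (@cline t) (@continuous_gap lambda _)).
have vp0 : gap lambda (x - t2 *: nu) = 0.
  apply: contrapT => /eqP vp.
  have : \forall t \near t2, gap lambda (x - t *: nu) != 0.
    by apply: (cdl t2 [set s | s != 0]); apply: open_nbhs_nbhs; split => //; exact: open_neq.
  move=> /nbhs_ballP[e /= e0 he].
  have [t Zt tlt] := sup_adherent e0 hZ.
  have := he t; rewrite (proj2 Zt) eqxx /ball /= ger0_norm ?subr_ge0.
    by rewrite ltrBlDl -ltrBlDr tlt => /(_ isT).
  by apply: ub_le_sup => //; case: hZ.
have t2lt : t2 < t1.
  rewrite lt_neqAle t21 andbT; apply/eqP => e; move: vq; rewrite -e vp0 ltxx //.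
have pos t : t2 < t -> t < t1 -> 0 < gap lambda (x - t *: nu).
  move=> tt2 tt1; have t0 : 0 <= t by exact: le_trans (ltW tt2).
  have Ot := Oin t t0 tt1.
  rewrite lt_neqAle subr_ge0 bl ?dline // ?andbT; last by lra.
  rewrite eq_sym; apply/eqP => vt0.
  have : t <= t2 by apply: ub_le_sup; [case: hZ|split => //; rewrite t0 ltW].
  by rewrite leNgt tt2.
set p := x - t2 *: nu in vp0.
have Op : Omega p by exact: Oin.
have pl : dot p nu < lambda by rewrite dline; lra.
have [d d0 hd] := @sqball_in (Omega `&` [set z | dot z nu < lambda]) p
  (openI oO (open_dot_lt (a:=lambda))) (conj Op pl).
(* A ball around y = p - rho nu of radius 3/2 rho contains p in its interior
   and stays within distance d of p. *)
pose rho := Num.min d (t1 - t2) / 3.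
have m0 : 0 < Num.min d (t1 - t2) by rewrite lt_min d0 subr_gt0.
have rho0 : 0 < rho by rewrite divr_gt0.
have [r1 r2] : 3 * rho <= d /\ 3 * rho <= t1 - t2.
  by rewrite /rho mulrC divfK //; split; rewrite ge_min lexx ?orbT.
pose y := p - rho *: nu.
have py : dot (p - (p - rho *: nu)) (p - (p - rho *: nu)) = rho ^+ 2.
  by rewrite opprB addrC subrK !dotE n1; ring.
have vy : 0 < gap lambda y.
  by rewrite /y /p -addrA -opprD -scalerDl; apply: pos; lra.
have in2 z : dot (z - y) (z - y) <= (3 / 2 * rho) ^+ 2 -> Omega z /\ dot z nu < lambda.
  move=> h; apply: hd.
  have -> : z - p = (z - y) - rho *: nu.
    have -> : p = y + rho *: nu by rewrite /y subrK.
    by rewrite opprD addrA.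
  move: (z - y : 'rV[R]_N) h => w h; have := cauchy_schwarz_unit w n1.
  rewrite !dotE n1 (dotC nu w) => h2.
  have h3 : - (3 / 2 * rho) <= dot w nu.
    have : dot w nu ^+ 2 <= (3 / 2 * rho) ^+ 2 by exact: le_trans h.
    nra.
  have h4 : - (rho * dot w nu) <= 3 / 2 * rho ^+ 2 by nra.
  have h5 : (3 * rho) ^+ 2 <= d ^+ 2 by rewrite ler_sqr ?nnegrE ?(ltW d0) // mulr_ge0 // ltW.
  have h6 : 0 < rho ^+ 2 by rewrite exprn_gt0.
  have e1 : (3 / 2 * rho) ^+ 2 = 9 / 4 * rho ^+ 2 by field.
  have e2 : (3 * rho) ^+ 2 = 9 * rho ^+ 2 by ring.
  rewrite e1 in h; rewrite e2 in h5.
  lra.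
have yl z : dot (z - y) (z - y) <= (3 / 2 * rho) ^+ 2 -> Omega z /\ dot z nu <= lambda.
  by move=> /in2[? /ltW].
have r0 : 0 < 3 / 2 * rho by lra.
have [k k0 hk] := gap_barrier l0 bl r0 yl (fun z h => (in2 z (ltW h)).2) vy.
have pK : rho ^+ 2 <= (3 / 2 * rho) ^+ 2 by nra.
have := hk p; rewrite py vp0 => /(_ pK).
by apply/negP; rewrite -ltNge mulr_gt0 //; nra.
Qed.

Notation dU x := (\sum_i nu ord0 i * partial i U x).

(** The gap vanishes on the hyperplane and along the normal line it equals
    U (x + t nu) - U (x - t nu), with derivative twice that of U at t = 0. The
    barrier on a ball touching the hyperplane at x makes this derivative
    positive. *)
Lemma hopf_hyperplane lambda x : lambda < 0 -> cap_le lambda -> Omega x ->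
  dot x nu = lambda -> 0 < dU x.
Proof.
move=> l0 bl Ox xl.
have [d d0 hd] := sqball_in oO Ox.
(* The ball touches the hyperplane at x and stays within distance 2 rho of x. *)
pose rho := d / 3.
have rho0 : 0 < rho by rewrite divr_gt0.
have d3 : d = 3 * rho by rewrite /rho mulrC divfK.
pose y := x - rho *: nu.
have yl : dot y nu = lambda - rho by rewrite /y !dotE n1 xl mulr1.
have KO z : dot (z - y) (z - y) <= rho ^+ 2 -> Omega z /\ dot z nu <= lambda.
  move=> h; split; last by have := dot_half rho0 h; rewrite yl subrK.
  apply: hd.
  have -> : z - x = (z - y) - rho *: nu.
    have -> : x = y + rho *: nu by rewrite /y subrK.
    by rewrite opprD addrA.
  move: (z - y : 'rV[R]_N) h => w h; have := cauchy_schwarz_unit w n1.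
  rewrite !dotE n1 (dotC nu w) => h2.
  have h3 : - rho <= dot w nu.
    have : dot w nu ^+ 2 <= rho ^+ 2 by exact: le_trans h.
    nra.
  have h4 : - (rho * dot w nu) <= rho ^+ 2 by nra.
  have h6 : 0 < rho ^+ 2 by rewrite exprn_gt0.
  have e2 : d ^+ 2 = 9 * rho ^+ 2 by rewrite d3; ring.
  rewrite e2; lra.
have Kl z : dot (z - y) (z - y) < rho ^+ 2 -> dot z nu < lambda.
  by move=> h; have := dot_half_lt rho0 h; rewrite yl subrK.
have yb : dot (y - y) (y - y) <= rho ^+ 2.
  by rewrite subrr /dot big1 ?sqr_ge0 // => i _; rewrite mxE mul0r.
have vy : 0 < gap lambda y.
  apply: cap_lt => //; first by case: (KO y yb).
  by rewrite yl ltrBlDr ltrDl.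
have [k k0 hk] := gap_barrier l0 bl rho0 KO Kl vy.
have grow t : 0 < t -> t <= rho -> k * rho * t <= U (x + t *: nu) - U (x - t *: nu).
  move=> t0 tr.
  have e : x - t *: nu - y = (rho - t) *: nu.
    by rewrite /y opprB addrC addrA subrK scalerBl.
  have K' : dot (x - t *: nu - y) (x - t *: nu - y) <= rho ^+ 2.
    by rewrite e !dotE n1; nra.
  have := hk _ K'; rewrite gap_hyperplane // e !dotE n1.
  apply: le_trans; rewrite -mulrA ler_pM2l //; nra.
rewrite ltNge; apply/negP => dU0.
have [dx ex] := C1_is_derive nu oO (C2_C1 U2) Ox.
have [dx' ex'] := C1_is_derive (- nu) oO (C2_C1 U2) Ox.
have eN : \sum_i (- nu) ord0 i * partial i U x = - dU x.
  by rewrite -sumrN; apply: eq_bigr => i _; rewrite mxE mulNr.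
rewrite eN in ex'.
have kr : 0 < k * rho by rewrite mulr_gt0.
pose ph (t : R) := U (x + t *: nu) - U (x + t *: (- nu)).
have dph : is_derive (0 : R) 1 ph (dU x + dU x).
  have e0 (v : 'rV[R]_N) : x + 0 *: v = x by rewrite scale0r addr0.
  have d1 : derivable U (x + 0 *: nu) nu by rewrite e0.
  have d2 : derivable U (x + 0 *: (- nu)) (- nu) by rewrite e0.
  have := is_deriveB (is_derive_line d1) (is_derive_line d2).
  by rewrite !e0 ex ex' opprK.
have [cph eph] := dph.
have phl : 'D_1 ph 0 < k * rho by rewrite eph; lra.
have [e /= e0 he] := @cvgr_lt _ _ _ _ _ _ cph _ phl.
pose t := Num.min e rho / 2.
have m0 : 0 < Num.min e rho by rewrite lt_min e0 rho0.
have t0 : 0 < t by rewrite divr_gt0.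
have tm : t < Num.min e rho by rewrite /t ltr_pdivrMr // ltr_pMr // ltr1n.
move: tm; rewrite lt_min => /andP[te tr].
have := he t; rewrite /= sub0r normrN gtr0_norm // => /(_ te); rewrite gt_eqF // => /(_ isT).
rewrite addr0 [t *: 1]mulr1 /ph !scale0r !addr0 subrr subr0 scalerN.
have := grow t t0 (ltW tr).
move=> h1 h2; move: h1; apply/negP; rewrite -ltNge.
by move: h2; rewrite -[X in X < _]/(t^-1 * _) ltr_pdivrMl // [t * _]mulrC.
Qed.

Lemma continuous_dU x : Omega x -> {for x, continuous (fun z => dU z)}.
Proof.
move=> Ox; apply: continuous_sumr => i.
have c1 := @cst_continuous 'rV[R]_N R (nu ord0 i) x.
exact: continuousM c1 (@continuous_partial_U _ _ _ _ U2 i x Ox).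
Qed.

(** Locally uniform in both the point and the plane: strictly inside the cap the
    strict inequality persists, and near the hyperplane U increases along nu, so it
    increases from a point to its reflection. Compactness of [K] makes it
    uniform. *)
Lemma cap_le_near_compact lambda0 (K : set 'rV[R]_N) : lambda0 < 0 -> cap_le lambda0 ->
  compact K -> K `<=` Omega ->
  \forall l \near lambda0, forall x, K x -> dot x nu < l -> U x <= U (T l x).
Proof.
move=> l0 bl cK KO.
have cT (p : 'rV[R]_N * R) : {for p, continuous (fun q : 'rV[R]_N * R => T q.2 q.1)}.
  pose g (q : 'rV[R]_N * R) : R := 2 * (q.2 - dot q.1 nu).
  have cf : {for p, continuous (fst : 'rV[R]_N * R -> _)} by exact: cvg_fst.
  have cs : {for p, continuous (snd : 'rV[R]_N * R -> _)} by exact: cvg_snd.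
  have cd : {for p, continuous (fun q : 'rV[R]_N * R => dot q.1 nu)}.
    exact: (continuous_comp cf (@continuous_dotl R N nu _)).
  have cg : {for p, continuous g}.
    exact: (continuousM (@cst_continuous _ R 2 p) (continuousB cs cd)).
  have c3 : {for p, continuous (fun q : 'rV[R]_N * R => g q *: nu)}.
    exact: continuousZr_tmp cg.
  exact: (@continuousD _ _ _ (fst : 'rV[R]_N * R -> 'rV[R]_N) _ p cf c3).
have cf (p : 'rV[R]_N * R) : {for p, continuous (fst : 'rV[R]_N * R -> _)} by exact: cvg_fst.
have cs (p : 'rV[R]_N * R) : {for p, continuous (snd : 'rV[R]_N * R -> _)} by exact: cvg_snd.
have cd p : {for p, continuous (fun q : 'rV[R]_N * R => dot q.1 nu - q.2)}.
  exact: (continuousB (continuous_comp (cf p) (@continuous_dotl R N nu _)) (cs p)).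
have := (compact_near_coveringP K).1 cK R (nbhs lambda0)
  (fun l x => dot x nu < l -> U x <= U (T l x)).
apply => x Kx; have Ox := KO x Kx.
suff : \forall q \near (x, lambda0), dot q.1 nu < q.2 -> U q.1 <= U (T q.2 q.1) by [].
have [xl|xl|xl] := ltgtP (dot x nu) lambda0.
- have vx := cap_lt l0 bl Ox xl.
  have cv : {for (x, lambda0), continuous
      (fun q : 'rV[R]_N * R => U (T q.2 q.1) - U q.1)}.
    exact: (continuousB (continuous_comp (cT (x, lambda0)) (@cU _))
      (continuous_comp (cf (x, lambda0)) (@cU _))).
  have h : \forall q \near (x, lambda0), 0 < U (T q.2 q.1) - U q.1.
    exact: (@cvgr_gt _ _ _ _ _ _ cv _ vx).
  by near=> q => _; rewrite -subr_ge0 ltW //; near: q; exact: h.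
- have xl' : 0 < dot x nu - lambda0 by rewrite subr_gt0.
  have h : \forall q \near (x, lambda0), 0 < dot q.1 nu - q.2.
    exact: (@cvgr_gt _ _ _ _ _ _ (@cd (x, lambda0)) _ xl').
  near=> q => ql; suff : 0 < dot q.1 nu - q.2 by rewrite subr_gt0 ltNge (ltW ql).
  by near: q; exact: h.
have dUx := hopf_hyperplane l0 bl Ox xl.
have : \forall z \near x, Omega z /\ 0 < dU z.
  near=> z; split; first by near: z; exact: open_nbhs_nbhs.
  by near: z; apply: (@cvgr_gt _ _ (nbhs x) _ _ _ (continuous_dU Ox)).
move=> /nbhs_ballP[d /= d0 hd].
have hq : \forall q \near (x, lambda0), ball x d q.1 /\ ball x d (T q.2 q.1).
  near=> q; split; near: q.
    by apply: (cf (x, lambda0) (ball x d)); exact: nbhsx_ballx.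
  apply: (cT (x, lambda0) (ball x d)) => /=.
  by rewrite /reflection xl subrr mulr0 scale0r addr0; exact: nbhsx_ballx.
near=> q; have : ball x d q.1 /\ ball x d (T q.2 q.1) by near: q; exact: hq.
move: (q.1) (q.2) => y l [xy xTy] yl.
have s0 : 0 < 2 * (l - dot y nu) by rewrite mulr_gt0 // subr_gt0.
have inb (t : R) : 0 <= t <= 2 * (l - dot y nu) -> ball x d (y + t *: nu).
  move=> /andP[t0 ts]; move: xy xTy; rewrite -!ball_normE /= => xy xTy.
  have [a as_ a01] : exists2 a : R, a * (2 * (l - dot y nu)) = t & 0 <= a <= 1.
    exists (t / (2 * (l - dot y nu))); first by rewrite divfK ?gt_eqF.
    by rewrite divr_ge0 ?(ltW s0) //= ler_pdivrMr // mul1r.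
  have -> : x - (y + t *: nu) = (1 - a) *: (x - y) + a *: (x - T l y).
    by apply/rowP => i; rewrite /reflection !mxE -as_; ring.
  move/andP: a01 => [a0 a1].
  apply: (le_lt_trans (ler_normD _ _)); rewrite !normrZ.
  rewrite (ger0_norm a0) (@ger0_norm _ (1 - a)) ?subr_ge0 //.
  have [a_0|an] := eqVneq a 0; first by rewrite a_0 subr0 mul1r mul0r addr0.
  have ap : 0 < a by rewrite lt_neqAle eq_sym an.
  have h1 : a * `|x - T l y| < a * d by rewrite ltr_pM2l.
  have h2 : (1 - a) * `|x - y| <= (1 - a) * d by rewrite ler_wpM2l ?subr_ge0 ?(ltW xy).
  lra.
have [|c /andP[c0 c1] ec] := @MVT_line _ _ U y nu (2 * (l - dot y nu)) s0.
  move=> t ht; have [Oz _] := hd _ (inb t ht).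
  by have [] := C1_is_derive nu oO (C2_C1 U2) Oz.
have hc : 0 <= c <= 2 * (l - dot y nu) by rewrite !ltW.
have [Oz dz] := hd _ (inb c hc).
have [_ e] := C1_is_derive nu oO (C2_C1 U2) Oz.
by rewrite -subr_ge0 [_ - _]ec e mulr_ge0 // ltW.
Unshelve. all: by end_near. Qed.

(** [lap_max] for - g, written as g + (- 2) g to fit [twice_derivable_lin]. *)
Lemma lap_min A (g : 'rV[R]_N -> R) x : open A -> A x -> twice_derivable A g ->
  (forall y, A y -> g x <= g y) -> 0 <= lap g x.
Proof.
move=> oA Ax tg gx.
have [t2 l2] := twice_derivable_lin (-2) oA tg tg.
have := lap_max oA Ax t2; rewrite l2 // => H.
suff : lap g x + - 2 * lap g x <= 0 by lra.
by apply: H => y /gx; lra.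
Qed.

Lemma bounded_sqball : exists B : R, Omega `<=` [set z | dot (z - 0) (z - 0) <= B].
Proof.
have [B [_ hB]] := bO.
have B1 : B < `|B| + 1 by rewrite (le_lt_trans (ler_norm _)) // ltrDl.
exists (N%:R * (`|B| + 1) ^+ 2) => z Oz /=; rewrite subr0.
apply: (le_trans (dot_le_norm z)); rewrite ler_wpM2l //.
by rewrite lerXn2r ?nnegrE ?addr_ge0 //; exact: hB.
Qed.

(** A negative minimum of the gap lies in the cap, and by [cap_le_near_compact] not
    where U >= de. So U < de there and [powRV_steep] contradicts the sign of the
    Laplacian at a minimum. *)
Lemma cap_le_extend lambda0 : lambda0 < 0 -> cap_le lambda0 ->
  \forall l \near lambda0, l < 0 -> cap_le l.
Proof.
move=> l00 bl; have [B OB] := bounded_sqball.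
have [de de0 steep] := powRV_steep gamma0 L0.
pose K := [set z | de <= U z].
have KO : K `<=` Omega.
  by move=> z Kz; apply: contrapT => /U0 e; move: Kz; rewrite /K /= e leNgt de0.
have cK : compact K.
  apply: (subclosed_compact _ (compact_sqball (y := 0) (r := B))).
    apply: (@preimage_closed _ _ U [set t | de <= t]); last exact: closed_ge.
    by move=> z _; exact: cU.
  by move=> z /KO /OB.
have := cap_le_near_compact l00 bl cK KO; apply: filterS => l hl l0 x Ox xl.
rewrite leNgt; apply/negP => wx.
(* Outside Omega, U vanishes and the gap is nonnegative, so minimizing over a
   large ball is the same as minimizing over the closed cap. *)
pose Q := [set z : 'rV[R]_N | dot (z - 0) (z - 0) <= B] `&` [set z | dot z nu <= l].
have cQ : compact Q.
  apply: (subclosed_compact _ (compact_sqball (y := 0) (r := B))); last by move=> z [].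
  by apply: closedI; [exact: closed_sqball|exact: closed_dot_le].
have Qx : Q x by split; [exact: OB|exact: ltW].
have [c + cmin] := compact_EVT_min (ex_intro _ x Qx) cQ
  (continuous_subspaceT (@continuous_gap l)).
rewrite inE => Qc.
have gapc : gap l c < 0.
  by apply: (@le_lt_trans _ _ (gap l x)); rewrite ?subr_lt0 //; apply: cmin; rewrite inE.
have Uc : U (T l c) < U c by rewrite -subr_lt0.
have Oc : Omega c.
  by apply: contrapT => /U0 e; move: Uc; rewrite e ltNge U_ge0.
have cl : dot c nu < l.
  case: Qc => _ /=; rewrite le_eqVlt => /predU1P[e|//].
  by move: Uc; rewrite /reflection e subrr mulr0 scale0r addr0 ltxx.
have Ucd : U c < de.
  by rewrite ltNge; apply/negP => Kc; have := hl c Kc cl; rewrite leNgt Uc.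
have OTc : Omega (T l c) by apply: T_in => //; exact: ltW.
have [oA tA lA] := gap_twice_derivable l.
have oB : open (Omega `&` T l @^-1` Omega `&` [set z | dot z nu < l]).
  by apply: openI => //; exact: open_dot_lt.
have := @lap_min _ (gap l) c oB _ _ _; rewrite lA // => H.
have {}H : 0 <= lap U (T l c) - lap U c.
  apply: H => //.
    by move=> z [Az _]; exact: tA.
  by move=> z [[Oz _] /= zl]; apply: cmin; rewrite inE; split; [exact: OB|exact: ltW].
have H2 := lap_reflection_le l0 Oc cl.
have H3 := steep _ _ (Upos OTc) Uc Ucd.
have Un : `|U c - U (T l c)| = U c - U (T l c) by rewrite ger0_norm // subr_ge0 ltW.
rewrite Un in H2.
by have := lt_le_trans (le_lt_trans H2 H3) H; rewrite ltxx.
Qed.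

(** The supremum [s] of the admissible positions is itself admissible by
    continuity; if it were negative, [cap_le_extend] would push it further. *)
Lemma cap_le_all lambda : lambda < 0 -> cap_le lambda.
Proof.
move=> l0; apply: contrapT => nb.
pose S := [set m : R | forall l, l <= m -> cap_le l].
have [B OB] := bounded_sqball.
have Slt m : S m -> m < lambda.
  by move=> Sm; rewrite ltNge; apply/negP => lm; apply: nb; exact: Sm.
have S0 : S (- (`|B| + 1)).
  move=> l lB x Ox xl.
  have h1 := cauchy_schwarz_unit x n1; have /= h2 := OB x Ox; rewrite subr0 in h2.
  have h3 := le_trans h1 h2; have h4 := ler_norm B; have h5 := normr_ge0 B.
  exfalso; have : (`|B| + 1) < - dot x nu by lra.
  nra.
have hS : has_sup S by split; [exists (- (`|B| + 1))|exists lambda => m /Slt /ltW].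
pose s := sup S.
have sl : s <= lambda by apply: ge_sup; [case: hS|move=> m /Slt /ltW].
have s0 : s < 0 := le_lt_trans sl l0.
have below_lt m : m < s -> cap_le m.
  move=> ms; have ep : 0 < s - m by rewrite subr_gt0.
  have [m' Sm' mm'] := sup_adherent ep hS.
  by apply: Sm'; apply: ltW; move: mm'; rewrite opprB addrC subrK.
have bs : cap_le s.
  move=> x Ox xs; rewrite leNgt; apply/negP => h.
  have cl : {for s, continuous (fun m : R => U (T m x))}.
    have c1 : {for s, continuous (fun m : R => 2 * (m - dot x nu))}.
      exact: (continuousM (@cst_continuous _ R 2 s)
        (continuousB (@cvg_id _ (nbhs s)) (@cst_continuous _ R (dot x nu) s))).
    have c2 : {for s, continuous (fun m : R => T m x)}.
      exact: (continuous_comp c1 (@continuous_line R N x nu _)).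
    exact: (continuous_comp c2 (@cU _)).
  have : \forall m \near s, U (T m x) < U x by exact: (@cvgr_lt _ _ _ _ _ _ cl _ h).
  move=> /nbhs_ballP[e /= e0 he].
  pose m := Num.max (s - e / 2) ((dot x nu + s) / 2).
  have ms : m < s by rewrite gt_max; apply/andP; split; lra.
  have xm : dot x nu < m by rewrite lt_max; apply/orP; right; lra.
  have sm : s - e / 2 <= m by rewrite le_max lexx.
  have hm : ball s e m by rewrite /ball /= gtr0_norm ?subr_gt0 //; lra.
  by have := he m hm; rewrite /= ltNge (below_lt m ms x Ox xm).
have /nbhs_ballP[e /= e0 he] := cap_le_extend s0 bs.
pose m := Num.min (s + e / 2) (s / 2).
have m1 : s < m by rewrite lt_min; apply/andP; split; lra.
have m2 : m <= s + e / 2 by rewrite ge_min lexx.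
have m3 : m <= s / 2 by rewrite ge_min lexx orbT.
have Sm : S m.
  move=> l lm; have [ls|sl'] := ltP l s; first exact: below_lt.
  apply: he; last by lra.
  by rewrite /ball /= distrC ger0_norm ?subr_ge0 //; lra.
have : m <= s by apply: ub_le_sup => //; case: hS.
by rewrite leNgt m1.
Qed.

(** Two points on a line parallel to nu are mirror images in the hyperplane
    through their midpoint. *)
Lemma nondecreasing_cap : nondecreasing_dir nu (left_cap nu Omega) U.
Proof.
move=> x s; rewrite le_eqVlt => /predU1P[<- _ _|s0 [Ox /= x0] [Oy /= y0]].
  by rewrite scale0r addr0.
rewrite !dotE n1 mulr1 in y0.
have l0 : dot x nu + s / 2 < 0 by lra.
have := cap_le_all l0 Ox; rewrite ltrDl divr_gt0 // => /(_ isT).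
by congr (_ <= U (_ + _ *: _)); field.
Qed.

(** The comparison passes to the limit lambda -> 0. *)
Lemma reflection0_le x : Omega x -> dot x nu < 0 -> U x <= U (T 0 x).
Proof.
move=> Ox x0; rewrite leNgt; apply/negP => h.
have cl : {for (0 : R), continuous (fun m : R => U (T m x))}.
  have c1 : {for (0 : R), continuous (fun m : R => 2 * (m - dot x nu))}.
    exact: (continuousM (@cst_continuous _ R 2 0)
      (continuousB (@cvg_id _ (nbhs (0 : R))) (@cst_continuous _ R (dot x nu) 0))).
  have c2 : {for (0 : R), continuous (fun m : R => T m x)}.
    exact: (continuous_comp c1 (@continuous_line R N x nu _)).
  exact: (continuous_comp c2 (@cU _)).
have : \forall m \near (0 : R), U (T m x) < U x by exact: (@cvgr_lt _ _ _ _ _ _ cl _ h).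
move=> /nbhs_ballP[e /= e0 he].
pose m := Num.max (- (e / 2)) (dot x nu / 2).
have m0 : m < 0 by rewrite gt_max; apply/andP; split; lra.
have xm : dot x nu < m by rewrite lt_max; apply/orP; right; lra.
have em : - (e / 2) <= m by rewrite le_max lexx.
have hm : ball 0 e m by rewrite /ball /= sub0r normrN ltr0_norm //; lra.
by have := he m hm; rewrite /= ltNge (cap_le_all m0 Ox xm).
Qed.

End moving_plane.

(** * Zero extension, opposite directions, and balls *)

Section extension.
Context {R : realType} {N : nat}.
Variables (Omega : set 'rV[R]_N) (gamma : R) (f : 'rV[R]_N -> R -> R) (u : 'rV[R]_N -> R).
Hypotheses (oO : open Omega) (bO : bounded_set Omega).
Hypotheses (hu0 : {within closure Omega, continuous u}) (hu2 : is_Ck 2 Omega u).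
Hypothesis hub : forall x, bdry Omega x -> u x = 0.

Definition zero_extension := u \_ Omega.

Lemma zero_extension_in x : Omega x -> u x = zero_extension x.
Proof. by move=> Ox; rewrite /zero_extension patchE mem_set. Qed.

Lemma zero_extension_out x : ~ Omega x -> zero_extension x = 0.
Proof. by move=> nOx; rewrite /zero_extension patchE memNset. Qed.

(** At a boundary point both the boundary values and the extension are 0. *)
Lemma continuous_zero_extension : continuous zero_extension.
Proof.
move=> x; have [Ox|nOx] := pselect (Omega x).
  exact: (is_Ck_ext oO zero_extension_in hu2).1.
rewrite /continuous_at zero_extension_out //; apply/(@cvgrPdist_lt _ _ _ (nbhs x)) => e e0.
have [cx|ncx] := pselect (closure Omega x); last first.
  have : nbhs x (~` closure Omega).
    by apply: open_nbhs_nbhs; split => //; exact/closed_openC/closed_closure.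
  apply: filterS => y ncy; rewrite zero_extension_out ?subrr ?normr0 // => Oy.
  by apply: ncy; exact: subset_closure.
have ux0 : u x = 0.
  by apply: hub; split => //; rewrite (interior_id _).1.
have h0 : u @ within (closure Omega) (nbhs x) --> (0 : R).
  by rewrite -ux0; exact: (subspace_continuousP _ _).1 hu0 x cx.
have : \forall y \near x, closure Omega y -> `|0 - u y| < e.
  by move/cvgrPdist_lt : h0 => /(_ e e0); rewrite near_withinE.
apply: filterS => y hy; have [Oy|nOy] := pselect (Omega y).
  by rewrite -zero_extension_in //; apply: hy; exact: subset_closure.
by rewrite zero_extension_out // subrr normr0.
Qed.

Lemma weak_zero_extension : weak_solution Omega gamma f u -> weak_solution Omega gamma f zero_extension.
Proof.
move=> wu phi cphi; have [i e] := wu phi cphi; split.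
  apply: eq_integrable i => //; first by apply: lebesgue_measurable; exact: open_measurable_rV.
  by move=> y; rewrite inE => Oy; rewrite zero_extension_in.
have -> : \int[lebesgue R N]_(x in Omega) dot (gradient zero_extension x) (gradient phi x) =
   \int[lebesgue R N]_(x in Omega) dot (gradient u x) (gradient phi x).
  apply: eq_Rintegral => y; rewrite inE => Oy; congr (dot _ _).
  apply/rowP => i'; rewrite !mxE.
  exact: esym (is_derive_partial_ext 'e_i' oO zero_extension_in Oy).1.
have e1 : \int[lebesgue R N]_(x in Omega) (phi x / (zero_extension x `^ gamma)) =
    \int[lebesgue R N]_(x in Omega) (phi x / (u x `^ gamma)).
  by apply: eq_Rintegral => y; rewrite inE => Oy; rewrite -zero_extension_in.
have e2 : \int[lebesgue R N]_(x in Omega) (f x (zero_extension x) * phi x) =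
    \int[lebesgue R N]_(x in Omega) (f x (u x) * phi x).
  by apply: eq_Rintegral => y; rewrite inE => Oy; rewrite -zero_extension_in.
exact: etrans e (esym (congr2 +%R e1 e2)).
Qed.

End extension.

Section direction.
Context {R : realType} {N : nat}.
Implicit Types (nu x y : 'rV[R]_N) (Omega : set 'rV[R]_N).

Lemma reflectionN nu x : reflection (- nu) 0 x = reflection nu 0 x.
Proof. by rewrite /reflection dotNr scalerN -scaleNr; congr (_ + _ *: _); ring. Qed.

Lemma convex_dirN nu Omega : convex_dir nu Omega -> convex_dir (- nu) Omega.
Proof.
move=> cv x s Ox; rewrite scalerN -scaleNr => Oy t t01.
by rewrite scalerN -scaleNr -mulrN; exact: cv.
Qed.

Lemma symmetric_dirN nu Omega : symmetric_dir nu Omega -> symmetric_dir (- nu) Omega.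
Proof.
move=> sy; rewrite /symmetric_dir (_ : reflection (- nu) 0 = reflection nu 0) //.
by apply/funext => x; exact: reflectionN.
Qed.

Lemma reflection_normal nu : dot nu nu = 1 -> reflection nu 0 nu = - nu.
Proof.
move=> n1; rewrite /reflection n1 sub0r mulrN1 scaleNr scaler_nat mulr2n opprD.
by rewrite addrA subrr add0r.
Qed.

(** Conjugation by the reflection exchanges the two caps and the two
    directions. *)
Lemma monotone_symmetric_dirN nu Omega (f : 'rV[R]_N -> R -> R) : dot nu nu = 1 ->
  symmetric_dir nu Omega -> monotone_symmetric_dir nu Omega f ->
  monotone_symmetric_dir (- nu) Omega f.
Proof.
move=> n1 sy [fm fs].
have R0 x : left_cap (- nu) Omega x -> left_cap nu Omega (reflection nu 0 x).
  move=> [Ox /=]; rewrite dotNr => x0; split; first exact: reflection0_in.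
  by rewrite /= dot_reflection //; lra.
have fR x t : left_cap (- nu) Omega x -> 0 <= t -> f x t = f (reflection nu 0 x) t.
  by move=> /R0 cx t0; rewrite [RHS]fs // reflectionK.
split=> [t t0 x s s0 cx cy|x t cx t0]; last by rewrite reflectionN; exact: fR.
rewrite (fR _ _ cx t0) (fR _ _ cy t0) scalerN -scaleNr reflectionD reflection0Z.
rewrite (reflection_normal n1).
rewrite scaleNr scalerN opprK; apply: (fm t t0) => //; first exact: R0.
have := R0 _ cy; rewrite scalerN -scaleNr reflectionD reflection0Z.
rewrite (reflection_normal n1).
by rewrite scaleNr scalerN opprK.
Qed.

Lemma convex_dir_eball nu (r : R) : 0 < r -> dot nu nu = 1 -> convex_dir nu (@eball R N r).
Proof.
move=> r0 n1 x s; rewrite /eball /= !enorm_lt ?(ltW r0) // => hx.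
rewrite !dotE n1 (dotC nu x) => hy t /andP[t0 t1].
rewrite /= enorm_lt ?(ltW r0) // !dotE n1 (dotC nu x).
move: (dot x x) (dot x nu) hx hy => X c hx hy.
have h1 : 0 <= s ^+ 2 * (t - t ^+ 2) by rewrite mulr_ge0 ?sqr_ge0 //; nra.
have h2 : 0 < (1 - t) * (r ^+ 2 - X) + t * (r ^+ 2 - (X + s * c + (s * c + s * (s * 1)))).
  have [->|tn] := eqVneq t 0; first by rewrite subr0 mul1r mul0r addr0 subr_gt0.
  apply: ltr_wpDl; first by rewrite mulr_ge0 ?subr_ge0 ?(ltW hx).
  by rewrite mulr_gt0 ?subr_gt0 // lt_neqAle eq_sym tn.
move: h1 h2; lra.
Qed.

Lemma symmetric_dir_eball nu (r : R) : dot nu nu = 1 -> symmetric_dir nu (@eball R N r).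
Proof.
move=> n1; apply/seteqP; split=> [_ [x hx <-]|x hx].
  by move: hx; rewrite /eball /= /enorm dot_reflection0.
exists (reflection nu 0 x); last by rewrite reflectionK.
by move: hx; rewrite /eball /= /enorm dot_reflection0.
Qed.

(** Reflect across the perpendicular bisector, whose normal is x - y. *)
Lemma sphere_reflection x y : dot x x = dot y y -> x != y ->
  exists2 nu : 'rV[R]_N, enorm nu = 1 & reflection nu 0 x = y.
Proof.
move=> xy nxy; have [w wE] : exists w, w = x - y by exists (x - y).
have ww0 : dot w w != 0 by rewrite dot_eq0 wE subr_eq0.
have wwp : 0 < dot w w by rewrite lt_neqAle eq_sym ww0 dot_ge0.
have s0 : 0 < enorm w by rewrite sqrtr_gt0.
have ws : dot w w = enorm w ^+ 2 by rewrite sqr_enorm.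
exists ((enorm w)^-1 *: w).
  by apply/eqP; rewrite enorm_eq // expr1n !dotE ws; apply/eqP; field; rewrite gt_eqF.
have xw : 2 * dot x w = dot w w by rewrite wE !dotE (dotC y x) xy; ring.
rewrite /reflection !dotE scalerA.
rewrite (_ : _ * _ = - 1); first by rewrite scaleN1r wE opprB addrC subrK.
rewrite sub0r (_ : _ * _ = - (2 * dot x w) / enorm w ^+ 2); last by field; rewrite gt_eqF.
by rewrite xw ws mulNr divff // expf_neq0 // gt_eqF.
Qed.

End direction.

(** * The symmetry theorem *)

Theorem theorem1p1 (R : realType) (N : nat) (hN : (0 < N)%N)
    (gamma : R) (hgamma : 0 < gamma)
    (Omega : set 'rV[R]_N) (hOmega : bounded_smooth_domain Omega)
    (f : 'rV[R]_N -> R -> R) (hf : hp Omega f)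
    (u : 'rV[R]_N -> R)
    (hu0 : {within closure Omega, continuous u})
    (hu2 : is_Ck 2 Omega u)
    (hu : solution Omega gamma f u) :
  (forall nu : 'rV[R]_N, enorm nu = 1 ->
     convex_dir nu Omega -> symmetric_dir nu Omega ->
     monotone_symmetric_dir nu Omega f ->
     (forall x, Omega x -> u x = u (reflection nu 0 x)) /\
     nondecreasing_dir nu (left_cap nu Omega) u) /\
  (forall rad : R, 0 < rad -> Omega = eball rad ->
     (forall nu : 'rV[R]_N, enorm nu = 1 -> monotone_symmetric_dir nu Omega f) ->
     radially_decreasing rad u).
Proof.
case: hOmega => [_ oO _ bO _]; case: hu => [wu upos ubd]; case: hf => _ hL.
pose U := zero_extension Omega u.
have uU x : Omega x -> u x = U x by exact: zero_extension_in.
have cU : continuous U by exact: continuous_zero_extension.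
have U2 : is_Ck 2 Omega U by exact: is_Ck_ext oO uU hu2.
have Upos x : Omega x -> 0 < U x by move=> Ox; rewrite -uU //; exact: upos.
have U0 x : ~ Omega x -> U x = 0 by exact: zero_extension_out.
have wU : weak_solution Omega gamma f U by exact: weak_zero_extension.
have [B OB] := bounded_sqball bO.
have [M0 M00 UM0] := compact_bounded_fun cU (compact_sqball (y := 0) (r := B))
  (fun x nBx => U0 x (fun Ox => nBx (OB x Ox))).
pose M := M0 + 1.
have UM x : U x <= M by rewrite (le_trans (ler_norm _)) // (le_trans (UM0 x)) // lerDl.
have [L' hL'] := hL M (ltr_wpDl M00 ltr01).
pose L := `|L'|.
have fL x t1 t2 : Omega x -> 0 <= t1 <= M -> 0 <= t2 <= M ->
    `|f x t1 - f x t2| <= L * `|t1 - t2|.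
  move=> Ox h1 h2; apply: (le_trans (hL' x t1 t2 Ox h1 h2)).
  by rewrite ler_wpM2r // ler_norm.
(* Comparison in the directions nu and - nu. *)
have sym nu : enorm nu = 1 -> convex_dir nu Omega -> symmetric_dir nu Omega ->
    monotone_symmetric_dir nu Omega f -> forall x, Omega x -> U x = U (reflection nu 0 x).
  move=> /enorm1_dot n1 cv sy mf.
  have n1' : dot (- nu) (- nu) = 1 by rewrite dotNl dotNr opprK.
  have le1 := reflection0_le hgamma oO bO cU U2 Upos U0 wU UM (normr_ge0 L') fL n1 cv sy mf.
  have le2 := reflection0_le hgamma oO bO cU U2 Upos U0 wU UM (normr_ge0 L') fL n1'
    (convex_dirN cv) (symmetric_dirN sy) (monotone_symmetric_dirN n1 sy mf).
  have key x : Omega x -> dot x nu < 0 -> U x = U (reflection nu 0 x).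
    move=> Ox x0; apply/eqP; rewrite eq_le le1 //=.
    rewrite -[X in _ <= U X](reflectionK 0 n1 x) -[X in _ <= U X]reflectionN.
    apply: le2; first exact: reflection0_in.
    by rewrite dotNr dot_reflection // mulr0 sub0r opprK.
  move=> x Ox; have [x0|x0|x0] := ltgtP (dot x nu) 0; first exact: key.
    rewrite [RHS]key ?reflectionK //; first exact: reflection0_in.
    by rewrite dot_reflection // mulr0 sub0r oppr_lt0.
  by rewrite /reflection x0 subrr mulr0 scale0r addr0.
split.
  move=> nu nu1 cv sy mf; have n1 := enorm1_dot nu1; split.
    move=> x Ox; rewrite !uU //; first exact: sym.
    exact: reflection0_in.
  move=> x s s0 cx cy; rewrite !uU; [|by case: cy|by case: cx].
  exact: (nondecreasing_cap hgamma oO bO cU U2 Upos U0 wU UM (normr_ge0 L') fL n1 cv sy mf).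
move=> rad rad0 OE mf.
pose i0 : 'I_N := Ordinal hN.
pose e0 : 'rV[R]_N := 'e_i0.
have e01 : dot e0 e0 = 1 by rewrite dot_delta mxE !eqxx.
have en1 : enorm (- e0) = 1 by rewrite /enorm dotNl dotNr opprK e01 sqrtr1.
have n1 := enorm1_dot en1.
have cv nu : dot nu nu = 1 -> convex_dir nu Omega.
  by move=> h; rewrite OE; exact: convex_dir_eball.
have sy nu : dot nu nu = 1 -> symmetric_dir nu Omega.
  by move=> h; rewrite OE; exact: symmetric_dir_eball.
have axis (r : R) : 0 <= r -> enorm (r *: e0) = r.
  by move=> r0; rewrite /enorm dotZl dotZr e01 mulr1 -expr2 sqrtr_sqr ger0_norm.
have in_axis (r : R) : 0 <= r < rad -> Omega (r *: e0).
  by move=> /andP[r0 rr]; rewrite OE /eball /= axis.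
exists (fun r => U (0 + r *: e0)); split.
  move=> x Bx; have Ox : Omega x by rewrite OE.
  rewrite uU // add0r; have [->|ne] := eqVneq x (enorm x *: e0); first by rewrite axis ?enorm_ge0.
  have xx : dot x x = dot (enorm x *: e0) (enorm x *: e0).
    by rewrite dotZl dotZr e01 mulr1 -expr2 sqr_enorm.
  have [nu nu1 <-] := sphere_reflection xx ne.
  by apply: sym => //; [apply: cv|apply: sy|exact: mf]; exact: enorm1_dot.
move=> r /andP[r0 rr].
have Or : Omega (r *: e0) by apply: in_axis; rewrite ltW.
have l0 : - r < 0 by rewrite oppr_lt0.
have bl := cap_le_all hgamma oO bO cU U2 Upos U0 wU UM (normr_ge0 L') fL n1
  (cv _ n1) (sy _ n1) (mf _ en1) l0.
have dr : dot (r *: e0) (- e0) = - r by rewrite dotZl dotNr e01 mulrN1.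
have := hopf_hyperplane hgamma oO bO cU U2 Upos U0 wU UM (normr_ge0 L') fL n1
  (cv _ n1) (sy _ n1) (mf _ en1) l0 bl Or dr.
have -> : \sum_i (- e0) ord0 i * partial i U (r *: e0) = - partial i0 U (r *: e0).
  rewrite (bigD1 i0) //= big1 ?addr0.
    by rewrite !mxE !eqxx mulN1r.
  by move=> j ji; rewrite !mxE (negbTE ji) andbF oppr0 mul0r.
rewrite oppr_gt0 => neg.
have dU : derivable U (0 + r *: e0) e0.
  by rewrite add0r; have [] := C2_twice_derivable U2 Or i0.
have [dv ev] := is_derive_line dU; split; first exact: dv.
by rewrite derive1E ev add0r.
Qed.
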